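(* Let $n\ge 3$, $p$ a prime, $b_1,b_2\in\mathbb{Z}_p$, and let \begin{align*} V_n(\mathbb{Z}_p)_{a_1 = b_1, a_2 = b_2} &= \{x^n + a_1 x^{n - 1} + \ldots + a_n \in \mathbb{Z}_p[x] : a_1 = b_1, a_2 = b_2\},\\ V_n(\mathbb{Z}_p)_{a_1 = b_1} &= \{x^n + a_1 x^{n - 1} + \ldots + a_n \in \mathbb{Z}_p[x] : a_1 = b_1\}. \end{align*} For odd $p$, an integer $m\ge 0$ and $b\in\mathbb{F}_p$ define \[ \delta_{m, p}(b) = \begin{cases} -\left(\frac{-1}{p}\right)^{(m - 1)/2} p^{(m + 1)/2} & \text{if } 2 \nmid m \text{ and } b \neq 0, \\ \left(\frac{-1}{p}\right)^{(m - 1)/2} (p - 1) p^{(m + 1)/2} & \text{if } 2 \nmid m \text{ and } b = 0, \\ \left(\frac{b}{p}\right) \left(\frac{-1}{p}\right)^{m/2} p^{m/2 + 1} & \text{if } 2 \mid m, \end{cases} \] and for integers $t\ge0$, \[ H_{n, p, t}(b) = \sum_{\substack{0\le k \leq n - 2 \\ p \nmid n - k}} (-1)^{\lceil k/2 \rceil} \left(\frac{n - k}{p}\right) \left(\frac{2}{p}\right)^{\lfloor k/2 \rfloor} \delta_{\lceil k/2 \rceil + t + 1, p}(b) + \sum_{\substack{0 \leq k \leq n - 2 \\ p \mid n - k}} (-1)^{\lceil k/2 \rceil} \left(\frac{2}{p}\right)^{\lfloor k/2 \rfloor} p\, \delta_{\lceil k/2 \rceil + t, p}(b). \] Write $V=V_n(\mathbb{Z}_p)_{a_1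 = b_1, a_2 = b_2}$ and $V'=V_n(\mathbb{Z}_p)_{a_1 = b_1}$. (i) If $p = 2$, then $P_1^{\mathrm{sqf}}(V) = 0$, $P^{\max}(V) = P^{\max}(V')$ and $P_0^{\mathrm{sqf}}(V) = P_0^{\mathrm{sqf}}(V')$. (ii) If $p$ is odd, $p \mid n$ and $p \nmid b_1$, then $P^{\max}(V) = P^{\max}(V')$, $P_0^{\mathrm{sqf}}(V) = P_0^{\mathrm{sqf}}(V')$, $P_1^{\mathrm{sqf}}(V) = P_1^{\mathrm{sqf}}(V')$. (iii) If $p$ is odd, $p \mid n$ and $p \mid b_1$, then \begin{align*} P^{\max}(V) &= P^{\max}(V') + \frac{(-1)^{\lfloor n/2 \rfloor}}{p^{n + \lfloor n/2 \rfloor}} \left(\frac{2}{p}\right)^{\lfloor n/2 \rfloor} \delta_{\lceil n/2 \rceil + 1, p}(2 \overline{b_2}), \\ P_0^{\mathrm{sqf}}(V) &= P_0^{\mathrm{sqf}}(V') + \frac{(-1)^{\lfloor n/2 \rfloor}}{p^n} \left(\frac{2}{p}\right)^{\lfloor n/2 \rfloor} \delta_{\lceil n/2 \rceil + 1, p}(2 \overline{b_2}), \\ P_1^{\mathrm{sqf}}(V) &= P_1^{\mathrm{sqf}}(V') + \frac{(-1)^n (1 - 1/p)}{p^n} H_{n, p, 1}(2 \overline{b_2}). \end{align*} (iv) If $p$ is odd and $p \nmid n$, then, with $\beta = 2 \overline{b_2} - (1 - 1/\overline{n}) \overline{b_1}^2 \in \mathbb{F}_p$, \begin{align*} P^{\max}(V)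 &= P^{\max}(V') + \frac{(-1)^{\lfloor n/2 \rfloor}}{p^{n + \lfloor n/2 \rfloor}} \left(\frac{n}{p}\right) \left(\frac{2}{p}\right)^{\lfloor n/2 \rfloor} \delta_{\lceil n/2 \rceil, p}(\beta), \\ P_0^{\mathrm{sqf}}(V) &= P_0^{\mathrm{sqf}}(V') + \frac{(-1)^{\lfloor n/2 \rfloor}}{p^n} \left(\frac{n}{p}\right) \left(\frac{2}{p}\right)^{\lfloor n/2 \rfloor} \delta_{\lceil n/2 \rceil, p}(\beta), \\ P_1^{\mathrm{sqf}}(V) &= P_1^{\mathrm{sqf}}(V') + \frac{(-1)^n (1 - 1/p)}{p^n} \left(\frac{n}{p}\right) H_{n, p, 0}(\beta). \end{align*}
   Context: $V_n(\mathbb{Z}_p)$ is the set of monic degree-$n$ polynomials over $\mathbb{Z}_p$; a subset defined by fixing $k$ coefficients is identified with $\mathbb{Z}_p^{n-k}$ via the remaining coefficients, with Haar measure. Densities are ratios of measures: $P_0^{\mathrm{sqf}}$ is the density of $f$ with $p\nmid\mathrm{Disc}(f)$, $P_1^{\mathrm{sqf}}$ the density of $f$ with $v_p(\mathrm{Disc}(f))=1$, and $P^{\max}$ the density of $f$ with $\mathbb{Z}_p[x]/(f(x))$ the maximal order of $\mathbb{Q}_p[x]/(f(x))$. Bars denote reduction mod $p$, $1/\overline{n}$ is the inverse of $n$ in $\mathbb{F}_p$, and $\left(\frac{\cdot}{p}\right)$ is the Legendre symbol (value $0$ at $0$). *)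

(* Defs.v *)
From HB Require Import structures.
From mathcomp Require Import all_boot all_order all_algebra.
From mathcomp Require Import all_classical all_reals all_analysis.
From mathcomp Require Import fraction qpoly.

Set Implicit Arguments.
Unset Strict Implicit.
Unset Printing Implicit Defensive.

Import Order.TTheory GRing.Theory Num.Theory.
Local Open Scope classical_set_scope.
Local Open Scope ring_scope.

(* Z_p as the inverse limit of the Z/p^k: the term of index k is the canonical
   representative, in [0, p^k), of the residue class modulo p^k.  The single
   condition below enforces both the range and the compatibility. *)
Record padic (p : nat) (p_pr : prime p) : Type := Padic {
  padic_seq :> nat -> int;
  padic_coherent : forall k,
    padic_seq k = (padic_seq k.+1 %% (p ^ k)%N%:Z)%Z }.

Section PadicRing.
Variables (p : nat) (p_pr : prime p).
Local Notation Zp := (padic p_pr).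
Local Notation P k := ((p ^ k)%N%:Z).

Implicit Types x y z : Zp.

Lemma padic_ext x y : (forall k, x k = y k) -> x = y.
Proof.
case: x y => [x xP] [y yP] /= e.
have {}e : x = y by apply: funext.
by subst y; congr Padic; apply: Prop_irrelevance.
Qed.

HB.instance Definition _ := gen_eqMixin Zp.
HB.instance Definition _ := gen_choiceMixin Zp.

Lemma modz_tower (a : int) k l : (k <= l)%N ->
  ((a %% P l)%Z %% P k)%Z = (a %% P k)%Z.
Proof.
move=> kl; have d : (P k %| P l)%Z by apply: (dvdn_exp2l p kl).
rewrite {2}(divz_eq a (P l)).
by have /dvdzP[c ->] := d; rewrite mulrA modzMDl.
Qed.

Fact padic_of_subproof (a : nat -> int) :
  (forall k, (a k.+1 = a k %[mod P k])%Z) ->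
  forall k, (a k %% P k)%Z = ((a k.+1 %% P k.+1)%Z %% P k)%Z.
Proof. by move=> h k; rewrite modz_tower // h. Qed.

Definition padic_of (a : nat -> int)
    (h : forall k, (a k.+1 = a k %[mod P k])%Z) : Zp :=
  Padic p_pr (padic_of_subproof h).

Lemma padicS x k : (x k.+1 = x k %[mod P k])%Z.
Proof. by rewrite [x k]padic_coherent modz_mod. Qed.

Lemma padic_mod x k : (x k %% P k)%Z = x k.
Proof. by rewrite [x k]padic_coherent modz_mod. Qed.

Lemma padic_le x k l : (k <= l)%N -> x k = (x l %% P k)%Z.
Proof.
elim: l => [|l IH]; first by rewrite leqn0 => /eqP->; rewrite padic_mod.
rewrite leq_eqVlt => /orP[/eqP->|kl]; first by rewrite padic_mod.
by rewrite (IH kl) (padic_coherent x l) modz_tower.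
Qed.

Fact padic_const_subproof (a : int) k : (a = a %[mod P k])%Z.
Proof. by []. Qed.
Fact padic_add_subproof x y k : (x k.+1 + y k.+1 = x k + y k %[mod P k])%Z.
Proof. by rewrite -modzDm !padicS modzDm. Qed.
Fact padic_opp_subproof x k : (- x k.+1 = - x k %[mod P k])%Z.
Proof. by rewrite -modzNm padicS modzNm. Qed.
Fact padic_mul_subproof x y k : (x k.+1 * y k.+1 = x k * y k %[mod P k])%Z.
Proof. by rewrite -modzMm !padicS modzMm. Qed.

Definition padic_const (a : int) : Zp := padic_of (padic_const_subproof a).
Definition padic_add x y : Zp := padic_of (padic_add_subproof x y).
Definition padic_opp x : Zp := padic_of (padic_opp_subproof x).
Definition padic_mul x y : Zp := padic_of (padic_mul_subproof x y).

Fact padic_addA : associative padic_add.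
Proof. by move=> x y z; apply: padic_ext => k /=; rewrite modzDmr modzDml addrA. Qed.
Fact padic_addC : commutative padic_add.
Proof. by move=> x y; apply: padic_ext => k /=; rewrite addrC. Qed.
Fact padic_add0 : left_id (padic_const 0) padic_add.
Proof. by move=> x; apply: padic_ext => k /=; rewrite mod0z add0r padic_mod. Qed.
Fact padic_addN : left_inverse (padic_const 0) padic_opp padic_add.
Proof. by move=> x; apply: padic_ext => k /=; rewrite modzDml addNr. Qed.

HB.instance Definition _ :=
  GRing.isZmodule.Build Zp padic_addA padic_addC padic_add0 padic_addN.

Fact padic_mulA : associative padic_mul.
Proof. by move=> x y z; apply: padic_ext => k /=; rewrite modzMmr modzMml mulrA. Qed.
Fact padic_mulC : commutative padic_mul.
Proof. by move=> x y; apply: padic_ext => k /=; rewrite mulrC. Qed.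
Fact padic_mul1 : left_id (padic_const 1) padic_mul.
Proof. by move=> x; apply: padic_ext => k /=; rewrite modzMml mul1r padic_mod. Qed.
Fact padic_mulDl : left_distributive padic_mul padic_add.
Proof.
by move=> x y z; apply: padic_ext => k /=; rewrite modzMml modzDm mulrDl.
Qed.
Fact padic_1neq0 : padic_const 1 != padic_const 0.
Proof.
apply/eqP => /(congr1 (fun x : Zp => x 1%N)) /=.
by rewrite expn1 mod0z modz_small // ltz_nat prime_gt1.
Qed.

HB.instance Definition _ := GRing.Zmodule_isComNzRing.Build Zp
  padic_mulA padic_mulC padic_mul1 padic_mulDl padic_1neq0.

Definition padic_unit : {pred Zp} := fun x => `[< exists y, y * x = 1 >].
Definition padic_inv x : Zp := xget x [set y | y * x = 1].

Fact padic_mulV : {in padic_unit, left_inverse 1 padic_inv *%R}.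
Proof.
move=> x /asboolP [y yx].
by apply: (@xgetPex _ x [set y | y * x = 1]); exists y.
Qed.
Fact padic_unitP x y : y * x = 1 -> padic_unit x.
Proof. by move=> yx; apply/asboolP; exists y. Qed.
Fact padic_inv_out : {in [predC padic_unit], padic_inv =1 id}.
Proof.
move=> x /asboolPn nx; apply: xgetPN => y yx.
by apply: nx; exists y.
Qed.

HB.instance Definition _ := GRing.ComNzRing_hasMulInverse.Build Zp
  padic_mulV padic_unitP padic_inv_out.

Lemma padic_neq0 x : x != 0 -> exists k, x k != 0.
Proof.
move=> x0; apply/not_existsP => h; case/eqP: x0; apply: padic_ext => k /=.
by rewrite mod0z; apply/eqP; apply/negPn/negP; apply: h.
Qed.

Fact padic_integral : GRing.integral_domain_axiom Zp.
Proof.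
move=> x y xy; rewrite -[_ || _]negbK; apply/negP.
rewrite negb_or => /andP[/padic_neq0[k xk] /padic_neq0[l yl]].
move: xy => /(congr1 (fun x : Zp => x (k + l)%N)) /= /eqP; rewrite mod0z.
rewrite (padic_le x (leq_addr l k)) in xk.
rewrite (padic_le y (leq_addl k l)) in yl.
set a := x _ in xk *; set b := y _ in yl *.
have pk_gt0 m : (0 < p ^ m)%N by rewrite expn_gt0 prime_gt0.
have val (c : int) m : (c %% P m)%Z != 0 -> (0 < `|c|)%N /\ (logn p `|c| < m)%N.
  move=> cm; have c0 : (0 < `|c|)%N.
    by rewrite absz_gt0; apply: contra cm => /eqP->; rewrite mod0z.
  split=> //; rewrite ltnNge; apply: contra cm.
  by rewrite -pfactor_dvdn // => ?; apply/eqP/dvdz_mod0P.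
have [a0 la] := val _ _ xk; have [b0 lb] := val _ _ yl.
move=> /eqP/dvdz_mod0P d.
have : (p ^ (k + l) %| `|a| * `|b|)%N by rewrite -abszM; apply: d.
rewrite pfactor_dvdn ?muln_gt0 ?a0 // lognM // => le.
have lt : (logn p `|a| + logn p `|b| < k + l)%N.
  by rewrite -addSn leq_add // ltnW.
by move: (leq_ltn_trans le lt); rewrite ltnn.
Qed.

HB.instance Definition _ := GRing.ComUnitRing_isIntegral.Build Zp padic_integral.

HB.instance Definition _ := isPointed.Build Zp 0.

(* The p-adic topology: a base is given by the balls x + p^k Z_p. *)
Definition padic_ball (c : Zp * nat) : set Zp := [set y | y c.2 = c.1 c.2].

Fact padic_ball_cover : \bigcup_(i in setT) padic_ball i = setT.
Proof. by rewrite predeqE => x; split=> // _; exists (x, 0%N). Qed.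
Fact padic_ball_join i j t : setT i -> setT j -> padic_ball i t ->
  padic_ball j t ->
  exists k, [/\ setT k, padic_ball k t & padic_ball k `<=` padic_ball i `&` padic_ball j].
Proof.
case: i j => [x k] [y l] _ _; rewrite /padic_ball /= => ti tj.
exists (t, maxn k l); split=> // z /= zt; split.
  by rewrite -ti (padic_le z (leq_maxl k l)) zt -padic_le // leq_maxl.
by rewrite -tj (padic_le z (leq_maxr k l)) zt -padic_le // leq_maxr.
Qed.

HB.instance Definition _ :=
  @isBaseTopological.Build Zp (Zp * nat)%type setT padic_ball
    padic_ball_cover padic_ball_join.

Definition pdvd (k : nat) (x : Zp) : Prop := exists y : Zp, x = p%:R ^+ k * y.

Definition has_valuation (x : Zp) (k : nat) : Prop :=
  pdvd k x /\ ~ pdvd k.+1 x.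

Definition residue (x : Zp) : 'F_p := (x 1%N)%:~R.

(* Discriminant of a monic polynomial. *)
Definition disc (f : {poly Zp}) : Zp :=
  (-1) ^+ 'C((size f).-1, 2) * resultant f f^`().

End PadicRing.

Section MaximalOrder.
Variables (p : nat) (p_pr : prime p).
Local Notation Zp := (padic p_pr).
Local Notation Qp := {fraction Zp}.
Local Notation toQp := (@FracField.tofrac Zp).

(* Orders of a Q_p-algebra: subrings that are finitely generated as Z_p-modules
   and span the algebra over Q_p. *)
Definition is_order (K : algType Qp) (O : set K) : Prop :=
  [/\ O 1,
      (forall x y, O x -> O y -> O (x - y)),
      (forall x y, O x -> O y -> O (x * y)) &
      exists m (e : 'I_m -> K),
        O = [set \sum_(i < m) toQp (c i) *: e i | c in [set: 'I_m -> Zp]] /\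
        [set \sum_(i < m) c i *: e i | c in [set: 'I_m -> Qp]] = [set: K]].

Definition is_maximal_order (K : algType Qp) (O : set K) : Prop :=
  is_order O /\ forall O' : set K, is_order O' -> O `<=` O' -> O' = O.

(* Q_p[x]/(f) and the image in it of Z_p[x]/(f).  The library quotient
   {poly %/ h} is R[x]/(h) only when h is monic of positive degree. *)
Definition is_maximal (f : {poly Zp}) : Prop :=
  let F := map_poly toQp f in
  @is_maximal_order {poly %/ F}
    [set in_qpoly F (map_poly toQp g) | g in [set: {poly Zp}]].

End MaximalOrder.

Section Density.
Variables (R : realType) (p : nat) (p_pr : prime p).
Local Notation Zp := (padic p_pr).

Definition Zp_borel (d : nat) := g_sigma_algebraType (@open 'rV[Zp]_d).

Definition is_haar (d : nat) (mu : {measure set (Zp_borel d) -> \bar R}) : Prop :=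
  [/\ (forall (x : 'rV[Zp]_d) (A : set (Zp_borel d)), measurable A ->
         mu [set x + a | a in (A : set 'rV[Zp]_d)] = mu A),
      (forall K : set 'rV[Zp]_d, compact K -> (mu K < +oo)%E) &
      (forall U : set 'rV[Zp]_d, open U -> U !=set0 -> (0 < mu U)%E)].

Definition V_fix1 (n : nat) (b1 : Zp) : set {poly Zp} :=
  [set f | [/\ f \is monic, size f = n.+1 & f`_(n - 1)%N = b1]].

Definition V_fix2 (n : nat) (b1 b2 : Zp) : set {poly Zp} :=
  [set f | [/\ f \is monic, size f = n.+1, f`_(n - 1)%N = b1 & f`_(n - 2)%N = b2]].

(* V is a set of polynomials in which the coefficients of degree >= d are
   fixed; poly_rV identifies it with Z_p^d through the coefficients of degree
   < d.  The density of S in V is a ratio of Haar measures. *)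
Definition density (d : nat) (mu : {measure set (Zp_borel d) -> \bar R})
    (V S : set {poly Zp}) : R :=
  fine (mu [set poly_rV f | f in V `&` S]) / fine (mu [set poly_rV f | f in V]).

Definition P0sqf d (mu : {measure set (Zp_borel d) -> \bar R}) V : R :=
  density mu V [set f | ~ pdvd 1 (disc f)].

Definition P1sqf d (mu : {measure set (Zp_borel d) -> \bar R}) V : R :=
  density mu V [set f | has_valuation (disc f) 1].

Definition Pmax d (mu : {measure set (Zp_borel d) -> \bar R}) V : R :=
  density mu V [set f | is_maximal f].

End Density.

Section Formulas.
Variable p : nat.

(* Meaningful for p an odd prime. *)
Definition legendre (b : 'F_p) : int :=
  if b == 0 then 0 else if [exists c : 'F_p, c ^+ 2 == b] then 1 else -1.

Definition delta (m : nat) (b : 'F_p) : int :=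
  if odd m then
    if b != 0 then - (legendre (-1) ^+ (m - 1)%N./2 * p%:Z ^+ (m + 1)%N./2)
    else legendre (-1) ^+ (m - 1)%N./2 * (p%:Z - 1) * p%:Z ^+ (m + 1)%N./2
  else legendre b * legendre (-1) ^+ m./2 * p%:Z ^+ (m./2 + 1)%N.

Definition Hsum (n t : nat) (b : 'F_p) : int :=
  \sum_(0 <= k < (n - 2).+1 | ~~ (p %| n - k)%N)
     (-1) ^+ uphalf k * legendre (n - k)%N%:R * legendre 2%:R ^+ k./2
       * delta (uphalf k + t + 1)%N b
  + \sum_(0 <= k < (n - 2).+1 | (p %| n - k)%N)
     (-1) ^+ uphalf k * legendre 2%:R ^+ k./2 * p%:Z * delta (uphalf k + t)%N b.

End Formulas.

(* Main.v *)
(** Haar measure on Z_p^d gives equal mass to the cosets of p^2 Z_p^d, and each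
    of the three conditions on a monic f depends only on f mod p^2, so each
    density is an average over F_p^d of a weight A(f mod p).  For p not dividing
    Disc f, A is the indicator of separability; for v_p(Disc f) = 1 it is
    1 - 1/p if p is odd and f mod p has a single double root and is otherwise
    separable, and 0 otherwise; for maximality, by Dedekind's criterion, it is the proportion
    of units modulo D, where f mod p = D^2 g with g separable.

    Fixing a_1 (and a_2) is detected by the additive characters of the first two
    power sums of the roots (for p = 2, by characters of order 4).  These are multiplicative in f, and their sums over
    the monic polynomials of degree m vanish for m > 1 (the L-function has
    degree 1); hence the weighted sums over squarefree, maximal and
    one-double-root polynomials are products of Gauss sums.  Inverting the
    Fourier transform yields the formulas. *)

Require Import Defs.
From HB Require Import structures.
From mathcomp Require Import all_boot all_order all_algebra all_field.
From mathcomp Require Import all_classical all_reals all_analysis.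
From mathcomp Require Import fraction qpoly ring zify.

Set Implicit Arguments.
Unset Strict Implicit.
Unset Printing Implicit Defensive.

Import Order.TTheory GRing.Theory Num.Theory.
Local Open Scope ring_scope.

(** * Monic polynomials over F_p and their square decomposition *)

Section Monics.
Variable F : finFieldType.
Implicit Types f g d : {poly F}.

(** The characters that ignore the second power sum detect [a_1] alone, which is why the results
    compare V with V': only the characters chi with a nonzero second component remain. For odd p,
    chi^2 is again of this type, so the unique writing f = d^2 g with g separable turns the degree-1
    L-functions of chi and chi^2 into the series (1 + L u) / (1 + L2 u^2) of separable sums. Here L
    and L2 are Gauss sums up to signs and phases; floor(n/2) counts the factors L2 and ceil(n/2) all
    Gauss sums. The phase is quadratic in the first parameter, with coefficient proportional to n:
    if p divides n it disappears, and summing over that parameter forces p | b_1; otherwise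
    completing the square brings one more Gauss sum. For p = 2 the sum of chi^2 vanishes already in
    degree 1, so the separable and maximal sums vanish from degree 2 on. Two constraints shape the
    rest. Character sums live in [algC] and densities in an arbitrary real field, so the identities
    pass through the rationals. The degree of f' can drop modulo p, so Sylvester matrices are given
    a fixed shape. *)

Definition monics (m : nat) : seq {poly F} :=
  [seq 'X^m + rVpoly v | v : 'rV[F]_m].

Lemma size_rVpoly (R : nzRingType) m (v : 'rV[R]_m) : (size (rVpoly v) <= m)%N.
Proof. exact: size_poly. Qed.

Lemma mem_monics m f : (f \in monics m) = (f \is monic) && (size f == m.+1).
Proof.
apply/fintype.imageP/andP => [[v _ ->]|[fm /eqP sf]].
  have lt : (size (rVpoly v) < size ('X^m : {poly F}))%N.
    by rewrite size_polyXn ltnS size_rVpoly.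
  by rewrite monicE lead_coefDl // lead_coefXn size_polyDl // size_polyXn.
have le : (size (f - 'X^m)%R <= m)%N.
  apply/leq_sizeP => j; rewrite leq_eqVlt => /predU1P[<-|lt].
    rewrite coefB coefXn eqxx; move: fm; rewrite monicE /lead_coef sf /=.
    by move=> /eqP->; rewrite subrr.
  by rewrite coefB coefXn gtn_eqF // nth_default ?subr0 // sf.
by exists (poly_rV (f - 'X^m)) => //; rewrite poly_rV_K // addrC subrK.
Qed.

Lemma monics_uniq m : uniq (monics m).
Proof.
rewrite map_inj_uniq ?enum_uniq // => u v /addrI e.
by rewrite -(rVpolyK u) e rVpolyK.
Qed.

Lemma monicsP m f : f \is monic -> size f = m.+1 -> f \in monics m.
Proof. by move=> fm sf; rewrite mem_monics fm sf eqxx. Qed.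

Lemma monics_monic m f : f \in monics m -> f \is monic.
Proof. by rewrite mem_monics => /andP[]. Qed.

Lemma monics_size m f : f \in monics m -> size f = m.+1.
Proof. by rewrite mem_monics => /andP[_ /eqP]. Qed.

Lemma monicsM m k f g : f \in monics m -> g \in monics k -> f * g \in monics (m + k).
Proof.
move=> fm gk; apply: monicsP; first by rewrite rpredM ?(monics_monic fm) ?(monics_monic gk).
rewrite size_Mmonic ?monic_neq0 ?(monics_monic fm) ?(monics_monic gk) //.
by rewrite (monics_size fm) (monics_size gk) addnS.
Qed.

Lemma monics0 : monics 0 = [:: 1].
Proof.
apply: perm_small_eq => //; apply: uniq_perm => //; first exact: monics_uniq.
move=> f; rewrite mem_monics inE; apply/andP/eqP => [[fm sf]|->].
  move: fm; rewrite (size1_polyC (eq_leq (eqP sf))) monicE lead_coefC => /eqP->.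
  by [].
by rewrite monic1 size_poly1.
Qed.

Lemma big_monics (V : nmodType) m (H : {poly F} -> V) :
  \sum_(f <- monics m) H f = \sum_(v : 'rV[F]_m) H ('X^m + rVpoly v).
Proof. by rewrite big_image. Qed.

Lemma monicsM_dvd m k d g : d \in monics k -> (k <= m)%N ->
  (d * g \in monics m) = (g \in monics (m - k)).
Proof.
move=> dk km; apply/idP/idP => [|gm]; last first.
  by rewrite -(subnKC km) monicsM // subnKC.
rewrite !mem_monics monicMl ?(monics_monic dk) //.
case/andP=> gm /eqP; rewrite gm size_Mmonic ?monic_neq0 ?(monics_monic dk) //.
by rewrite (monics_size dk) addSn /= => e; rewrite -(addKn k (size g)) e subSn.
Qed.

Lemma big_monics_dvd (V : nmodType) m k d (H : {poly F} -> V) :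
  d \in monics k -> (k <= m)%N ->
  \sum_(f <- monics m | d %| f) H f = \sum_(g <- monics (m - k)) H (d * g).
Proof.
move=> dk km; rewrite -big_filter -(big_map (fun g => d * g) xpredT H).
have d0 := monic_neq0 (monics_monic dk).
apply: perm_big; apply: uniq_perm; first by rewrite filter_uniq ?monics_uniq.
  by rewrite map_inj_uniq ?monics_uniq //; apply: mulfI.
move=> f; rewrite mem_filter; apply/andP/mapP => [[/dvdpP[g ->]]|[g gm ->]].
  by rewrite mulrC (monicsM_dvd _ dk km) => gm; exists g.
by rewrite dvdp_mulIl (monicsM_dvd _ dk km).
Qed.

Lemma big_monics1 (V : nmodType) (H : {poly F} -> V) :
  \sum_(f <- monics 1) H f = \sum_(r : F) H ('X - r%:P).
Proof.
rewrite -big_enum /= -(big_map (fun r => 'X - r%:P) xpredT H).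
apply: perm_big; apply: uniq_perm; first exact: monics_uniq.
  rewrite map_inj_uniq ?enum_uniq // => a b /addrI /oppr_inj /polyC_inj //.
move=> f; rewrite mem_monics; apply/andP/mapP => [[fm /eqP sf]|[r _ ->]].
  exists (- f`_0); rewrite ?mem_enum //; apply/polyP => -[|[|i]].
  - by rewrite coefB coefX coefC /= sub0r opprK.
  - rewrite coefB coefX coefC subr0; move: fm; rewrite monicE /lead_coef sf.
    by move=> /eqP.
  by rewrite nth_default ?sf // coefB coefX coefC subr0.
by rewrite monicXsubC size_XsubC.
Qed.

Lemma card_monics m : size (monics m) = (#|F| ^ m)%N.
Proof. by rewrite size_map -cardE card_mx mul1n. Qed.

Lemma dvd_monics d f : f \is monic -> d %| f ->
  exists k d', d' \in monics k /\ d' %= d.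
Proof.
move=> fm df; have d0 : d != 0 by apply: contraTneq df => ->; rewrite dvd0p monic_neq0.
exists (size d).-1, ((lead_coef d)^-1 *: d).
have ld : lead_coef d != 0 by rewrite lead_coef_eq0.
split; last by rewrite eqp_scale // invr_eq0.
apply: monicsP; first by rewrite monicE lead_coefZ mulVf.
by rewrite size_scale ?invr_eq0 // prednK // size_poly_gt0.
Qed.

End Monics.

(** * Square factors, separability and the unique double root over F_p *)

Section Squarefree.
Variables (p : nat) (p_pr : prime p).
Local Notation F := 'F_p.
Implicit Types f g d : {poly F}.

(** All exponents of [f] are multiples of p, and the coefficients, lying in F_p, are their own p-th
    powers; so f(x) = g(x^p) = g(x)^p. *)
Lemma deriv_eq0_pth_power f : f^`() = 0 -> exists g, f = g ^+ p.
Proof.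
move=> f'0; pose g := \poly_(i < size f) f`_(i * p)%N; exists g.
have pch : p \in [pchar {poly F}] by rewrite pchar_poly pchar_Fp.
have -> : g ^+ p = \sum_(i < size f) f`_(i * p)%N *: 'X^(i * p).
  rewrite /g poly_def -[_ ^+ p]/(pFrobenius_aut pch _) rmorph_sum /=.
  apply: eq_bigr => i _; rewrite pFrobenius_autE exprZn -exprM; congr (_ *: _).
  by have := expf_card f`_(i * p)%N; rewrite card_Fp.
apply/polyP => k; rewrite coef_sum.
have [/dvdnP[j ->]|npk] := boolP (p %| k)%N.
  have [lt|ge] := ltnP j (size f).
    rewrite (bigD1 (Ordinal lt)) //= coefZ coefXn eqxx mulr1 big1 ?addr0 // => i ij.
    rewrite coefZ coefXn eqn_pmul2r ?prime_gt0 // eq_sym.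
    by rewrite (negPf (ij : (i != j :> nat))) mulr0.
  rewrite nth_default; last by rewrite (leq_trans ge) // leq_pmulr ?prime_gt0.
  rewrite big1 // => i _; rewrite coefZ coefXn eqn_pmul2r ?prime_gt0 //.
  by rewrite gtn_eqF ?mulr0 // (leq_trans _ ge).
rewrite big1 => [|i _]; last first.
  rewrite coefZ coefXn; case: eqP => [e|]; last by rewrite mulr0.
  by rewrite e dvdn_mull in npk.
case: k npk => [|k npk]; first by rewrite dvdn0.
have := congr1 (fun q : {poly F} => q`_k) f'0; rewrite coef_deriv coef0 -mulr_natr.
move/eqP; rewrite mulf_eq0 => /predU1P[//|].
by rewrite -(dvdn_pcharf (pchar_Fp p_pr)) (negPf npk).
Qed.

(** Let h = gcd(f, f') and f = q h. A common factor of h and q has its square dividing f. If h and q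
    are coprime, h divides f' = q' h + q h', hence h'; by degree h' = 0, and h is a p-th power. *)
Lemma nonseparable_square f : f \is monic -> ~~ separable_poly f ->
  exists2 d : {poly F}, (1 < size d)%N & d ^+ 2 %| f.
Proof.
move=> fm; rewrite unlock coprimep_def; set h := gcdp f f^`() => sh1.
have f0 := monic_neq0 fm.
have h0 : h != 0 by rewrite gcdp_eq0 negb_and f0.
have sh : (1 < size h)%N by rewrite ltn_neqAle eq_sym sh1 size_poly_gt0.
have /dvdpP[q fE] : h %| f by apply: dvdp_gcdl.
have [cop|ncop] := boolP (coprimep h q); last first.
  exists (gcdp h q); last by rewrite fE mulrC expr2 dvdp_mul ?dvdp_gcdl ?dvdp_gcdr.
  rewrite ltn_neqAle eq_sym -coprimep_def ncop size_poly_gt0 gcdp_eq0.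
  by rewrite (negPf h0).
have h'0 : h^`() = 0.
  apply/eqP; rewrite -[_ == 0]negbK; apply/negP => h'n0.
  have : h %| f^`() by apply: dvdp_gcdr.
  rewrite fE derivM dvdp_addr ?dvdp_mulIr // Gauss_dvdpr // => /(dvdp_leq h'n0).
  by rewrite leqNgt lt_size_deriv.
have [k hE] := deriv_eq0_pth_power h'0.
exists k.
  rewrite ltnNge; apply: contraTN sh => /size1_polyC; rewrite hE => ->.
  by rewrite -rmorphXn /= -leqNgt size_polyC_leq1.
apply: (@dvdp_trans _ h); last exact: dvdp_gcdl.
by rewrite hE dvdp_exp2l ?prime_gt1.
Qed.

Lemma square_decomposition f m : f \in monics F m ->
  exists k d g, [/\ (k.*2 <= m)%N, d \in monics F k, g \in monics F (m - k.*2),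
    separable_poly g & f = d ^+ 2 * g].
Proof.
elim/ltn_ind: m f => m IH f fm.
have [sf|nsf] := boolP (separable_poly f).
  exists 0%N, 1, f; split; rewrite ?subn0 ?expr1n ?mul1r //.
  by rewrite monics0 inE.
have [e0 se0 e0f] := nonseparable_square (monics_monic fm) nsf.
have [k [e [ek ee0]]] := dvd_monics (monics_monic fm) (dvdp_trans (dvdp_exp2l e0 (isT : 1 <= 2)%N) e0f).
rewrite expr1 in ee0.
have k0 : (0 < k)%N.
  by rewrite -ltnS -(monics_size ek) (eqp_size ee0).
have e2f : e ^+ 2 %| f by rewrite (eqp_dvdl _ (eqp_exp 2 ee0)).
have e2 : e ^+ 2 \in monics F k.*2 by rewrite -addnn expr2 monicsM.
have /dvdpP[f1 fE] := e2f; rewrite mulrC in fE.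
have k2m : (k.*2 <= m)%N.
  by have := dvdp_leq (monic_neq0 (monics_monic fm)) e2f;
    rewrite (monics_size e2) (monics_size fm) ltnS.
have f1m : f1 \in monics F (m - k.*2) by rewrite -(monicsM_dvd _ e2 k2m) -fE.
have lt : (m - k.*2 < m)%N by rewrite ltn_subrL double_gt0 k0 (leq_trans _ k2m) // double_gt0.
have [k1 [d [g [k1m dk1 gm sg f1E]]]] := IH _ lt _ f1m.
exists (k + k1)%N, (e * d), g; split=> //.
- by rewrite doubleD -(subnKC k2m) leq_add2l.
- exact: monicsM.
- by rewrite doubleD subnDA.
by rewrite fE f1E exprMn mulrA.
Qed.

(** After removal of gcd(a, b), the square of the cofactor of [a] divides [v], so that cofactor is
    constant. Uniqueness of f = d^2 g follows. *)
Lemma dvdp_sqr_separable (a b v : {poly F}) : a != 0 -> separable_poly v -> a ^+ 2 %| b ^+ 2 * v -> a %| b.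
Proof.
move=> a0 sv; set h := gcdp a b.
have h0 : h != 0 by rewrite gcdp_eq0 negb_and a0.
have /dvdpP[a1 aE] : h %| a by apply: dvdp_gcdl.
have /dvdpP[b1 bE] : h %| b by apply: dvdp_gcdr.
have cop : coprimep a1 b1.
  have := @coprimep_div_gcd _ a b; rewrite a0 => /(_ isT).
  by rewrite -/h [in a %/ h]aE [in b %/ h]bE !mulpK.
have -> : b ^+ 2 * v = h ^+ 2 * (b1 ^+ 2 * v) by rewrite bE -/h; ring.
have -> : a ^+ 2 = h ^+ 2 * a1 ^+ 2 by rewrite aE -/h; ring.
rewrite dvdp_mul2l ?expf_neq0 // Gauss_dvdpr ?coprimep_expl ?coprimep_expr //.
have [/eqP sa1 _|sa1] := boolP (size a1 == 1%N); last first.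
  by rewrite (separable_nosquare sv).
have /eqP := sa1; rewrite size_poly_eq1 => a1_1.
by rewrite aE (eqp_dvdl _ (eqp_mulr _ a1_1)) mul1r dvdp_gcdr.
Qed.

Lemma square_decomposition_uniq d1 d2 g1 g2 :
  d1 \is monic -> d2 \is monic -> separable_poly g1 -> separable_poly g2 ->
  d1 ^+ 2 * g1 = d2 ^+ 2 * g2 -> d1 = d2.
Proof.
move=> d1m d2m s1 s2 e; apply/eqP; rewrite -eqp_monic // /eqp; apply/andP; split.
  by apply: dvdp_sqr_separable s2 _; rewrite ?monic_neq0 // -e dvdp_mulIl.
by apply: dvdp_sqr_separable s1 _; rewrite ?monic_neq0 // e dvdp_mulIl.
Qed.

(** The conditions select a single pair (j, e). A function of the square part of f thus becomes a
    sum over all candidate divisors, which can be exchanged with a sum over f. *)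
Lemma big_square_decomposition (R : nmodType) (w : nat -> {poly F} -> R) m k d g :
  (k.*2 <= m)%N -> d \in monics F k -> g \in monics F (m - k.*2) -> separable_poly g ->
  \sum_(j < m./2.+1) \sum_(e <- monics F j |
      (e ^+ 2 %| d ^+ 2 * g) && separable_poly (d ^+ 2 * g %/ e ^+ 2)) w j e = w k d.
Proof.
move=> km dk gm sg; set f := _ * g.
have km2 : (k < m./2.+1)%N by rewrite ltnS -(doubleK k) half_leq.
have d0 := monic_neq0 (monics_monic dk).
have unq j e : e \in monics F j -> (e ^+ 2 %| f) && separable_poly (f %/ e ^+ 2) -> e = d.
  move=> ej /andP[e2f se]; have em := monics_monic ej.
  apply: (square_decomposition_uniq em (monics_monic dk) se sg).
  by rewrite mulrC divpK.
rewrite (bigD1 (Ordinal km2)) //= [X in _ + X]big1 => [|j jk]; last first.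
  rewrite big_seq_cond big1 // => e /andP[ej He]; case/eqP: jk; apply: val_inj => /=.
  by have := monics_size ej; rewrite (unq _ _ ej He) (monics_size dk) => -[].
rewrite addr0 -big_filter (_ : [seq _ <- _ | _] = [:: d]) ?big_seq1 //.
apply: perm_small_eq => //; apply: uniq_perm => //; first by rewrite filter_uniq ?monics_uniq.
move=> e; rewrite mem_filter inE; apply/andP/eqP => [[He ek]|->]; first exact: unq ek He.
by rewrite dk dvdp_mulIl mulKp ?expf_neq0.
Qed.

(** For odd p and monic f, a gcd of degree 1 means f = (x - r)^2 g with g separable and g(r)
    nonzero. For p = 2 it cannot occur, since a double root puts (x - r)^2 into the gcd. The gcd is
    also what the rank of the Sylvester matrix sees. *)
Definition has_simple_double_root f := size (gcdp f f^`()) == 2.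

Lemma simple_double_rootP f : f \is monic -> has_simple_double_root f ->
  odd p /\ exists r g, [/\ f = ('X - r%:P) ^+ 2 * g, separable_poly g & ~~ root g r].
Proof.
move=> fm /eqP sh; set h := gcdp _ _ in sh.
have h0 : h != 0 by rewrite -size_poly_eq0 sh.
have [r rh] : exists r, root h r.
  exists (- h`_0 / h`_1); have l0 : h`_1 != 0.
    by move: h0; rewrite -lead_coef_eq0 /lead_coef sh.
  by rewrite /root horner_coef sh !big_ord_recl big_ord0 /= expr0 expr1 mulr1 addr0;
    rewrite mulrC divfK ?subrr.
have hE : h %= 'X - r%:P.
  by rewrite eqp_sym -dvdp_size_eqp ?dvdp_XsubCl // sh size_XsubC.
have rf : root f r by rewrite -dvdp_XsubCl -(eqp_dvdl _ hE) dvdp_gcdl.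
have rf' : root f^`() r by rewrite -dvdp_XsubCl -(eqp_dvdl _ hE) dvdp_gcdr.
have [G fG] := factor_theorem _ _ rf.
have rG : root G r.
  move: rf'; rewrite fG derivM derivXsubC mulr1 rootE hornerD hornerM.
  by rewrite hornerXsubC subrr mulr0 add0r rootE.
have [g GE] := factor_theorem _ _ rG.
have fE : f = ('X - r%:P) ^+ 2 * g by rewrite fG GE; ring.
have f'E : f^`() = ('X - r%:P) * (g *+ 2 + ('X - r%:P) * g^`()).
  rewrite fE derivM expr2 derivM derivXsubC; ring.
(* No common factor of f and f' exceeds x - r. Each conclusion below could fail only by producing a
   larger one. *)
have dh e : ('X - r%:P) * e %| f -> ('X - r%:P) * e %| f^`() -> (size e <= 1)%N.
  move=> ef ef'; have : ('X - r%:P) * e %| h by rewrite dvdp_gcd ef.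
  move=> /(dvdp_leq h0); have [->|e0] := eqVneq e 0; first by rewrite size_poly0.
  by rewrite sh size_monicM ?monicXsubC // size_XsubC.
have g0 : g != 0.
  by have := monic_neq0 fm; rewrite fE mulf_eq0 negb_or => /andP[].
have rg : ~~ root g r.
  apply/negP => /factor_theorem[g1 g1E].
  suff : (size ('X - r%:P)%R <= 1)%N by rewrite size_XsubC.
  apply: dh; first by rewrite fE expr2 dvdp_mulr.
  rewrite f'E dvdp_mul2l ?polyXsubC_eq0 // dvdp_addl ?dvdp_mulIl //.
  by rewrite g1E -mulr_natr mulrAC dvdp_mulIr.
split.
  case: (boolP (odd p)) => // /(prime_oddPn p_pr) p2.
  suff : (size ('X - r%:P)%R <= 1)%N by rewrite size_XsubC.
  apply: dh; first by rewrite fE expr2 dvdp_mulr.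
  rewrite f'E dvdp_mul2l ?polyXsubC_eq0 // dvdp_addl ?dvdp_mulIl //.
  rewrite -mulr_natr; have -> : (2%:R : {poly F}) = 0.
    by rewrite -[2%N]p2; apply: pcharf0; rewrite pchar_poly pchar_Fp.
  by rewrite mulr0 dvdp0.
exists r, g; split=> //; rewrite unlock coprimep_def; apply/eqP.
have c0 : gcdp g g^`() != 0 by rewrite gcdp_eq0 negb_and g0.
apply/eqP; rewrite eqn_leq size_poly_gt0 c0 andbT; apply: dh.
  by rewrite fE expr2 -mulrA dvdp_mul // dvdp_mull // dvdp_gcdl.
rewrite f'E dvdp_mul2l ?polyXsubC_eq0 // dvdp_add //.
  by rewrite -mulr_natr dvdp_mulr // dvdp_gcdl.
by rewrite dvdp_mull // dvdp_gcdr.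
Qed.

Lemma two_Fp_neq0 : odd p -> 2%:R != 0 :> F.
Proof.
move=> po; rewrite -(dvdn_pcharf (pchar_Fp p_pr)) dvdn_prime2 //.
by apply: contraTneq po => ->.
Qed.

Lemma gcdp_simple_double_root r g : odd p -> separable_poly g -> ~~ root g r ->
  gcdp (('X - r%:P) ^+ 2 * g) (('X - r%:P) ^+ 2 * g)^`() %= 'X - r%:P.
Proof.
move=> po sg rg; set f := _ * g.
have f'E : f^`() = ('X - r%:P) * (g *+ 2 + ('X - r%:P) * g^`()).
  rewrite /f derivM expr2 derivM derivXsubC; ring.
set k := g *+ 2 + _ in f'E.
(* At [r] the cofactor [k] takes the value 2 g(r), nonzero since p is odd; modulo [g] it is (x - r)
   g', which is a unit. *)
have cop : coprimep (('X - r%:P) * g) k.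
  rewrite coprimepMl coprimep_sym coprimep_XsubC; apply/andP; split.
    rewrite /root /k hornerD hornerM hornerXsubC subrr mul0r addr0 hornerMn.
    by rewrite -mulr_natr mulf_neq0 ?two_Fp_neq0 // -rootE.
  rewrite /k -mulr_natl coprimep_addl_mul coprimepMr coprimep_XsubC rg /=.
  by move: sg; rewrite unlock.
rewrite f'E /f expr2 -mulrA.
rewrite eqp_sym; apply: eqp_trans (mulp_gcdr _ _ _).
rewrite -{1}['X - _]mulr1 eqp_mul2l ?polyXsubC_eq0 // eqp_sym.
by rewrite -size_poly_eq1 -coprimep_def.
Qed.

Lemma has_simple_double_rootE r g : odd p -> separable_poly g -> ~~ root g r ->
  has_simple_double_root (('X - r%:P) ^+ 2 * g).
Proof.
move=> po sg rg; rewrite /has_simple_double_root.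
by rewrite (eqp_size (gcdp_simple_double_root po sg rg)) size_XsubC.
Qed.

(** The double root is read off the gcd of f and f', hence is unique: the indicator is a sum over
    candidate roots with at most one term. *)
Lemma big_simple_double_root (R : nzRingType) f : odd p -> f \is monic ->
  \sum_(r : F | [&& ('X - r%:P) ^+ 2 %| f, separable_poly (f %/ ('X - r%:P) ^+ 2)
     & ~~ root (f %/ ('X - r%:P) ^+ 2) r]) 1 = (has_simple_double_root f)%:R :> R.
Proof.
move=> po fm; have [Hf|Hf] := boolP (has_simple_double_root f); last first.
  rewrite big_pred0 // => r; apply: contraNF Hf => /and3P[/divpK <- sg rg].
  rewrite mulpK ?expf_neq0 ?polyXsubC_eq0 // in sg rg.
  by rewrite mulrC has_simple_double_rootE.
have [_ [r [g [fE sg rg]]]] := simple_double_rootP fm Hf.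
have X0 a : ('X - a%:P) ^+ 2 != 0 :> {poly F} by rewrite expf_neq0 ?polyXsubC_eq0.
rewrite (big_pred1 r) // => a /=; apply/and3P/eqP => [[/divpK aE sa ra]|->]; last first.
  by rewrite fE dvdp_mulIl mulKp.
have ha := gcdp_simple_double_root po sa ra; have hr := gcdp_simple_double_root po sg rg.
rewrite mulrC aE in ha; rewrite -fE in hr.
have : 'X - a%:P %= 'X - r%:P by apply: eqp_trans hr; rewrite eqp_sym.
by rewrite eqp_monic ?monicXsubC // => /eqP /addrI /oppr_inj /polyC_inj.
Qed.

End Squarefree.

(** * Sums of a multiplicative function over separable, maximal and one-double-root polynomials *)

Section WeightedSums.
Variables (p : nat) (p_pr : prime p).
Local Notation F := 'F_p.
Implicit Types f g d : {poly F}.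

(** Euler's function of [d]: the monic polynomials of the same degree as [d] represent each residue
    class modulo [d] once. *)
Definition euler_phi d : nat := count (fun e => coprimep e d) (monics F (size d).-1).

(* At most one [d] contributes, the one with [f = d ^+ 2 * g] and [g] separable;
   its term is the proportion of units modulo [d]. *)
Definition maximal_weight (C : fieldType) f : C :=
  \sum_(k < (size f).-1./2.+1) \sum_(d <- monics F k |
     (d ^+ 2 %| f) && separable_poly (f %/ d ^+ 2)) (euler_phi d)%:R / p%:R ^+ k.

Lemma maximal_weightE (C : fieldType) m k d g :
  (k.*2 <= m)%N -> d \in monics F k -> g \in monics F (m - k.*2) -> separable_poly g ->
  maximal_weight C (d ^+ 2 * g) = (euler_phi d)%:R / p%:R ^+ k.
Proof.
move=> km dk gm sg; rewrite /maximal_weight.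
have -> : (size (d ^+ 2 * g)%R).-1 = m.
  have := monicsM (monicsM dk dk) gm; rewrite -expr2 addnn subnKC // => /monics_size ->.
  by [].
exact: (big_square_decomposition (fun k d => (euler_phi d)%:R / p%:R ^+ k : C)).
Qed.

Variables (C : numFieldType) (X : {poly F} -> C).
Hypothesis X1 : X 1 = 1.
Hypothesis XM : forall f g, f \is monic -> g \is monic -> X (f * g) = X f * X g.

Definition monic_sum (Y : {poly F} -> C) m : C := \sum_(f <- monics F m) Y f.
Definition separable_sum m : C := \sum_(f <- monics F m | separable_poly f) X f.

Lemma big_square_weight (w : nat -> {poly F} -> C) m :
  \sum_(f <- monics F m) (\sum_(k < m./2.+1) \sum_(d <- monics F k |
      (d ^+ 2 %| f) && separable_poly (f %/ d ^+ 2)) w k d) * X f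
  = \sum_(k < m./2.+1) (\sum_(d <- monics F k) w k d * X d ^+ 2) * separable_sum (m - k.*2).
Proof.
under eq_bigr do rewrite mulr_suml.
rewrite exchange_big; apply: eq_bigr => k _ /=.
under eq_bigr do rewrite big_mkcond mulr_suml.
rewrite exchange_big mulr_suml big_seq [RHS]big_seq; apply: eq_bigr => d dk /=.
have d2k : d ^+ 2 \in monics F k.*2 by rewrite -addnn expr2 monicsM.
have km : (k.*2 <= m)%N by have := ltn_ord k; rewrite ltnS geq_half_double.
have d0 := monic_neq0 (monics_monic dk).
transitivity (\sum_(f <- monics F m | d ^+ 2 %| f)
    (if separable_poly (f %/ d ^+ 2) then w k d else 0) * X f).
  by rewrite [RHS]big_mkcond; apply: eq_bigr => f _; case: (_ %| f) => //=; rewrite mul0r.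
rewrite (big_monics_dvd _ d2k km) /separable_sum [X in _ * X]big_mkcond mulr_sumr.
rewrite big_seq [RHS]big_seq; apply: eq_bigr => g gm.
rewrite mulKp ?expf_neq0 // XM ?(monics_monic d2k) ?(monics_monic gm) //.
rewrite expr2 XM ?(monics_monic dk) // -expr2.
by case: ifP => _; rewrite ?mul0r ?mulr0 // mulrA.
Qed.

(** In generating functions: the series of X at u is the series of X^2 at u^2 times the series of
    separable sums at u. *)
Lemma monic_sum_decomposition m :
  monic_sum X m = \sum_(k < m./2.+1) monic_sum (fun d => X d ^+ 2) k * separable_sum (m - k.*2).
Proof.
have := big_square_weight (fun _ _ => 1) m.
under [RHS]eq_bigr do under eq_bigr do rewrite mul1r.
move=> <-; rewrite /monic_sum big_seq [RHS]big_seq; apply: eq_bigr => f fm.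
have [k [d [g [km dk gm sg fE]]]] := square_decomposition p_pr fm.
by rewrite fE (big_square_decomposition (fun _ _ => 1) km dk gm sg) mul1r.
Qed.

Lemma monic_sum0 : monic_sum X 0 = 1.
Proof. by rewrite /monic_sum monics0 big_seq1. Qed.

Lemma big_gcdp_decomposition (R : nzRingType) m e d :
  e \in monics F m -> d \in monics F m ->
  \sum_(j < m.+1) \sum_(h <- monics F j |
     [&& h %| e, h %| d & coprimep (e %/ h) (d %/ h)]) 1 = 1 :> R.
Proof.
move=> em dm; have e0 := monic_neq0 (monics_monic em).
have [k [h [hk hE]]] := dvd_monics (monics_monic em) (dvdp_gcdl e d).
have he : h %| e by rewrite (eqp_dvdl _ hE) dvdp_gcdl.
have hd : h %| d by rewrite (eqp_dvdl _ hE) dvdp_gcdr.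
have km : (k < m.+1)%N.
  by rewrite -(monics_size hk) -(monics_size em) dvdp_leq.
have unq j h' : h' \in monics F j ->
    [&& h' %| e, h' %| d & coprimep (e %/ h') (d %/ h')] -> h' = h.
  move=> h'j /and3P[/divpK eE /divpK dE co].
  apply/eqP; rewrite -eqp_monic ?(monics_monic h'j) ?(monics_monic hk) //.
  apply: eqp_trans (_ : gcdp e d %= h); last by rewrite eqp_sym.
  rewrite -eE -dE ![_ * h']mulrC; apply: eqp_trans (mulp_gcdr _ _ _).
  by rewrite -{1}[h']mulr1 eqp_mul2l ?(monic_neq0 (monics_monic h'j)) // eqp_sym -size_poly_eq1.
rewrite (bigD1 (Ordinal km)) //= [X in _ + X]big1 => [|j jk]; last first.
  rewrite big_seq_cond big1 // => h' /andP[h'j H]; case/eqP: jk; apply: val_inj => /=.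
  by have := monics_size h'j; rewrite (unq _ _ h'j H) (monics_size hk) => -[].
rewrite addr0 -big_filter (_ : [seq _ <- _ | _] = [:: h]) ?big_seq1 //.
apply: perm_small_eq => //; apply: uniq_perm => //; first by rewrite filter_uniq ?monics_uniq.
move=> h'; rewrite mem_filter inE; apply/andP/eqP => [[He ek]|->]; first exact: unq ek He.
split=> //; rewrite he hd /= coprimep_def.
have := coprimep_div_gcd (_ : (e != 0) || (d != 0)); rewrite e0 => /(_ isT).
rewrite -coprimep_def.
have [c1 c1E] : exists c, e = c * h by apply/dvdpP.
have [c2 c2E] : exists c, d = c * h by apply/dvdpP.
have h0 := monic_neq0 (monics_monic hk).
move=> _; rewrite {1}c1E {1}c2E !mulpK //.
rewrite coprimep_def -(eqp_size (_ : gcdp e d %/ h %= _)).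
  by rewrite size_poly_eq1 -(eqp_mul2r _ _ h0) mul1r divpK ?dvdp_gcd ?he // eqp_sym.
rewrite -(eqp_mul2r _ _ h0) divpK ?dvdp_gcd ?he ?hd // eqp_sym mulrC.
by have := mulp_gcdr c1 c2 h; rewrite [h * c1]mulrC [h * c2]mulrC -c1E -c2E.
Qed.

Definition phi_sum (Y : {poly F} -> C) m : C :=
  \sum_(d <- monics F m) (euler_phi d)%:R * Y d.

(** The analogue of summing Euler's function over divisors: the pairs (d, e) of monic polynomials of
    degree m are sorted by their gcd h of degree j, leaving the coprime pair (d/h, e/h) of degree m
    - j. *)
Lemma phi_sum_decomposition (Y : {poly F} -> C) m :
  (forall f g, f \is monic -> g \is monic -> Y (f * g) = Y f * Y g) ->
  p%:R ^+ m * monic_sum Y m = \sum_(j < m.+1) monic_sum Y j * phi_sum Y (m - j).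
Proof.
move=> YM.
transitivity (\sum_(d <- monics F m) \sum_(e <- monics F m) Y d).
  rewrite /monic_sum mulr_sumr; apply: eq_bigr => d _.
  by rewrite big_const_seq count_predT card_monics card_Fp // iter_addr_0 -natrX mulr_natl.
transitivity (\sum_(d <- monics F m) \sum_(e <- monics F m) \sum_(j < m.+1)
    \sum_(h <- monics F j) (if [&& h %| e, h %| d & coprimep (e %/ h) (d %/ h)] then Y d else 0)).
  rewrite big_seq [RHS]big_seq; apply: eq_bigr => d dm.
  rewrite big_seq [RHS]big_seq; apply: eq_bigr => e em.
  rewrite -[LHS]mulr1 -(big_gcdp_decomposition C em dm) mulr_sumr.
  apply: eq_bigr => j _; rewrite big_mkcond mulr_sumr; apply: eq_bigr => h _.
  by case: ifP => _; rewrite ?mulr1 ?mulr0.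
under eq_bigr do rewrite exchange_big.
rewrite exchange_big; apply: eq_bigr => j _ /=.
under eq_bigr do rewrite exchange_big.
have jm : (j <= m)%N by rewrite -ltnS.
rewrite exchange_big /monic_sum mulr_suml big_seq [RHS]big_seq; apply: eq_bigr => h hj /=.
have h0 := monic_neq0 (monics_monic hj).
transitivity (\sum_(d <- monics F m | h %| d) \sum_(e <- monics F m | h %| e)
    (if coprimep (e %/ h) (d %/ h) then Y d else 0)).
  rewrite [RHS]big_mkcond; apply: eq_bigr => d _; case: ifP => hd; last first.
    by rewrite big1 // => e _; rewrite andbF.
  by rewrite [RHS]big_mkcond; apply: eq_bigr => e _; case: (h %| e).
rewrite (big_monics_dvd _ hj jm) /phi_sum mulr_sumr big_seq [RHS]big_seq.
apply: eq_bigr => d dm; rewrite (big_monics_dvd _ hj jm) -big_mkcond /=.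
rewrite /euler_phi (monics_size dm) mulrCA -YM ?(monics_monic dm) ?(monics_monic hj) //.
rewrite (eq_bigl (fun e => coprimep e d)) => [|e]; last by rewrite !mulKp.
by rewrite big_const_seq iter_addr_0 mulr_natl.
Qed.

Variables (L L2 : C).
Hypothesis monic_sum_X1 : monic_sum X 1 = L.
Hypothesis monic_sum_X : forall m, (1 < m)%N -> monic_sum X m = 0.
Hypothesis monic_sum_XX1 : monic_sum (fun d => X d ^+ 2) 1 = L2.
Hypothesis monic_sum_XX : forall m, (1 < m)%N -> monic_sum (fun d => X d ^+ 2) m = 0.

Lemma monic_sum_XX0 : monic_sum (fun d => X d ^+ 2) 0 = 1.
Proof. by rewrite /monic_sum monics0 big_seq1 X1 expr1n. Qed.

(** Only k = 0 and k = 1 survive in the decomposition of the vanishing sum of degree n + 2, so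
    S(n+2) = - L2 S(n), with S(0) = 1 and S(1) = L. *)
Lemma separable_sumE n : separable_sum n = (- L2) ^+ n./2 * L ^+ odd n.
Proof.
elim/ltn_ind: n => -[|[|n]] IH.
- have := monic_sum_decomposition 0.
  by rewrite big_ord1 monic_sum0 monic_sum_XX0 !mul1r /= subn0 => <-.
- have := monic_sum_decomposition 1.
  by rewrite big_ord1 monic_sum_X1 monic_sum_XX0 !mul1r /= subn0 => <-.
have := monic_sum_decomposition n.+2.
rewrite monic_sum_X // !big_ord_recl big1 => [|i _]; last by rewrite monic_sum_XX ?mul0r.
rewrite /= monic_sum_XX0 mul1r addr0 monic_sum_XX1 subn0 /bump /= !subSS subn0 (IH n) //.
by move/esym/eqP; rewrite addr_eq0 => /eqP->; rewrite negbK exprS !mulNr mulrA.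
Qed.

Lemma phi_sum_XX0 : phi_sum (fun d => X d ^+ 2) 0 = 1.
Proof.
rewrite /phi_sum monics0 big_seq1 X1 expr1n mulr1 /euler_phi size_poly1 monics0 /=.
by rewrite coprimep1.
Qed.

(** In degree 1 the decomposition reads p L2 = phi(1) + L2; in degree m > 1 it reads 0 = phi(m) + L2
    phi(m-1). *)
Lemma phi_sum_XXS m :
  phi_sum (fun d => X d ^+ 2) m.+1 = - (p%:R - 1) * (- L2) ^+ m.+1.
Proof.
have YM f g : f \is monic -> g \is monic -> X (f * g) ^+ 2 = X f ^+ 2 * X g ^+ 2.
  by move=> fm gm; rewrite XM // exprMn.
elim: m => [|m IH]; have := phi_sum_decomposition _ YM.
  move=> /(_ 1%N); rewrite !big_ord_recl big_ord0 /= monic_sum_XX0 monic_sum_XX1 phi_sum_XX0.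
  by rewrite subn0 !expr1 => H; move: H; rewrite mul1r mulr1 addr0 => H;
    rewrite mulrN mulNr opprK mulrBl mul1r H addrK.
move=> /(_ m.+2); rewrite 2!big_ord_recl big1 => [|i _]; last by rewrite monic_sum_XX ?mul0r.
rewrite /= monic_sum_XX // mulr0 monic_sum_XX0 monic_sum_XX1 subn0 /bump /= subSS subn0 IH.
rewrite mul1r addr0 => /esym/eqP; rewrite addr_eq0 => /eqP ->.
by rewrite [in RHS]exprS; ring.
Qed.

(** With h = floor(n/2), the sum over k is (- L2)^h times 1 - (p - 1)(1/p + ... + 1/p^h) = 1/p^h,
    the only change from the separable sum. *)
Lemma maximal_sumE n :
  \sum_(f <- monics F n) maximal_weight C f * X f = (- L2 / p%:R) ^+ n./2 * L ^+ odd n.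
Proof.
have p0 : p%:R != 0 :> C by rewrite pnatr_eq0 -lt0n prime_gt0.
transitivity (\sum_(k < n./2.+1)
    (phi_sum (fun d => X d ^+ 2) k / p%:R ^+ k) * ((- L2) ^+ (n./2 - k) * L ^+ odd n)).
  have := big_square_weight (fun k d => (euler_phi d)%:R / p%:R ^+ k) n.
  rewrite big_seq [X in X = _ -> _](_ : _ = \sum_(f <- monics F n) maximal_weight C f * X f).
    move=> ->; apply: eq_bigr => k _; rewrite separable_sumE; congr (_ * _).
      by rewrite /phi_sum mulr_suml; apply: eq_bigr => d _; rewrite mulrAC.
    have km : (k.*2 <= n)%N by have := ltn_ord k; rewrite ltnS geq_half_double.
    have -> : (n - k.*2 = odd n + (n./2 - k).*2)%N.
      by rewrite doubleB addnBA ?odd_double_half // leq_double -ltnS.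
    by rewrite half_bit_double oddD odd_double addbF oddb.
  by rewrite [RHS]big_seq; apply: eq_bigr => f fn; rewrite /maximal_weight (monics_size fn).
under eq_bigr do rewrite mulrA.
rewrite -mulr_suml; congr (_ * _); elim: n./2 => [|h IH].
  by rewrite big_ord1 phi_sum_XX0 !expr0 invr1 !mulr1.
rewrite big_ord_recr /= subnn mulr1 phi_sum_XXS.
under eq_bigr => i _ do rewrite subSn -1?ltnS // exprSr mulrA.
rewrite -mulr_suml IH !expr_div_n !exprS.
field; rewrite p0 /= expf_neq0 //.
Qed.

Definition separable_sum_off (r : F) m : C :=
  \sum_(g <- monics F m | separable_poly g && ~~ root g r) X g.

(** A separable polynomial vanishing at [r] is x - r times a separable one that does not vanish at
    [r]. *)
Lemma separable_sum_offS r m :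
  separable_sum_off r m.+1 = separable_sum m.+1 - X ('X - r%:P) * separable_sum_off r m.
Proof.
have r1 : 'X - r%:P \in monics F 1 by rewrite mem_monics monicXsubC size_XsubC.
apply/eqP; rewrite eq_sym subr_eq; apply/eqP.
rewrite /separable_sum (bigID (fun g => root g r)) /= addrC; congr (_ + _).
transitivity (\sum_(g <- monics F m.+1 | ('X - r%:P) %| g) (if separable_poly g then X g else 0)).
  rewrite big_mkcond [RHS]big_mkcond; apply: eq_bigr => g _; rewrite dvdp_XsubCl andbC.
  by case: root => //=; case: separable_poly.
rewrite (big_monics_dvd _ r1) // subn1 /= mulr_sumr [RHS]big_mkcond big_seq [RHS]big_seq.
apply: eq_bigr => g gm; rewrite mulrC separable_root.
by case: ifP => // _; rewrite mulrC XM ?monicXsubC ?(monics_monic gm).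
Qed.

Lemma separable_sum_offE r m : separable_sum_off r m =
  \sum_(j < m.+1) (- X ('X - r%:P)) ^+ (m - j) * separable_sum j.
Proof.
elim: m => [|m IH].
  rewrite big_ord1 mul1r /separable_sum_off /separable_sum monics0 !big_cons !big_nil.
  by rewrite root1 andbT.
rewrite [RHS]big_ord_recr /= subnn mul1r separable_sum_offS IH addrC; congr (_ + _).
rewrite mulr_sumr -sumrN; apply: eq_bigr => j _.
by rewrite subSn -1?ltnS // exprS; ring.
Qed.

(** Substituting f = (x - r)^2 g leaves the separable [g] avoiding [r]. Expanding that sum
    contributes the alternating powers of X(x - r), whence the exponent n - k + 2. *)
Lemma double_root_sumE n : odd p ->
  \sum_(f <- monics F n.+2 | has_simple_double_root f) X f =
  \sum_(k < n.+1) (-1) ^+ (n - k) * (\sum_(r : F) X ('X - r%:P) ^+ (n - k).+2)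
     * separable_sum k.
Proof.
move=> po.
transitivity (\sum_(r : F) X ('X - r%:P) ^+ 2 * separable_sum_off r n); last first.
  under eq_bigr do rewrite separable_sum_offE mulr_sumr.
  rewrite exchange_big; apply: eq_bigr => k _ /=.
  rewrite -mulrA mulr_suml mulr_sumr; apply: eq_bigr => r _.
  rewrite [in LHS]exprNn -(add2n (n - k)) (exprD _ 2).
  by move: ((-1) ^+ (n - k)) (X _ ^+ (n - k)) => s t; ring.
transitivity (\sum_(f <- monics F n.+2) \sum_(r : F)
   (if [&& ('X - r%:P) ^+ 2 %| f, separable_poly (f %/ ('X - r%:P) ^+ 2)
     & ~~ root (f %/ ('X - r%:P) ^+ 2) r] then X f else 0)).
  rewrite big_mkcond big_seq [RHS]big_seq; apply: eq_bigr => f fn.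
  have := big_simple_double_root p_pr C po (monics_monic fn).
  case: has_simple_double_root; rewrite -big_mkcond /= ?mulr1n ?mulr0n.
    by move=> H; rewrite -[LHS]mulr1 -H mulr_sumr; apply: eq_bigr => r _; rewrite mulr1.
  rewrite sumr_const => /eqP; rewrite pnatr_eq0 => /eqP H.
  by rewrite sumr_const H.
rewrite exchange_big; apply: eq_bigr => r _ /=.
have r2 : ('X - r%:P) ^+ 2 \in monics F 2.
  by rewrite mem_monics monic_exp ?monicXsubC // size_exp_XsubC.
transitivity (\sum_(f <- monics F n.+2 | ('X - r%:P) ^+ 2 %| f)
    (if separable_poly (f %/ ('X - r%:P) ^+ 2) && ~~ root (f %/ ('X - r%:P) ^+ 2) r
     then X f else 0)).
  by rewrite [RHS]big_mkcond; apply: eq_bigr => f _; case: (_ %| f).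
rewrite (big_monics_dvd _ r2) // subn2 /= mulr_sumr [RHS]big_mkcond big_seq [RHS]big_seq.
apply: eq_bigr => g gn.
rewrite mulKp ?expf_neq0 ?polyXsubC_eq0 //; case: ifP => // _.
by rewrite !XM ?(monics_monic gn) ?monic_exp ?monicXsubC // expr2 XM ?monicXsubC.
Qed.

End WeightedSums.

(** * Legendre symbols and Gauss sums *)

Section Legendre.
Variables (p : nat) (p_pr : prime p) (p_odd : odd p).
Local Notation F := 'F_p.
Implicit Types a b c : F.

Lemma odd_Fp_two_neq0 : 2%:R != 0 :> F.
Proof.
rewrite -(dvdn_pcharf (pchar_Fp p_pr)) dvdn_prime2 //.
by apply: contraTneq p_odd => ->.
Qed.

Lemma legendre0 : legendre (0 : F) = 0.
Proof. by rewrite /legendre eqxx. Qed.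

Lemma legendre_sqr c : c != 0 -> legendre (c ^+ 2) = 1.
Proof.
by move=> c0; rewrite /legendre expf_eq0 (negPf c0); case: existsP => // -[]; exists c.
Qed.

Lemma legendre1 : legendre (1 : F) = 1.
Proof. by rewrite -(expr1n _ 2) legendre_sqr ?oner_eq0. Qed.

Lemma legendre_mul_sqr a c : c != 0 -> legendre (a * c ^+ 2) = legendre a.
Proof.
move=> c0; rewrite /legendre mulf_eq0 expf_eq0 (negPf c0) orbF; case: eqP => // _.
congr (if _ then _ else _); apply/existsP/existsP => -[d /eqP dE].
  by exists (d / c); rewrite expr_div_n dE mulfK ?expf_neq0.
by exists (d * c); rewrite exprMn dE.
Qed.

Lemma card_square_roots b :
  (#|[pred c : F | c ^+ 2 == b]|%:R : int) = 1 + legendre b.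
Proof.
rewrite /legendre; have [->|b0] := eqVneq b 0.
  by rewrite (eq_card (B := pred1 0)) ?card1 // => c; rewrite !inE expf_eq0.
case: (boolP [exists c : F, c ^+ 2 == b]) => [/existsP[c /eqP cE]|nex]; last first.
  rewrite eq_card0 ?subrr // => c; rewrite !inE; apply: contraNF nex => cE.
  by apply/existsP; exists c.
have cN : c != - c.
  rewrite -addr_eq0 -mulr2n -mulr_natr mulf_neq0 ?odd_Fp_two_neq0 //.
  by apply: contraNneq b0 => c0; rewrite -cE c0 expr0n.
rewrite (eq_card (B := pred2 c (- c))) ?card2 ?cN // => d.
by rewrite !inE -cE eqf_sqr.
Qed.

Lemma sum_legendre : \sum_(b : F) legendre b = 0.
Proof.
have : \sum_(b : F) (1 + legendre b) = p%:R :> int.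
  under eq_bigr do rewrite -card_square_roots -sum1_card natr_sum.
  rewrite (exchange_big_dep predT) //=.
  transitivity (\sum_(c : F) 1 : int); last by rewrite sumr_const card_Fp.
  by apply: eq_bigr => c _; rewrite (big_pred1 (c ^+ 2)) // => i; rewrite inE eq_sym.
rewrite big_split /= sumr_const card_Fp // => /eqP.
by rewrite -subr_eq0 addrAC subrr add0r => /eqP.
Qed.

Lemma legendre_le1 b : legendre b <= 1.
Proof. by rewrite /legendre; case: eqP => // _; case: ifP. Qed.

Lemma legendre_eq1P b : legendre b = 1 -> exists2 c, c != 0 & b = c ^+ 2.
Proof.
rewrite /legendre; case: eqP => // b0; case: existsP => // -[c /eqP cE] _.
by exists c => //; apply: contra_notN b0 => /eqP c0; rewrite -cE c0 expr0n.
Qed.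

Lemma legendre_cases b : b != 0 -> legendre b = 1 \/ legendre b = -1.
Proof. by rewrite /legendre => /negPf->; case: ifP; [left|right]. Qed.

(** Only two nonsquares need an argument. For a nonsquare [a] every term - ((a d / p) + (d / p)) is
    nonnegative, and the terms sum to 0 over d; so each vanishes, in particular at d = b. *)
Lemma legendreM a b : legendre (a * b) = legendre a * legendre b.
Proof.
have [->|a0] := eqVneq a 0; first by rewrite mul0r legendre0 mul0r.
have [->|b0] := eqVneq b 0; first by rewrite mulr0 legendre0 mulr0.
have [/[dup] la /legendre_eq1P[c c0 ->]|la] := legendre_cases a0.
  by rewrite mulrC legendre_mul_sqr // legendre_sqr // mul1r.
have [/[dup] lb /legendre_eq1P[c c0 ->]|lb] := legendre_cases b0.
  by rewrite legendre_mul_sqr // legendre_sqr // mulr1.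
have key : \sum_(d : F) - (legendre (a * d) + legendre d) = 0.
  rewrite sumrN big_split /= sum_legendre addr0.
  rewrite (_ : \sum_(i : F) legendre (a * i) = \sum_(i : F) legendre i).
    by rewrite sum_legendre oppr0.
  by rewrite [RHS](reindex_inj (mulfI a0)).
have ge0 (d : F) : true -> 0 <= - (legendre (a * d) + legendre d).
  move=> _; have [->|d0] := eqVneq d 0; first by rewrite mulr0 legendre0.
  have [/[dup] ld /legendre_eq1P[c c0 ->]|ld] := legendre_cases d0.
    by rewrite legendre_mul_sqr // legendre_sqr // la addNr.
  by rewrite ld opprD opprK addrC subr_ge0 legendre_le1.
have /eqP : - (legendre (a * b) + legendre b) = 0 by apply: (psumr_eq0P ge0 key).
by rewrite oppr_eq0 addr_eq0 lb opprK la mulrNN mulr1 => /eqP.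
Qed.

Lemma legendre_neq0_sqr a : a != 0 -> legendre a ^+ 2 = 1.
Proof. by move=> /legendre_cases[]->; rewrite ?sqrrN expr1n. Qed.

End Legendre.

Section GaussSums.
Variables (p : nat) (p_pr : prime p).
Local Notation F := 'F_p.
Local Notation C := algC.
Variable w : C.
Hypothesis w_prim : p.-primitive_root w.

Definition addchar (x : F) : C := w ^+ x.

Lemma addcharD x y : addchar (x + y) = addchar x * addchar y.
Proof.
by rewrite /addchar /= [X in (_ %% X)%N](Fp_cast p_pr) (prim_expr_mod w_prim) exprD.
Qed.

Lemma addchar0 : addchar 0 = 1. Proof. by []. Qed.

Lemma addcharMn x m : addchar (x *+ m) = addchar x ^+ m.
Proof. by elim: m => // m IH; rewrite mulrS addcharD IH exprS. Qed.

Lemma addchar_natM m x : addchar (m%:R * x) = addchar x ^+ m.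
Proof. by rewrite mulr_natl addcharMn. Qed.

Lemma addchar1_neq1 : addchar 1 != 1.
Proof.
rewrite /addchar /= -(prim_order_dvd w_prim) [X in (_ %% X)%N](Fp_cast p_pr).
by rewrite modn_small ?prime_gt1 // gtnNdvd // prime_gt1.
Qed.

Lemma addchar_nontriv a : a != 0 -> exists x, addchar (a * x) != 1.
Proof. by move=> a0; exists a^-1; rewrite divff // addchar1_neq1. Qed.

Lemma sum_addchar a : \sum_(x : F) addchar (a * x) = (if a == 0 then p%:R else 0).
Proof.
case: eqP => [->|/eqP a0].
  under eq_bigr do rewrite mul0r addchar0.
  by rewrite sumr_const card_Fp.
have [x0 ne1] := addchar_nontriv a0; set S := LHS.
have : S * addchar (a * x0) = S.
  rewrite {1}/S mulr_suml /S [RHS](reindex_inj (addIr x0)) /=.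
  by apply: eq_bigr => x _; rewrite mulrDr addcharD.
move/eqP; rewrite -subr_eq0 -{2}[S]mulr1 -mulrBr mulf_eq0 subr_eq0 (negPf ne1) orbF.
by move/eqP.
Qed.

Hypothesis p_odd : odd p.

Local Notation leg a := ((legendre a)%:~R : C).

Definition gauss : C := \sum_(b : F) leg b * addchar b.

Lemma sum_legendre_addchar a : \sum_(b : F) leg b * addchar (a * b) = leg a * gauss.
Proof.
have [->|a0] := eqVneq a 0.
  rewrite legendre0 mul0r; under eq_bigr do rewrite mul0r addchar0 mulr1.
  by rewrite -rmorph_sum sum_legendre.
rewrite /gauss [in RHS](reindex_inj (mulfI a0)) mulr_sumr; apply: eq_bigr => b _ /=.
by rewrite mulrA legendreM // intrM mulrA -intrM -expr2 legendre_neq0_sqr // mul1r.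
Qed.

Lemma sum_addchar_sqr a : a != 0 -> \sum_(x : F) addchar (a * x ^+ 2) = leg a * gauss.
Proof.
move=> a0; rewrite -sum_legendre_addchar.
transitivity (\sum_(b : F) (1 + leg b) * addchar (a * b)).
  transitivity (\sum_(b : F) \sum_(x : F | x ^+ 2 == b) addchar (a * b)).
    rewrite (exchange_big_dep predT) //=.
    by apply: eq_bigr => x _; rewrite (big_pred1 (x ^+ 2)) // => i; rewrite /= eq_sym.
  apply: eq_bigr => b _; rewrite sumr_const -mulr_natl; congr (_ * _).
  have /(congr1 (fun z : int => z%:~R : C)) := card_square_roots p_pr p_odd b.
  by rewrite intrD -[(_%:R)%:~R]/((_%:R)%:~R) rmorph_nat => <-.
under eq_bigr do rewrite mulrDl mul1r.
by rewrite big_split /= sum_addchar (negPf a0) add0r.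
Qed.

Lemma gauss_sqr : gauss ^+ 2 = leg (-1 : F) * p%:R.
Proof.
rewrite expr2 {1}/gauss mulr_suml.
transitivity (\sum_(a : F) \sum_(b : F) leg b * addchar (a * (1 + b))).
  apply: eq_bigr => a _; rewrite mulrAC -sum_legendre_addchar mulr_suml.
  by apply: eq_bigr => b _; rewrite mulrDr mulr1 addcharD -mulrA [_ * addchar a]mulrC.
rewrite exchange_big /=.
transitivity (\sum_(b : F) leg b * (if b == -1 then p%:R else 0)).
  apply: eq_bigr => b _; rewrite -mulr_sumr; congr (_ * _).
  under eq_bigr do rewrite mulrC.
  by rewrite sum_addchar addrC addr_eq0.
by rewrite (bigD1 (-1)) //= eqxx big1 ?addr0 // => b /negPf->; rewrite mulr0.
Qed.

Lemma sum_addchar_quadratic a b : a != 0 ->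
  \sum_(x : F) addchar (a * x ^+ 2 + b * x) = addchar (- (b ^+ 2 / (4%:R * a))) * leg a * gauss.
Proof.
move=> a0; have two0 := odd_Fp_two_neq0 p_pr p_odd.
rewrite -mulrA -sum_addchar_sqr // mulr_sumr.
rewrite (reindex_inj (addIr (- (b / (2%:R * a))))) /=.
apply: eq_bigr => x _; rewrite -addcharD; congr addchar.
have e4 : 4%:R = 2%:R * 2%:R :> F by rewrite -natrM.
by rewrite e4; field; rewrite a0 e4 mulf_neq0 //= two0.
Qed.

Lemma sum_legendre_pow m x :
  \sum_(b : F | b != 0) leg b ^+ m * addchar (b * x) =
  if odd m then leg x * gauss else (if x == 0 then p%:R else 0) - 1.
Proof.
have legm (b : F) : b != 0 -> leg b ^+ m = if odd m then leg b else 1.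
  move=> b0; rewrite -[in LHS](odd_double_half m) exprD -muln2 mulnC exprM.
  rewrite -[leg b ^+ 2]rmorphXn /= legendre_neq0_sqr // expr1n mulr1.
  by case: odd; rewrite ?expr1 ?expr0.
transitivity (\sum_(b : F | b != 0) (if odd m then leg b else 1) * addchar (x * b)).
  by apply: eq_bigr => b b0; rewrite legm // [b * x]mulrC.
case: odd.
  rewrite -sum_legendre_addchar [RHS](bigD1 0) //= legendre0 mul0r add0r.
  by apply: eq_bigr.
rewrite -sum_addchar [in RHS](bigD1 0) //= mulr0 addchar0 addrAC subrr add0r.
by apply: eq_bigr => b _; rewrite mul1r.
Qed.

Lemma gauss_even j : gauss ^+ j.*2 = leg (-1 : F) ^+ j * p%:R ^+ j.
Proof. by rewrite -muln2 mulnC exprM gauss_sqr exprMn. Qed.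

(** Origin of [delta]: with G the Gauss sum, it is p G^m times the Fourier transform of the m-th
    power of the Legendre symbol on nonzero elements. Its cases come from the parity of the exponent
    and from G^2 = (-1/p) p. *)
Lemma deltaE m x : p%:R * gauss ^+ m * \sum_(b : F | b != 0) leg b ^+ m * addchar (b * x)
  = (delta (m + 1) x)%:~R.
Proof.
rewrite sum_legendre_pow /delta addn1 /=; case: ifP => om /=.
  have -> : gauss ^+ m = gauss ^+ m./2.*2 * gauss.
    by rewrite -exprSr -[in LHS](odd_double_half m) om.
  have -> : uphalf m = m./2.+1 by rewrite uphalf_half om.
  rewrite gauss_even !rmorphM /= !rmorphXn /= addn1 -pmulrn.
  have := gauss_sqr; move: (leg (-1 : F)) => l g2.
  transitivity (p%:R * (l ^+ m./2 * p%:R ^+ m./2) * (leg x * gauss ^+ 2)); first by ring.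
  by rewrite g2 !exprS; ring.
rewrite subn1 !addn1 /=.
have -> : gauss ^+ m = gauss ^+ m./2.*2 by rewrite -[in LHS](odd_double_half m) om.
rewrite gauss_even; case: eqP => x0 /=.
  by rewrite !rmorphM /= rmorphB /= !rmorphXn /= -pmulrn exprS; ring.
by rewrite rmorphN rmorphM /= !rmorphXn /= -pmulrn exprS; ring.
Qed.

(** The dual sum when p divides n: the parameter [a] enters only linearly, so summing over it forces
    b = 0. *)
Lemma dual_sum_isotropic m b c :
  \sum_(a : F) \sum_(x : F | x != 0) addchar (- (a * b + x * c)) * (leg x ^+ m * gauss ^+ m)
  = if b == 0 then (delta (m + 1) (- c))%:~R else 0.
Proof.
transitivity ((\sum_(a : F) addchar (- b * a)) *
    (gauss ^+ m * \sum_(x : F | x != 0) leg x ^+ m * addchar (x * - c))).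
  rewrite mulr_suml; apply: eq_bigr => a _; rewrite !mulr_sumr; apply: eq_bigr => x _.
  by rewrite opprD addcharD mulrN [a * b]mulrC mulNr; ring.
by rewrite sum_addchar oppr_eq0; case: eqP; rewrite ?mul0r // mulrA deltaE.
Qed.

Lemma deltaSS m (x : F) : delta m.+2 x = legendre (-1 : F) * p%:Z * delta m x.
Proof.
rewrite /delta /= negbK; case: ifP => om; last first.
  by rewrite !addn1 /= !exprS; ring.
case: m om => // m om; case: ifP => _; rewrite !addn1 !subn1 /= !exprS; ring.
Qed.

(** The sum over [a] is quadratic: completing the square adds a Gauss sum and a symbol in [x],
    raising the exponent to m + 1. [deltaE] then gives index m + 2, and [deltaSS] returns to m: its
    factor p cancels that of [deltaE], its (-1/p) the one in the symbol of - n / (4 x). *)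
Lemma dual_sum m (n b c : F) : n != 0 ->
  \sum_(a : F) \sum_(x : F | x != 0) addchar (- (a * b + x * c)) *
     (addchar (- (n * a ^+ 2 / (4%:R * x))) * (leg x ^+ m * gauss ^+ m))
  = leg n * (delta m (b ^+ 2 / n - c))%:~R.
Proof.
move=> n0; have two0 := odd_Fp_two_neq0 p_pr p_odd.
have four0 : 4%:R != 0 :> F by rewrite (natrM _ 2 2) mulf_neq0.
have := deltaE m.+1 (b ^+ 2 / n - c).
rewrite addn1 deltaSS !intrM -[(p%:Z)%:~R]pmulrn => key.
have pn0 : p%:R != 0 :> C by rewrite pnatr_eq0 -lt0n prime_gt0.
have l2 : leg (-1 : F) * leg (-1 : F) = 1.
  by rewrite -intrM -expr2 legendre_neq0_sqr // oppr_eq0 oner_eq0.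
have {}key : (delta m (b ^+ 2 / n - c))%:~R = leg (-1 : F) * gauss ^+ m.+1 *
    \sum_(x : F | x != 0) leg x ^+ m.+1 * addchar (x * (b ^+ 2 / n - c)).
  apply: (mulfI pn0); set D := (delta _ _)%:~R.
  transitivity (leg (-1 : F) * (leg (-1 : F) * p%:R * D)); first by rewrite !mulrA l2 mul1r.
  by rewrite -key; ring.
rewrite key !mulr_sumr exchange_big /=; apply: eq_bigr => x x0.
have A0 : - (n / (4%:R * x)) != 0 by rewrite oppr_eq0 !mulf_neq0 ?invr_eq0 ?mulf_neq0.
transitivity ((\sum_(a : F) addchar (- (n / (4%:R * x)) * a ^+ 2 + (- b) * a)) *
    (addchar (- (x * c)) * (leg x ^+ m * gauss ^+ m))).
  rewrite mulr_suml; apply: eq_bigr => a _; rewrite !mulrA; congr (_ * _ * _).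
  rewrite -!addcharD; congr addchar; field; by rewrite four0 x0.
rewrite sum_addchar_quadratic //.
have -> : legendre (- (n / (4%:R * x))) = legendre (-1 : F) * legendre n * legendre x.
  have -> : - (n / (4%:R * x)) = (-1) * n * x * (2%:R * x)^-1 ^+ 2.
    by rewrite (natrM _ 2 2); field; rewrite x0 two0.
  by rewrite legendre_mul_sqr ?invr_eq0 ?mulf_neq0 // !legendreM.
have -> : - ((- b) ^+ 2 / (4%:R * - (n / (4%:R * x)))) = x * (b ^+ 2 / n).
  rewrite sqrrN mulrN invrN mulrN opprK.
  by field; rewrite ?n0 ?four0 ?x0.
rewrite mulrBr addcharD !intrM !exprS; ring.
Qed.

End GaussSums.

(** * Counting with two prescribed top coefficients *)

Section TopCoefficients.
Variable F : finFieldType.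
Implicit Types f g : {poly F}.

(* The second and third coefficients of [f] from the top; the factor ['X^2]
   makes them 0 when the degree of [f] is too small. *)
Definition top1 f : F := ('X^2 * f)`_(size f).
Definition top2 f : F := ('X^2 * f)`_(size f).-1.

Lemma top1E m f : size f = m.+2 -> top1 f = f`_m.
Proof. by rewrite /top1 => ->; rewrite coefXnM /= !subSS subn0. Qed.

Lemma top2E m f : size f = m.+3 -> top2 f = f`_m.
Proof. by rewrite /top2 => ->; rewrite coefXnM /= !subSS subn0. Qed.

(** The factor x^2 makes the expansion by three leading terms valid in degrees 0 and 1 as well, so
    products can be compared uniformly in the degree. *)
Lemma top_decomposition f : f \is monic -> exists2 r : {poly F},
  'X^2 * f = 'X^((size f).-1) * ('X^2 + (top1 f)%:P * 'X + (top2 f)%:P) + r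
  & (size r < size f)%N.
Proof.
move=> fm; set r := 'X^2 * f - 'X^((size f).-1) * ('X^2 + (top1 f)%:P * 'X + (top2 f)%:P).
exists r; first by rewrite /r; ring.
have sf : (0 < size f)%N by rewrite size_poly_gt0 monic_neq0.
rewrite -(prednK sf) ltnS; apply/leq_sizeP => j le.
have [k ->] : exists k, j = (k + (size f).-1)%N by exists (j - (size f).-1)%N; rewrite subnK.
rewrite /r coefB (coefXnM (size f).-1) ltnNge leq_addl /= addnK !coefD coefXn coefCM coefX coefC.
case: k => [|[|[|k]]] /=.
- by rewrite add0n -/(top2 f) !(mulr0, addr0, add0r, subrr).
- by rewrite add1n prednK // -/(top1 f) !(mulr0, mulr1, addr0, add0r, subrr).
- rewrite add2n coefXnM ltnNge /= subn2 /=; move: fm; rewrite monicE /lead_coef => /eqP->.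
  by rewrite mulr0 !addr0 subrr.
rewrite coefXnM nth_default ?if_same ?mulr0 ?addr0 ?subrr //.
by rewrite !addSn subn2 /= -{1}(prednK sf) ltnS leq_addl.
Qed.

Lemma topM f g : f \is monic -> g \is monic ->
  top1 (f * g) = top1 f + top1 g /\ top2 (f * g) = top2 f + top2 g + top1 f * top1 g.
Proof.
move=> fm gm; have [r fE rf] := top_decomposition fm; have [s gE sg] := top_decomposition gm.
have f0 := monic_neq0 fm; have g0 := monic_neq0 gm.
have szf : (0 < size f)%N by rewrite size_poly_gt0.
have szg : (0 < size g)%N by rewrite size_poly_gt0.
have szfg : size (f * g) = ((size f).-1 + (size g).-1).+1.
  rewrite size_Mmonic //; lia.
have tfg (q : {poly F}) i : ('X^2 * q)`_i = ('X^4 * q)`_(i.+2).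
  by rewrite (exprD _ 2%N 2%N) -mulrA (coefXnM 2%N _ i.+2) /= !subSS subn0.
have t1E : top1 (f * g) = ('X^4 * (f * g))`_((size f).-1 + (size g).-1).+3.
  by rewrite /top1 szfg tfg.
have t2E : top2 (f * g) = ('X^4 * (f * g))`_((size f).-1 + (size g).-1).+2.
  by rewrite /top2 szfg tfg.
set a1 := top1 f in fE *; set a2 := top2 f in fE *.
set c1 := top1 g in gE *; set c2 := top2 g in gE *.
pose t : {poly F} := r * ('X^2 * g) + 'X^((size f).-1) * ('X^2 + a1%:P * 'X + a2%:P) * s.
have E : 'X^4 * (f * g) = 'X^((size f).-1 + (size g).-1) *
   ('X^4 + (a1 + c1)%:P * 'X^3 + (a2 + c2 + a1 * c1)%:P * 'X^2
      + (a1 * c2 + a2 * c1)%:P * 'X + (a2 * c2)%:P) + t.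
  transitivity (('X^2 * f) * ('X^2 * g)); first by ring.
  rewrite {1}fE mulrDl /t [X in X + _ = _](_ : _ = 'X^((size f).-1) * ('X^2 + a1%:P * 'X + a2%:P) *
    ('X^((size g).-1) * ('X^2 + c1%:P * 'X + c2%:P) + s)); last by rewrite -gE.
  rewrite !rmorphD !rmorphM /= exprD; ring.
have sq (a b : F) : (size ('X^2 + a%:P * 'X + b%:P)%R <= 3)%N.
  apply/leq_sizeP => -[|[|[|j]]] // _.
  by rewrite !coefD coefXn coefCM coefX coefC /= mulr0 !addr0.
have st : (size t <= (size f).-1 + (size g).-1 + 2)%N.
  rewrite /t (leq_trans (size_polyD _ _)) // geq_max; apply/andP; split.
    apply: leq_trans (size_polyMleq _ _) _.
    rewrite size_monicM ?monicXn // size_polyXn; lia.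
  apply: leq_trans (size_polyMleq _ _) _.
  have : (size ('X^((size f).-1) * ('X^2 + a1%:P * 'X + a2%:P))%R <= (size f).-1 + 3)%N.
    apply: leq_trans (size_polyMleq _ _) _; rewrite size_polyXn /=.
    by rewrite leq_add2l.
  lia.
have cE i : ('X^4 * (f * g))`_((size f).-1 + (size g).-1 + (2 + i)) =
   ('X^4 + (a1 + c1)%:P * 'X^3 + (a2 + c2 + a1 * c1)%:P * 'X^2
      + (a1 * c2 + a2 * c1)%:P * 'X + (a2 * c2)%:P)`_(2 + i).
  rewrite E coefD coefXnM ltnNge leq_addr /= addKn [X in _ + X]nth_default ?addr0 //.
  by rewrite (leq_trans st) // addnA leq_addr.
rewrite t1E t2E; split.
  have := cE 1%N; rewrite !addnS !addn0 => ->.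
  by rewrite !coefD !coefCM !coefXn coefX coefC /= !(mulr0, mulr1, addr0, add0r).
have := cE 0%N; rewrite !addnS !addn0 => ->.
by rewrite !coefD !coefCM !coefXn coefX coefC /= !(mulr0, mulr1, addr0, add0r).
Qed.

Lemma top1_XsubC r : top1 ('X - r%:P) = - r.
Proof. by rewrite (top1E (m := 0)) ?size_XsubC // coefB coefX coefC /= sub0r. Qed.

Lemma top2_XsubC r : top2 ('X - r%:P) = 0.
Proof. by rewrite /top2 size_XsubC coefXnM. Qed.

Lemma top1_1 : top1 1 = 0.
Proof. by rewrite /top1 size_poly1 coefXnM. Qed.

Lemma top2_1 : top2 1 = 0.
Proof. by rewrite /top2 size_poly1 coefXnM. Qed.

Lemma monics_shift m f (h : {poly F}) : (size h <= m)%N -> (f + h \in monics F m) = (f \in monics F m).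
Proof.
move=> sh; have suff_ (g h' : {poly F}) : (size h' <= m)%N -> g \in monics F m -> g + h' \in monics F m.
  move=> sh' gm; have lt : (size h' < size g)%N by rewrite (monics_size gm).
  apply: monicsP; last by rewrite size_polyDl // (monics_size gm).
  by rewrite monicE lead_coefDl // -monicE (monics_monic gm).
apply/idP/idP => [fh|]; last exact: suff_.
by rewrite -(addrK h f); apply: suff_; rewrite ?size_polyN.
Qed.

Lemma big_monics_shift (V : nmodType) m (h : {poly F}) (H : {poly F} -> V) : (size h <= m)%N ->
  \sum_(f <- monics F m) H f = \sum_(f <- monics F m) H (f + h).
Proof.
move=> sh; rewrite -(big_map (fun f => f + h) xpredT H).
apply: perm_big; apply: uniq_perm; first exact: monics_uniq.
  by rewrite map_inj_uniq ?monics_uniq //; apply: addIr.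
move=> f; apply/idP/mapP => [fm|[g gm ->]]; last by rewrite monics_shift.
by exists (f - h); rewrite ?subrK // monics_shift // size_polyN.
Qed.

(** Translation by [h] permutes the monic polynomials of degree m and multiplies the sum by [u],
    which is not 1. *)
Lemma monic_sum_eq0 (R : idomainType) (Y : {poly F} -> R) m (h : {poly F}) u : (size h <= m)%N -> u != 1 ->
  (forall f, f \in monics F m -> Y (f + h) = Y f * u) -> \sum_(f <- monics F m) Y f = 0.
Proof.
move=> sh u1 Yh; set S := LHS.
have : S * u = S.
  rewrite {2}/S (big_monics_shift _ sh) /S mulr_suml big_seq [RHS]big_seq.
  by apply: eq_bigr => f /Yh.
move/eqP; rewrite -subr_eq0 -{2}[S]mulr1 -mulrBr mulf_eq0 subr_eq0 (negPf u1) orbF.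
by move/eqP.
Qed.

Lemma top1_shift m t f : (1 < m)%N -> f \in monics F m -> top1 (f + t *: 'X^(m - 2)) = top1 f.
Proof.
case: m => [|[|m]] // _ fm; rewrite subn2 /=.
have sh : (size (t *: 'X^m : {poly F}) <= m.+2)%N.
  by rewrite (leq_trans (size_scale_leq _ _)) // size_polyXn.
have fhm : f + t *: 'X^m \in monics F m.+2 by rewrite monics_shift.
rewrite !(top1E (m := m.+1)) ?(monics_size fm) ?(monics_size fhm) //.
by rewrite coefD coefZ coefXn gtn_eqF // mulr0 addr0.
Qed.

Lemma top2_shift m t f : (1 < m)%N -> f \in monics F m -> top2 (f + t *: 'X^(m - 2)) = top2 f + t.
Proof.
case: m => [|[|m]] // _ fm; rewrite subn2 /=.
have sh : (size (t *: 'X^m : {poly F}) <= m.+2)%N.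
  by rewrite (leq_trans (size_scale_leq _ _)) // size_polyXn.
have fhm : f + t *: 'X^m \in monics F m.+2 by rewrite monics_shift.
rewrite !(top2E (m := m)) ?(monics_size fm) ?(monics_size fhm) //.
by rewrite coefD coefZ coefXn eqxx mulr1.
Qed.

Lemma top1_shift1 m t f : (0 < m)%N -> f \in monics F m -> top1 (f + t *: 'X^(m - 1)) = top1 f + t.
Proof.
case: m => [|m] // _ fm; rewrite subn1 /=.
have sh : (size (t *: 'X^m : {poly F}) <= m.+1)%N.
  by rewrite (leq_trans (size_scale_leq _ _)) // size_polyXn.
have fhm : f + t *: 'X^m \in monics F m.+1 by rewrite monics_shift.
rewrite !(top1E (m := m)) ?(monics_size fm) ?(monics_size fhm) //.
by rewrite coefD coefZ coefXn eqxx mulr1.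
Qed.

End TopCoefficients.

Section TopCounts.
Variables (p n : nat) (b1 b2 : 'F_p).

Definition count2 (R : nzRingType) (W : {poly 'F_p} -> R) : R :=
  \sum_(f <- monics 'F_p n | (f`_(n - 1) == b1) && (f`_(n - 2) == b2)) W f.
Definition count1 (R : nzRingType) (W : {poly 'F_p} -> R) : R :=
  \sum_(f <- monics 'F_p n | f`_(n - 1) == b1) W f.

End TopCounts.

(** * Odd p: evaluation of the character sums and Fourier inversion *)

Section OddCharacters.
Variables (p : nat) (p_pr : prime p) (p_odd : odd p).
Local Notation F := 'F_p.
Local Notation C := algC.
Variable w : C.
Hypothesis w_prim : p.-primitive_root w.
Local Notation e := (@addchar p w).
Local Notation g := (@gauss p w).
Local Notation leg a := ((legendre (a : F))%:~R : C).
Implicit Types f : {poly F}.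

(* [- top1 f] and [top1 f ^+ 2 - 2 * top2 f] are the first two power sums of the
   roots of [f], hence additive in [f]. *)
Definition rootchar (a b : F) f : C :=
  e (a * - top1 f + b * (top1 f ^+ 2 - 2%:R * top2 f)).

Lemma rootchar1 a b : rootchar a b 1 = 1.
Proof.
by rewrite /rootchar top1_1 top2_1 expr0n /= mulr0 subrr oppr0 !mulr0 addr0 addchar0.
Qed.

Lemma rootcharM a b f1 f2 : f1 \is monic -> f2 \is monic ->
  rootchar a b (f1 * f2) = rootchar a b f1 * rootchar a b f2.
Proof.
move=> m1 m2; have [t1 t2] := topM m1 m2.
rewrite /rootchar -(addcharD p_pr w_prim) t1 t2; congr (addchar _ _); ring.
Qed.

Lemma rootcharX a b f m : rootchar a b f ^+ m = rootchar (m%:R * a) (m%:R * b) f.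
Proof. by rewrite /rootchar -(addchar_natM p_pr w_prim) mulrDr !mulrA. Qed.

(** Adding t to the coefficient of x^(m-2) moves the second power sum by - 2 t, which the character
    sees since p is odd and b is nonzero. *)
Lemma monic_sum_rootchar a b m : b != 0 -> (1 < m)%N -> monic_sum (rootchar a b) m = 0.
Proof.
move=> b0 m1; have two0 := odd_Fp_two_neq0 p_pr p_odd.
have [x ex] : exists x, e (b * (- (2%:R * x))) != 1.
  have [y ey] := addchar_nontriv p_pr w_prim b0.
  by exists (- (y / 2%:R)); rewrite !mulrN opprK [2%:R * _]mulrC divfK.
apply: (monic_sum_eq0 (h := x *: 'X^(m - 2)) _ ex).
  by rewrite (leq_trans (size_scale_leq _ _)) // size_polyXn; lia.
move=> f fm; rewrite /rootchar top1_shift // top2_shift // -(addcharD p_pr w_prim).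
by congr (addchar _ _); ring.
Qed.

Definition lin_sum k (a b : F) : C := \sum_(r : F) rootchar a b ('X - r%:P) ^+ k.

(** On x - r the k-th power of the character is a quadratic exponential in r, trivial when p divides
    [k]. *)
Lemma lin_sumE k a b : b != 0 -> lin_sum k a b =
  if k%:R == 0 :> F then p%:R
  else e (- (k%:R * a ^+ 2 / (4%:R * b))) * leg k%:R * (leg b * g).
Proof.
move=> b0; rewrite /lin_sum.
transitivity (\sum_(r : F) e ((k%:R * b) * r ^+ 2 + (k%:R * a) * r)).
  apply: eq_bigr => r _; rewrite rootcharX /rootchar top1_XsubC top2_XsubC; congr (addchar _ _).
  by ring.
case: eqP => [->|/eqP k0].
  under eq_bigr do rewrite !mul0r addr0 addchar0.
  by rewrite sumr_const card_Fp.
rewrite (sum_addchar_quadratic p_pr w_prim p_odd) ?mulf_neq0 // legendreM // intrM.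
have four0 : 4%:R != 0 :> F by rewrite (natrM _ 2 2) mulf_neq0 ?odd_Fp_two_neq0.
rewrite !mulrA; congr (_ * _ * _ * _); congr (addchar _ _).
by field; rewrite b0 k0 four0.
Qed.

Lemma monic_sum_lin a b k : monic_sum (fun f => rootchar a b f ^+ k) 1 = lin_sum k a b.
Proof. exact: big_monics1. Qed.

Lemma monic_sum_lin1 a b : monic_sum (rootchar a b) 1 = lin_sum 1 a b.
Proof. exact: big_monics1. Qed.

Lemma monic_sum_rootchar_sqr a b m : b != 0 -> (1 < m)%N ->
  monic_sum (fun f => rootchar a b f ^+ 2) m = 0.
Proof.
move=> b0 m1; rewrite -(monic_sum_rootchar (2%:R * a) (b := 2%:R * b) _ m1).
  by apply: eq_bigr => f _; rewrite rootcharX.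
by rewrite mulf_neq0 ?odd_Fp_two_neq0.
Qed.

(** The phases of the floor(k/2) factors L2 and of the possible factor L add up to k a^2 / (4 b),
    and their Gauss sums number ceil(k/2). *)
Lemma separable_sum_rootchar a b k : b != 0 -> separable_sum (rootchar a b) k =
  (-1) ^+ k./2 * leg 2%:R ^+ k./2 * (e (- (k%:R * a ^+ 2 / (4%:R * b)))
     * (leg b ^+ uphalf k * g ^+ uphalf k)).
Proof.
move=> b0.
rewrite (separable_sumE p_pr (rootchar1 a b) (@rootcharM a b) (monic_sum_lin1 a b)
  (fun m => monic_sum_rootchar a b0) (monic_sum_lin a b 2) (fun m => monic_sum_rootchar_sqr a b0)).
have two0 := odd_Fp_two_neq0 p_pr p_odd.
rewrite !lin_sumE // (negPf two0) oner_eq0 legendre1 // mulr1.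
rewrite [in LHS]exprNn !exprMn -!(addchar_natM p_pr w_prim).
have -> : uphalf k = (k./2 + odd k)%N by rewrite uphalf_half addnC.
rewrite !exprD.
have -> : e (- (k%:R * a ^+ 2 / (4%:R * b))) =
   e (k./2%:R * - (2%:R * a ^+ 2 / (4%:R * b))) * e ((odd k)%:R * - (1 * a ^+ 2 / (4%:R * b))).
  rewrite -(addcharD p_pr w_prim); congr (addchar _ _).
  by rewrite -[in LHS](odd_double_half k) natrD -muln2 natrM; ring.
by ring.
Qed.

Variables (n : nat) (b1 b2 : F).
Hypothesis n_gt2 : (2 < n)%N.

Local Notation count2 := (count2 n b1 b2).
Local Notation count1 := (count1 n b1).

Local Notation s1 := (- b1).
Local Notation s2 := (b1 ^+ 2 - 2%:R * b2).

(** [s1] and [s2] are the power sums prescribed by [b1] and [b2]. Summing over all (a, b) detects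
    both coefficients, 2 being invertible; the terms with b = 0 detect only the first. Subtraction
    leaves the characters with degree-1 L-function. *)
Lemma count_inversion (W : {poly F} -> C) : p%:R ^+ 2 * count2 W - p%:R * count1 W =
  \sum_(a : F) \sum_(b : F | b != 0) e (- (a * s1 + b * s2)) *
     \sum_(f <- monics F n) W f * rootchar a b f.
Proof.
have two0 := odd_Fp_two_neq0 p_pr p_odd.
pose G a b := e (- (a * s1 + b * s2)) * \sum_(f <- monics F n) W f * rootchar a b f.
have top_n f : f \in monics F n -> top1 f = f`_(n - 1) /\ top2 f = f`_(n - 2).
  move=> /monics_size sf; case: (n) n_gt2 sf => [|[|m]] // _ sf.
  by rewrite (top1E sf) (top2E sf) subn1 subn2.
have inner f a b : e (- (a * s1 + b * s2)) * rootchar a b f =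
    e ((- top1 f - s1) * a) * e ((top1 f ^+ 2 - 2%:R * top2 f - s2) * b).
  by rewrite /rootchar -!(addcharD p_pr w_prim); congr (addchar _ _); ring.
have all : \sum_(a : F) \sum_(b : F) G a b = p%:R ^+ 2 * count2 W.
  transitivity (\sum_(f <- monics F n) W f *
     ((\sum_(a : F) e ((- top1 f - s1) * a)) * \sum_(b : F) e ((top1 f ^+ 2 - 2%:R * top2 f - s2) * b))).
    under eq_bigr do under eq_bigr do rewrite /G mulr_sumr.
    under eq_bigr do rewrite exchange_big.
    rewrite exchange_big; apply: eq_bigr => f _ /=.
    rewrite mulr_suml mulr_sumr; apply: eq_bigr => a _.
    by rewrite mulrA mulr_sumr; apply: eq_bigr => b _; rewrite mulrCA inner mulrA.
  rewrite /count2 mulr_sumr [RHS]big_mkcond big_seq [RHS]big_seq; apply: eq_bigr => f fn.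
  have [t1 t2] := top_n f fn; rewrite !(sum_addchar p_pr w_prim) t1 t2.
  rewrite opprK addrC subr_eq0 eq_sym; case: eqP => [->|_] /=; last by rewrite mul0r mulr0.
  have -> : b1 ^+ 2 - 2%:R * f`_(n - 2) - s2 = 2%:R * (b2 - f`_(n - 2)) by ring.
  rewrite mulf_eq0 (negPf two0) /= subr_eq0 eq_sym.
  by case: eqP => _; rewrite ?mulr0 // expr2 mulrC.
have zero : \sum_(a : F) G a 0 = p%:R * count1 W.
  transitivity (\sum_(f <- monics F n) W f * \sum_(a : F) e ((- top1 f - s1) * a)).
    under eq_bigr do rewrite /G mulr_sumr.
    rewrite exchange_big; apply: eq_bigr => f _ /=.
    rewrite mulr_sumr; apply: eq_bigr => a _.
    by rewrite mulrCA inner mulr0 addchar0 mulr1.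
  rewrite /count1 mulr_sumr [RHS]big_mkcond big_seq [RHS]big_seq; apply: eq_bigr => f fn.
  have [t1 t2] := top_n f fn; rewrite !(sum_addchar p_pr w_prim) t1.
  rewrite opprK addrC subr_eq0 eq_sym; case: eqP => _; first by rewrite mulrC.
  by rewrite mulr0.
rewrite -all -zero -sumrB; apply: eq_bigr => a _.
by rewrite (bigD1 0) //= addrAC subrr add0r.
Qed.

(** Common value of the dual sums for odd p. If p does not divide [n], the argument is s1^2 / n -
    s2. If it does, the sum vanishes unless b1 = 0, and the index is one higher. *)
Definition dual_value (m : nat) : int :=
  if n%:R == 0 :> F then (if b1 == 0 then delta (m + 1) (2%:R * b2) else 0)
  else legendre (n%:R : F) * delta m (2%:R * b2 - (1 - 1 / n%:R) * b1 ^+ 2).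

Lemma dual_valueE m :
  \sum_(a : F) \sum_(b : F | b != 0) e (- (a * s1 + b * s2)) *
     (e (- (n%:R * a ^+ 2 / (4%:R * b))) * (leg b ^+ m * g ^+ m)) = (dual_value m)%:~R.
Proof.
rewrite /dual_value; case: eqP => [n0|/eqP n0]; last first.
  rewrite (dual_sum p_pr w_prim p_odd) // intrM; congr (_ * (delta _ _)%:~R).
  by field.
transitivity (\sum_(a : F) \sum_(b : F | b != 0) e (- (a * s1 + b * s2)) *
     (leg b ^+ m * g ^+ m)).
  apply: eq_bigr => a _; apply: eq_bigr => b _; rewrite n0.
  by rewrite !mul0r oppr0 addchar0 mul1r.
rewrite (dual_sum_isotropic p_pr w_prim p_odd) oppr_eq0; case: eqP => // b10.
by rewrite b10 expr0n /= sub0r opprK.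
Qed.

Lemma count_separable :
  p%:R ^+ 2 * count2 (fun f => (separable_poly f)%:R)
    - p%:R * count1 (fun f => (separable_poly f)%:R)
  = (-1) ^+ n./2 * leg 2%:R ^+ n./2 * (dual_value (uphalf n))%:~R.
Proof.
rewrite count_inversion -dual_valueE mulr_sumr; apply: eq_bigr => a _.
rewrite mulr_sumr; apply: eq_bigr => b b0.
rewrite [RHS]mulrCA -separable_sum_rootchar // /separable_sum [in RHS]big_mkcond; congr (_ * _).
by apply: eq_bigr => f _; case: separable_poly; rewrite ?mul1r ?mul0r.
Qed.

Lemma count_maximal :
  p%:R ^+ 2 * count2 (maximal_weight C) - p%:R * count1 (maximal_weight C)
  = (-1) ^+ n./2 * leg 2%:R ^+ n./2 * (dual_value (uphalf n))%:~R / p%:R ^+ n./2.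
Proof.
rewrite count_inversion -dual_valueE mulr_sumr mulr_suml; apply: eq_bigr => a _.
rewrite mulr_sumr mulr_suml; apply: eq_bigr => b b0.
rewrite [X in _ = X / _]mulrCA -separable_sum_rootchar // -mulrA; congr (_ * _).
rewrite (separable_sumE p_pr (rootchar1 a b) (@rootcharM a b) (monic_sum_lin1 a b)
  (fun m => monic_sum_rootchar a b0) (monic_sum_lin a b 2) (fun m => monic_sum_rootchar_sqr a b0)).
rewrite (maximal_sumE p_pr (rootchar1 a b) (@rootcharM a b) (monic_sum_lin1 a b)
  (fun m => monic_sum_rootchar a b0) (monic_sum_lin a b 2) (fun m => monic_sum_rootchar_sqr a b0)).
by rewrite expr_div_n mulrAC.
Qed.

(** The double root contributes the sum over r of the (n - k)-th power of the character: [p] if p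
    divides n - k, otherwise one more Gauss sum. Hence the two sums in H. *)
Lemma count_double_root :
  p%:R ^+ 2 * count2 (fun f => (has_simple_double_root f)%:R)
    - p%:R * count1 (fun f => (has_simple_double_root f)%:R)
  = (-1) ^+ n * \sum_(k < n.-1) (-1) ^+ uphalf k * leg 2%:R ^+ k./2 *
      (if (p %| n - k)%N then p%:R * (dual_value (uphalf k))%:~R
       else leg (n - k)%:R * (dual_value (uphalf k).+1)%:~R).
Proof.
rewrite count_inversion.
transitivity (\sum_(a : F) \sum_(b : F | b != 0) \sum_(k < n.-1)
   (-1) ^+ n * ((-1) ^+ uphalf k * leg 2%:R ^+ k./2 * ((if (p %| n - k)%N then p%:R else leg (n - k)%:R)
     * (e (- (a * s1 + b * s2)) * (e (- (n%:R * a ^+ 2 / (4%:R * b)))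
     * (leg b ^+ (uphalf k + ~~ (p %| n - k)%N) * g ^+ (uphalf k + ~~ (p %| n - k)%N))))))); last first.
  under eq_bigr do rewrite exchange_big.
  rewrite exchange_big mulr_sumr; apply: eq_bigr => k _ /=.
  transitivity ((-1) ^+ n * ((-1) ^+ uphalf k * leg 2%:R ^+ k./2 *
     ((if (p %| n - k)%N then p%:R else leg (n - k)%:R) *
       (dual_value (uphalf k + ~~ (p %| n - k)%N))%:~R))).
    rewrite -dual_valueE !mulr_sumr; apply: eq_bigr => a _.
    by rewrite !mulr_sumr; apply: eq_bigr.
  by case: (p %| _)%N; rewrite ?addn0 ?addn1.
apply: eq_bigr => a _; apply: eq_bigr => b b0.
case: n n_gt2 => [|[|n']] // _ /=.
transitivity (e (- (a * s1 + b * s2)) *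
   \sum_(f <- monics F n'.+2 | has_simple_double_root f) rootchar a b f).
  congr (_ * _); rewrite [RHS]big_mkcond; apply: eq_bigr => f _.
  by case: has_simple_double_root; rewrite ?mul1r ?mul0r.
rewrite (double_root_sumE p_pr (@rootcharM a b)) // mulr_sumr; apply: eq_bigr => k _.
have kn : (k <= n')%N by rewrite -ltnS.
rewrite -/(lin_sum _ a b) lin_sumE // separable_sum_rootchar //.
have -> : (n'.+2 - k = (n' - k).+2)%N by lia.
rewrite (dvdn_pcharf (pchar_Fp p_pr)).
have sgn : (-1) ^+ (n' - k) * (-1) ^+ k./2 = (-1) ^+ n'.+2 * (-1) ^+ uphalf k :> C.
  rewrite -!exprD -signr_odd -[RHS]signr_odd; congr (_ ^+ (nat_of_bool _)).
  have := odd_double_half k; rewrite uphalf_half; lia.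
set S := (-1) ^+ (n' - k) in sgn *; set T := (-1) ^+ k./2 in sgn *.
(* If p divides n - k then n = k in F_p, and the phase of the separable factor is already the one
   attached to n. Otherwise the phases for n - k and k add up to it. *)
case: eqP => [z|/eqP nz] /=.
  rewrite addn0.
  have -> : n'.+2%:R = k%:R :> F.
    by apply/eqP; rewrite -subr_eq0 -natrB 1?leqW // 1?leqW // -z; apply/eqP; congr (_%:R); lia.
  transitivity ((S * T) * (leg 2%:R ^+ k./2 * (p%:R * (e (- (a * s1 + b * s2)) *
     (e (- (k%:R * a ^+ 2 / (4%:R * b))) * (leg b ^+ uphalf k * g ^+ uphalf k)))))).
    by ring.
  by rewrite sgn; ring.
rewrite addn1.
have -> : e (- (n'.+2%:R * a ^+ 2 / (4%:R * b))) =
    e (- ((n' - k).+2%:R * a ^+ 2 / (4%:R * b))) * e (- (k%:R * a ^+ 2 / (4%:R * b))).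
  rewrite -(addcharD p_pr w_prim); congr (addchar _ _).
  have -> : n'.+2 = ((n' - k).+2 + k)%N by lia.
  by rewrite natrD; ring.
set E1 := e (- (_.+2%:R * _ / _)); set E2 := e (- (k%:R * _ / _)); set E3 := e (- (_ + _)).
transitivity ((S * T) * (leg 2%:R ^+ k./2 * (leg (n' - k).+2%:R * (E3 *
     (E1 * E2 * (leg b ^+ (uphalf k).+1 * g ^+ (uphalf k).+1)))))).
  by rewrite !exprS; ring.
by rewrite sgn; ring.
Qed.

End OddCharacters.

(** * The prime 2: characters of order 4 *)

Section EvenCharacters.
Local Notation F := 'F_2.
Local Notation C := algC.
Implicit Types f : {poly F}.

(* For p = 2 the pairs of top coefficients form the cyclic group of order 4 of
   units 1 + a t + b t^2 modulo t^3, whose faithful characters are the two below. *)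
Definition evenchar (u : C) f : C := u ^+ top1 f * (-1) ^+ top2 f.

Lemma F2_cases (x : F) : x = 0 \/ x = 1.
Proof. by case: x => -[|[|]] // i; [left|right]; apply: val_inj. Qed.

Lemma F2_expr0 (R : nzRingType) (x : R) : x ^+ (0%R : F) = 1. Proof. by []. Qed.
Lemma F2_expr1 (R : nzRingType) (x : R) : x ^+ (1%R : F) = x. Proof. by []. Qed.
Lemma F2_add11 : 1 + 1 = 0 :> F. Proof. exact: val_inj. Qed.

Let expF2 := (F2_expr0, F2_expr1, F2_add11).

Lemma N1_neq1 : (-1 : C) != 1.
Proof. by rewrite eq_sym -addr_eq0 -(natrD _ 1 1) pnatr_eq0. Qed.

Variable u : C.
Hypothesis u_sqr : u ^+ 2 = -1.

Lemma evenchar1 : evenchar u 1 = 1.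
Proof. by rewrite /evenchar top1_1 top2_1 !expr0 mul1r. Qed.

(** When both first coefficients are 1, their sum is 0 in F_2 and a factor u^2 = -1 is lost; their
    product, which enters the second coefficient of [f1 * f2], restores it. *)
Lemma evencharM f1 f2 : f1 \is monic -> f2 \is monic ->
  evenchar u (f1 * f2) = evenchar u f1 * evenchar u f2.
Proof.
move=> m1 m2; have [t1 t2] := topM m1 m2; rewrite /evenchar t1 t2.
have uu : u * u = -1 by rewrite -expr2.
case: (F2_cases (top1 f1)) => ->; case: (F2_cases (top1 f2)) => ->;
  case: (F2_cases (top2 f1)) => ->; case: (F2_cases (top2 f2)) => ->;
  by rewrite ?(mulr0, mul0r, mulr1, addr0, add0r, expF2) ?(mulr1, mul1r, mulrN1, mulN1r, mulrN, mulNr, uu, opprK).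
Qed.

Lemma monic_sum_evenchar m : (1 < m)%N -> monic_sum (evenchar u) m = 0.
Proof.
move=> m1; apply: (monic_sum_eq0 (h := 1 *: 'X^(m - 2)) _ N1_neq1).
  by rewrite (leq_trans (size_scale_leq _ _)) // size_polyXn; lia.
move=> f fm; rewrite /evenchar top1_shift // top2_shift // -mulrA; congr (_ * _).
by case: (F2_cases (top2 f)) => ->; rewrite ?add0r !expF2 ?mul1r // mulrNN mulr1.
Qed.

(** The square of the character is -1 to the power of the first coefficient, which cancels already
    in degree 1; hence L2 = 0. *)
Lemma monic_sum_evenchar_sqr m : (0 < m)%N -> monic_sum (fun f => evenchar u f ^+ 2) m = 0.
Proof.
move=> m1; apply: (monic_sum_eq0 (h := 1 *: 'X^(m - 1)) _ N1_neq1).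
  by rewrite (leq_trans (size_scale_leq _ _)) // size_polyXn; lia.
move=> f fm; rewrite /evenchar !exprMn ![(-1) ^+ _ ^+ 2]exprAC !sqrrN !expr1n !mulr1.
rewrite ![u ^+ _ ^+ 2]exprAC u_sqr top1_shift1 //.
by case: (F2_cases (top1 f)) => ->; rewrite ?add0r !expF2 ?mul1r // mulrNN mulr1.
Qed.

Let prime2 : prime 2 := isT.

Lemma separable_sum_even m : (1 < m)%N -> separable_sum (evenchar u) m = 0.
Proof.
move=> m1.
rewrite (separable_sumE prime2 evenchar1 evencharM erefl monic_sum_evenchar
  (monic_sum_evenchar_sqr (isT : 0 < 1)%N) (fun m m1 => monic_sum_evenchar_sqr (ltnW m1))).
by rewrite oppr0 expr0n; case: m m1 => [|[|m]] //= _; rewrite mul0r.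
Qed.

Lemma maximal_sum_even m : (1 < m)%N ->
  \sum_(f <- monics F m) maximal_weight C f * evenchar u f = 0.
Proof.
move=> m1.
rewrite (maximal_sumE prime2 evenchar1 evencharM erefl monic_sum_evenchar
  (monic_sum_evenchar_sqr (isT : 0 < 1)%N) (fun m m1 => monic_sum_evenchar_sqr (ltnW m1))).
by rewrite oppr0 mul0r expr0n; case: m m1 => [|[|m]] //= _; rewrite mul0r.
Qed.

End EvenCharacters.

(** Both square roots of -1 are used: adding their relations shows that for b_1 = 0 the count does
    not depend on b_2, and one relation then gives the same for b_1 = 1. *)
Lemma count_even (n : nat) (b1 b2 : 'F_2) (W : {poly 'F_2} -> algC) : (2 < n)%N ->
  (forall u, u ^+ 2 = -1 -> \sum_(f <- monics 'F_2 n) W f * evenchar u f = 0) ->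
  2%:R * count2 n b1 b2 W = count1 n b1 W.
Proof.
move=> n2 HW.
have top_n (f : {poly 'F_2}) : f \in monics 'F_2 n -> top1 f = f`_(n - 1) /\ top2 f = f`_(n - 2).
  move=> /monics_size sf; case: (n) n2 sf => [|[|m]] // _ sf.
  by rewrite (top1E sf) (top2E sf) subn1 subn2.
have H u : u ^+ 2 = -1 -> count2 n 0 0 W - count2 n 0 1 W + u * (count2 n 1 0 W - count2 n 1 1 W) = 0.
  move=> /HW <-; rewrite /count2 !(big_mkcond (fun _ => _ && _)) /= -!sumrB mulr_sumr -big_split /=.
  rewrite big_seq [RHS]big_seq; apply: eq_bigr => f /top_n[t1 t2].
  rewrite /evenchar t1 t2.
  by case: (F2_cases f`_(n - 1)) => ->; case: (F2_cases f`_(n - 2)) => -> /=;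
    rewrite ?F2_expr0 ?F2_expr1; ring.
have i2 := sqrCi algC.
have H1 := H 'i i2; have H2 := H (- 'i) (etrans (sqrrN _) i2).
have i0 : 'i != 0 :> algC by apply: neq0Ci.
have two0 : 2%:R != 0 :> algC by rewrite pnatr_eq0.
have E0 : count2 n 0 0 W = count2 n 0 1 W.
  apply/eqP; rewrite -subr_eq0; apply/eqP/(mulfI two0); rewrite mulr0.
  transitivity ((count2 n 0 0 W - count2 n 0 1 W + 'i * (count2 n 1 0 W - count2 n 1 1 W)) +
    (count2 n 0 0 W - count2 n 0 1 W + - 'i * (count2 n 1 0 W - count2 n 1 1 W))); first by ring.
  by rewrite H1 H2 addr0.
have E1 : count2 n 1 0 W = count2 n 1 1 W.
  apply/eqP; rewrite -subr_eq0; apply/eqP/(mulfI i0); rewrite mulr0.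
  by move: H1; rewrite E0 subrr add0r.
have D : count1 n b1 W = count2 n b1 0 W + count2 n b1 1 W.
  rewrite /count1 /count2 !(big_mkcond (fun _ => _ && _)) [LHS]big_mkcond /= -big_split /=.
  by apply: eq_bigr => f _; case: (F2_cases f`_(n - 2)) => ->; case: (_ == b1);
    rewrite /= ?addr0 ?add0r.
rewrite D mulr_natl mulr2n.
by case: (F2_cases b1) => ->; case: (F2_cases b2) => ->; rewrite ?E0 ?E1.
Qed.

(** * p-adic integers and residues *)

Section PadicTheory.
Variables (p : nat) (p_pr : prime p).
Local Notation Zp := (padic p_pr).
Local Notation F := 'F_p.
Local Notation P k := ((p ^ k)%N%:Z).
Local Notation pp := (p%:R : Zp).
Implicit Types x y z : Zp.

Lemma padicD x y k : (x + y) k = ((x k + y k) %% P k)%Z. Proof. by []. Qed.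
Lemma padicM x y k : (x * y) k = ((x k * y k) %% P k)%Z. Proof. by []. Qed.
Lemma padicN x k : (- x) k = (- x k %% P k)%Z. Proof. by []. Qed.
Lemma padic0 k : (0 : Zp) k = 0. Proof. exact: mod0z. Qed.

Lemma padic_natr (n : nat) k : (n%:R : Zp) k = (n%:Z %% P k)%Z.
Proof.
elim: n => [|n IH]; first by rewrite padic0 mod0z.
rewrite mulrS padicD IH -[(1 : Zp) k]/((1 %% P k)%Z) modzDm.
by rewrite -[1 in LHS]/(1%N%:Z) -PoszD add1n.
Qed.

Lemma natrX_pp m : pp ^+ m = (p ^ m)%N%:R. Proof. by rewrite natrX. Qed.

Lemma P_gt0 k : 0 < P k. Proof. by rewrite ltz_nat expn_gt0 prime_gt0. Qed.
Lemma P_neq0 k : P k != 0. Proof. by rewrite gt_eqF ?P_gt0. Qed.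

(** The quotient by p^k at level [j] is computed from the residue at level [j + k]. *)
Lemma pdvdP k x : pdvd k x <-> x k = 0.
Proof.
split=> [[y ->]|xk].
  by rewrite padicM natrX_pp padic_natr modzMml modzMr.
have dv j : (P k %| x (j + k)%N)%Z.
  by apply/dvdz_mod0P; rewrite -padic_le ?leq_addl.
have coh j : ((x (j.+1 + k)%N %/ P k)%Z = (x (j + k)%N %/ P k)%Z %[mod P j])%Z.
  apply/eqP; rewrite eqz_mod_dvd -(dvdz_mul2r (P_neq0 k)) mulrBl !divzK ?dv //.
  rewrite -PoszM -expnD -eqz_mod_dvd; apply/eqP.
  by rewrite addSn padicS.
exists (padic_of p_pr coh); apply: padic_ext => j.
rewrite padicM natrX_pp padic_natr modzMml /= modzMmr mulrC divzK ?dv //.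
by rewrite -padic_le ?leq_addr.
Qed.

(** Bezout inverses modulo each p^k form a coherent sequence, because inverses modulo p^k are
    unique. *)
Lemma padic_unitE x : (x \is a GRing.unit) = (x 1%N != 0).
Proof.
apply/idP/idP => [xu|x1].
  apply/eqP => x10; have := congr1 (fun z : Zp => z 1%N) (mulrV xu).
  rewrite padicM x10 mul0r mod0z -[1]/(1%:R) padic_natr expn1 modz_small //.
  by rewrite ltz_nat prime_gt1.
have cop k : coprimez (x k) (P k).
  case: k => [|k]; first by rewrite /coprimez expn0 gcdz1.
  have nd : ~~ (p%:Z %| x k.+1)%Z.
    apply: contra x1 => /dvdz_mod0P xp.
    by rewrite (@padic_le _ _ x 1%N k.+1) // expn1 xp.
  rewrite /coprimez -[gcdz _ _]/((gcdn `|x k.+1| (p ^ k.+1))%N%:Z) eqz_nat.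
  rewrite -[_ == 1%N]/(coprime _ _) coprime_sym coprime_pexpl // prime_coprime //.
pose inv k := (egcdz (x k) (P k)).1.
have invP k : (inv k * x k = 1 %[mod P k])%Z.
  rewrite /inv; case: egcdzP => u v /= e _; move: (cop k); rewrite /coprimez => /eqP g1.
  by rewrite (_ : 1 = v * P k + u * x k) ?modzMDl // addrC e.
have coh k : (inv k.+1 = inv k %[mod P k])%Z.
  have e1 : (inv k.+1 * x k = 1 %[mod P k])%Z.
    rewrite -modzMmr -padicS modzMmr.
    have /eqP := invP k.+1; rewrite eqz_mod_dvd => d.
    apply/eqP; rewrite eqz_mod_dvd; apply: dvdz_trans d.
    by apply/dvdnP; exists p; rewrite /= expnS.
  rewrite -[inv k.+1]mulr1 -modzMmr -(invP k) modzMmr mulrA [_ * inv k]mulrC -mulrA.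
  by rewrite -modzMmr e1 modzMmr mulr1.
apply/unitrPr; exists (padic_of p_pr coh); apply: padic_ext => k.
by rewrite padicM /= modzMmr mulrC invP.
Qed.

Lemma residueE x y : residue x = residue y <-> x 1%N = y 1%N.
Proof.
rewrite /residue; split=> [|->//] e.
have lt (z : Zp) : exists2 m : nat, z 1%N = m%:Z & (m < p)%N.
  have := padic_mod z 1; rewrite expn1 => e1.
  have := modz_ge0 (z 1%N) (P_neq0 1); have := ltz_pmod (z 1%N) (P_gt0 1).
  by rewrite expn1 e1; case: (z 1%N) => // m lt _; exists m.
have [m mE mp] := lt x; have [m' mE' mp'] := lt y.
move: e; rewrite mE mE' -!pmulrn => /(congr1 val) /=.
by rewrite !val_Fp_nat // !modn_small // => ->.
Qed.

Lemma intr_Fp_mod (a : int) : (a %% p)%Z%:~R = a%:~R :> F.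
Proof.
by rewrite /modz intrB intrM -[(p%:Z)%:~R]pmulrn pchar_Fp_0 // mulr0 subr0.
Qed.

Fact residue_is_zmod_morphism : zmod_morphism (@residue p p_pr).
Proof.
move=> x y; rewrite /residue padicD padicN modzDmr -rmorphB /= expn1.
by rewrite intr_Fp_mod intrB.
Qed.

HB.instance Definition _ := GRing.isZmodMorphism.Build Zp F (@residue p p_pr)
  residue_is_zmod_morphism.

Fact residue_is_monoid_morphism : monoid_morphism (@residue p p_pr).
Proof.
split; last by move=> x y; rewrite /residue padicM expn1 intr_Fp_mod intrM.
by rewrite /residue -[(1 : Zp) 1%N]/((1 %% P 1)%Z) expn1 intr_Fp_mod.
Qed.

HB.instance Definition _ := GRing.isMonoidMorphism.Build Zp F (@residue p p_pr)
  residue_is_monoid_morphism.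

Lemma residue_eq0 x : residue x = 0 <-> pdvd 1 x.
Proof. by rewrite pdvdP -(rmorph0 (@residue p p_pr)) residueE padic0. Qed.

Lemma unit_residue x : (x \is a GRing.unit) = (residue x != 0).
Proof.
rewrite padic_unitE; congr (~~ _); apply/eqP/eqP => [/pdvdP/residue_eq0//|].
by move/residue_eq0/pdvdP.
Qed.

(** The section of [residue] by representatives in [0, p); it is not multiplicative in general,
    unlike the Teichmüller lift. *)
Definition teich (a : F) : Zp := (a : nat)%:R.

Lemma teichK a : residue (teich a) = a.
Proof. by rewrite rmorph_nat natr_Zp. Qed.

Lemma pp_neq0 : pp != 0.
Proof.
apply/eqP => p0; have := congr1 (fun z : Zp => z 2) p0; rewrite padic_natr padic0.
rewrite modz_small ?andbT /=; first by case=> pz; have := prime_gt0 p_pr; rewrite pz.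
by rewrite ltz_nat -{1}(expn1 p) ltn_exp2l ?prime_gt1.
Qed.

Lemma padic_decomposition x : x != 0 -> exists k u, u \is a GRing.unit /\ x = pp ^+ k * u.
Proof.
move=> /padic_neq0 nz; have [k xk min] := ex_minnP nz.
case: k xk min => [|k] xk min.
  by move: xk; rewrite -(padic_mod x 0) expn0 modz1.
have [u xE] : pdvd k x.
  apply/pdvdP/eqP; apply: contraTT (ltnSn k) => xk0; rewrite -leqNgt; exact: min.
exists k, u; split=> //; rewrite padic_unitE; apply: contra xk => /eqP u1.
apply/eqP/pdvdP; have /pdvdP[v vE] := u1.
by exists v; rewrite xE vE expr1 mulrA exprSr.
Qed.

End PadicTheory.

(** * Maximality of Z_p[x]/(f) *)

Section Reduction.
Variables (p : nat) (p_pr : prime p).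
Local Notation Zp := (padic p_pr).
Local Notation F := 'F_p.
Local Notation pp := (p%:R : {poly Zp}).

Local Notation red := (map_poly (@residue p p_pr)).

Definition liftp (f : {poly F}) : {poly Zp} := map_poly (@teich p p_pr) f.

Lemma coef_liftp f i : (liftp f)`_i = teich p_pr f`_i.
Proof. exact: coef_map_id0. Qed.

Lemma coef_red f i : (red f)`_i = residue f`_i.
Proof. exact: coef_map. Qed.

Lemma liftpK f : red (liftp f) = f.
Proof. by apply/polyP => i; rewrite coef_red coef_liftp teichK. Qed.

Lemma red_pp : red pp = 0.
Proof.
rewrite rmorph_nat; apply: pcharf0; rewrite pchar_poly; exact: pchar_Fp.
Qed.

Lemma red_eq0 f : red f = 0 -> exists g, f = pp * g.
Proof.
move=> rf; have H i : exists y : Zp, f`_i = p%:R * y.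
  have /residue_eq0 [y yE] : residue f`_i = 0 by rewrite -coef_red rf coef0.
  by exists y; rewrite yE expr1.
have [h hE] := choice H; exists (\poly_(i < size f) h i).
apply/polyP => i; rewrite -polyC_natr coefCM coef_poly; case: ltnP => [_|le]; first exact: hE.
by rewrite nth_default // mulr0.
Qed.

Lemma red_eqP f g : red f = red g -> exists h, f = g + pp * h.
Proof.
move=> e; have [h hE] : exists h, f - g = pp * h by apply: red_eq0; rewrite rmorphB /= e subrr.
by exists h; rewrite -hE addrC subrK.
Qed.

Lemma red_monic f : f \is monic -> red f \is monic.
Proof. exact: monic_map. Qed.

Lemma size_red f : f \is monic -> size (red f) = size f.
Proof.
by move=> fm; rewrite size_map_poly_id0 // (monicP fm) rmorph1 oner_eq0.
Qed.

End Reduction.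

Section Fractions.
Variables (R : idomainType).
Local Notation toF := (@FracField.tofrac R).

Lemma fraction_exists (z : {fraction R}) : exists a b, b != 0 /\ z * toF b = toF a.
Proof.
elim/quotW: z => x; exists (frac x).1, (frac x).2; split; first exact: denom_ratioP.
rewrite !piE; apply/eqmodP; rewrite /= FracField.equivfE.
by rewrite !numden_Ratio ?(oner_eq0, mulf_neq0, denom_ratioP) // !mulr1 mulrC.
Qed.

End Fractions.

Section MaximalOrderCriterion.
Variables (p : nat) (p_pr : prime p).
Local Notation Zp := (padic p_pr).
Local Notation Qp := {fraction Zp}.
Local Notation toQp := (@FracField.tofrac Zp).
Local Notation F := 'F_p.
Local Notation red := (map_poly (@residue p p_pr)).

Lemma Qp_denominator (z : Qp) : exists k a, p%:R ^+ k * z = toQp a.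
Proof.
have [a [b [b0 e]]] := fraction_exists z.
have [k [u [uu bE]]] := padic_decomposition b0.
exists k, (a * u^-1); rewrite rmorphM /= -e bE !rmorphM /= rmorphXn /= rmorph_nat.
rewrite -!mulrA -rmorphM /= divrr // rmorph1 mulr1 mulrC //.
Qed.

Lemma Qp_p_neq0 : p%:R != 0 :> Qp.
Proof. by rewrite -(rmorph_nat toQp) tofrac_eq0 pp_neq0. Qed.

Variable f : {poly Zp}.
Hypotheses (f_monic : f \is monic) (f_size : (1 < size f)%N).
Local Notation fQ := (map_poly toQp f).
Local Notation K := {poly %/ fQ}.

Lemma size_fQ : size fQ = size f.
Proof. by rewrite size_map_poly_id0 // (monicP f_monic) rmorph1 oner_eq0. Qed.

Lemma fQ_monic : fQ \is monic. Proof. exact: monic_map. Qed.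

(** [mk_monic] returns a default polynomial unless its argument is monic of positive degree; both
    hold here, so [K] is the intended quotient. *)
Lemma mk_monic_fQ : mk_monic fQ = fQ.
Proof. by rewrite /mk_monic size_fQ f_size fQ_monic. Qed.

Definition ev (g : {poly Zp}) : K := in_qpoly fQ (map_poly toQp g).

Fact ev_is_zmod_morphism : zmod_morphism ev.
Proof. by move=> g h; rewrite /ev rmorphB /= raddfB. Qed.
HB.instance Definition _ := GRing.isZmodMorphism.Build {poly Zp} K ev ev_is_zmod_morphism.
Fact ev_is_monoid_morphism : monoid_morphism ev.
Proof.
split; first by rewrite /ev rmorph1 in_qpoly1.
by move=> g h; rewrite /ev rmorphM /= in_qpolyM.
Qed.
HB.instance Definition _ := GRing.isMonoidMorphism.Build {poly Zp} K ev ev_is_monoid_morphism.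

Lemma evD g h : ev (g + h) = ev g + ev h. Proof. exact: rmorphD. Qed.
Lemma evB g h : ev (g - h) = ev g - ev h. Proof. exact: rmorphB. Qed.
Lemma evM g h : ev (g * h) = ev g * ev h. Proof. exact: rmorphM. Qed.

Lemma ev_f : ev f = 0.
Proof.
apply/val_inj => /=; rewrite mk_monic_fQ -{1}[map_poly _ f]mul1r.
by rewrite Pdiv.RingMonic.rmodp_mull ?fQ_monic.
Qed.

Lemma map_toQp_eq0 g : map_poly toQp g = 0 -> g = 0.
Proof.
move=> e; apply/polyP => i; rewrite coef0; apply/eqP.
by rewrite -tofrac_eq0 -coef_map e coef0.
Qed.

Definition rem (g : {poly Zp}) := Pdiv.Ring.rmodp g f.

Lemma size_rem g : (size (rem g) < size f)%N.
Proof. by rewrite Pdiv.Ring.ltn_rmodp monic_neq0. Qed.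

Lemma rem_eq g : exists h, g = h * f + rem g.
Proof. by exists (Pdiv.Ring.rdivp g f); apply: Pdiv.RingMonic.rdivp_eq. Qed.

Lemma ev_rem g : ev (rem g) = ev g.
Proof.
by have [h hE] := rem_eq g; rewrite [in RHS]hE rmorphD rmorphM /= ev_f mulr0 add0r.
Qed.

Lemma ev_eq0 g : ev g = 0 -> exists h, g = h * f.
Proof.
rewrite -ev_rem => e; have [h hE] := rem_eq g; exists h.
suff -> : h * f = h * f + rem g by [].
rewrite [rem g]map_toQp_eq0 ?addr0 //.
have := congr1 val e; rewrite /=.
by rewrite Pdiv.Ring.rmodp_small // mk_monic_fQ size_fQ (leq_ltn_trans (size_poly _ _)) ?size_rem.
Qed.

Lemma K_cancel (y z : K) : p%:R * y = p%:R * z -> y = z.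
Proof.
have H (x : K) : (p%:R : Qp)^-1 *: (p%:R * x) = x.
  by rewrite mulr_natl -scaler_nat scalerA mulVf ?scale1r ?Qp_p_neq0.
by move=> e; rewrite -[y]H e H.
Qed.

Lemma ev_pp g : ev (p%:R * g) = p%:R * ev g.
Proof. by rewrite rmorphM rmorph_nat. Qed.

Definition pinv (y : K) : K := (p%:R : Qp)^-1 *: y.

Lemma pinvK y : p%:R * pinv y = y.
Proof. by rewrite mulr_natl -scaler_nat /pinv scalerA mulfV ?scale1r ?Qp_p_neq0. Qed.

Lemma in_qpolyK (y : K) : in_qpoly fQ y = y.
Proof. by apply: val_inj; apply: in_qpoly_small; apply: size_mk_monic. Qed.

Lemma K_denominator (y : K) : exists k g, p%:R ^+ k * y = ev g.
Proof.
have H (q : {poly Qp}) : exists k g, p%:R ^+ k *: q = map_poly toQp g.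
  elim/poly_ind: q => [|q c [k [g e]]].
    by exists 0%N, 0; rewrite scaler0 rmorph0.
  have [l [a ea]] := Qp_denominator c.
  exists (k + l)%N, (p%:R ^+ l *: g * 'X + (p%:R ^+ k * a)%:P).
  rewrite rmorphD rmorphM /= map_polyX map_polyC /= map_polyZ /= -e rmorphM /= -ea.
  rewrite !rmorphXn /= !rmorph_nat scalerDr scalerAl scalerA -exprD addnC; congr (_ + _).
  by rewrite -mul_polyC -polyCM mulrA exprD [_ ^+ l * _]mulrC.
have [k [g e]] := H y; exists k, g; rewrite /ev -e.
by rewrite linearZ /= in_qpolyK -natrX mulr_natl -scaler_nat natrX.
Qed.

Local Open Scope classical_set_scope.
Local Notation O := [set in_qpoly fQ (map_poly toQp g) | g in [set: {poly Zp}]].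

Lemma O_ev g : O (ev g). Proof. by exists g. Qed.

Lemma OP y : O y -> exists g, y = ev g. Proof. by move=> [g _ <-]; exists g. Qed.

Let n := (size f).-1.
Lemma size_f_n : size f = n.+1.
Proof. by rewrite /n prednK // ltnW. Qed.

Lemma map_poly_expand (q : {poly Qp}) m : (size q <= m)%N -> q = \sum_(i < m) q`_i *: 'X^i.
Proof.
move=> sq; rewrite -poly_def; apply/polyP => i; rewrite coef_poly.
by case: ltnP => // le; rewrite nth_default // (leq_trans sq).
Qed.

Lemma ev_expand g : ev g = \sum_(i < n) toQp (rem g)`_i *: ev 'X^i.
Proof.
have sr : (size (map_poly toQp (rem g)) <= n)%N.
  by rewrite (leq_trans (size_poly _ _)) // -ltnS -size_f_n size_rem.
rewrite -ev_rem {1}/ev (map_poly_expand sr) linear_sum /=.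
by apply: eq_bigr => i _; rewrite linearZ /= coef_map /ev map_polyXn.
Qed.

Lemma ev_sum m (c : 'I_m -> Zp) (g : 'I_m -> {poly Zp}) :
  \sum_(i < m) toQp (c i) *: ev (g i) = ev (\sum_(i < m) (c i)%:P * g i).
Proof.
rewrite rmorph_sum /=; apply: eq_bigr => i _.
by rewrite /ev rmorphM /= map_polyC /= mul_polyC linearZ.
Qed.

Lemma K_span (y : K) : y = \sum_(i < n) (y : {poly Qp})`_i *: ev 'X^i.
Proof.
have sy : (size (y : {poly Qp}) <= n)%N.
  have e : size (mk_monic fQ) = n.+1 by rewrite mk_monic_fQ size_fQ size_f_n.
  by rewrite -ltnS -e; apply: size_mk_monic.
rewrite -[LHS]in_qpolyK [X in in_qpoly _ X](map_poly_expand sy) linear_sum /=.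
by apply: eq_bigr => i _; rewrite linearZ /= /ev map_polyXn.
Qed.

Lemma O_is_order : @is_order p p_pr K O.
Proof.
split.
- by exists 1 => //; rewrite rmorph1 in_qpoly1.
- by move=> y z /OP[g ->] /OP[h ->]; rewrite -rmorphB; apply: O_ev.
- by move=> y z /OP[g ->] /OP[h ->]; rewrite -rmorphM; apply: O_ev.
exists n, (fun i : 'I_n => ev 'X^i); split; apply/seteqP; split => y //=.
- by move=> /OP[g ->]; exists (fun i : 'I_n => (rem g)`_i) => //; rewrite -ev_expand.
- by move=> [c _ <-]; rewrite ev_sum; apply: O_ev.
by move=> _; exists (fun i : 'I_n => (y : {poly Qp})`_i) => //; rewrite -K_span.
Qed.

(** An order is finitely generated over Z_p, so one power of p clears the denominators of all its
    elements. *)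
Lemma order_denominator (O' : set K) : @is_order p p_pr K O' ->
  exists N, forall y, O' y -> exists g, p%:R ^+ N * y = ev g.
Proof.
case=> _ _ _ [m [e [-> _]]].
have H (i : 'I_m) : exists k : nat, exists g, p%:R ^+ k * e i = ev g by apply: K_denominator.
have [k kE] := choice H; have [g gE] := choice kE.
exists (\sum_(i < m) k i)%N => y [c _ <-].
exists (\sum_(i < m) (c i)%:P * (p%:R ^+ (\sum_(j < m | j != i) k j) * g i)).
rewrite -ev_sum mulr_sumr; apply: eq_bigr => i _.
rewrite rmorphM rmorphXn /= rmorph_nat -gE (bigD1 i) //= -scalerAr; congr (_ *: _).
by rewrite mulrA -exprD addnC.
Qed.

Section Splitting.
Variables (D G H : {poly Zp}).
Hypothesis f_split : f = D ^+ 2 * G + p%:R * H.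
Hypothesis G_sep : separable_poly (red G).

Lemma red_f : red f = red D ^+ 2 * red G.
Proof. by rewrite f_split rmorphD !rmorphM /= red_pp mul0r addr0. Qed.

Lemma red_f_neq0 : red f != 0.
Proof. by rewrite monic_neq0 // red_monic. Qed.

(** With E the lift of [e], this produces the lift psi = E D1^2 G of the quotient of [red f] by [e];
    psi / p is the candidate element of a larger order. *)
Lemma factor_lift (e : {poly F}) : e %| red D -> exists D1 D2,
  D = liftp p_pr e * D1 + p%:R * D2 /\ red f = e * red (liftp p_pr e * D1 ^+ 2 * G).
Proof.
move=> /dvdpP[d1 d1E]; have [D2 DE] : exists D2, D = liftp p_pr e * liftp p_pr d1 + p%:R * D2.
  by apply: red_eqP; rewrite rmorphM /= !liftpK d1E mulrC.
exists (liftp p_pr d1), D2; split=> //.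
by rewrite red_f !rmorphM /= !liftpK d1E; ring.
Qed.

(* If [O'] strictly contains [O], the polynomials [g] with [g / p] in [O'] reduce
   to an ideal generated by some [red h] with a common factor [e] with
   [red f / red h]; then [e] divides [red D], and the hypothesis makes [e]
   invertible modulo [p] in [O'], so [h / e] would contradict minimality. *)
Lemma maximal_of_coprime : coprimep (red H) (red D) -> is_maximal f.
Proof.
move=> cop; split; first exact: O_is_order.
move=> O' O'ord OO'; apply/seteqP; split; last exact: OO'.
have [oneO' Osub Omul _] := O'ord; have [N0 N0P] := order_denominator O'ord.
have O'ev g : O' (ev g) by apply/OO'/O_ev.
have O'opp y : O' y -> O' (- y).
  by move=> Oy; rewrite -sub0r; apply: Osub => //; rewrite -(rmorph0 ev).
have O'add y z : O' y -> O' z -> O' (y + z).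
  by move=> Oy Oz; rewrite -[z]opprK; apply: Osub => //; apply: O'opp.
move=> y0 Oy0; apply: contrapT => nOy0.
pose J h := exists2 y, O' y & ev h = p%:R * y.
have Jmul g h : J h -> J (g * h).
  move=> [y Oy e]; exists (ev g * y); first exact: Omul.
  by rewrite rmorphM /= e mulrCA.
have Jsub g h : J g -> J h -> J (g - h).
  move=> [y Oy ey] [z Oz ez]; exists (y - z); first exact: Osub.
  by rewrite rmorphB /= ey ez mulrBr.
have Jred g h : red g = red h -> J h -> J g.
  move=> /red_eqP[k ->] [y Oy ey]; exists (y + ev k); first exact: O'add.
  by rewrite rmorphD /= ey ev_pp mulrDr.
(* The least exponent N + 1 bringing p^(N+1) y0 into O gives y1 = p^N y0 in [O'] but not in O. If
   [red f] divided [red g], then g = c f + p h and y1 = ev h would lie in O. *)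
have [g1 Jg1 g1nd] : exists2 g1, J g1 & ~~ (red f %| red g1).
  have ex : exists N, `[< exists g, p%:R ^+ N * y0 = ev g >].
    by have [g e] := N0P _ Oy0; exists N0; apply/asboolP; exists g.
  have [[|N] /asboolP[g gE] min] := ex_minnP ex.
    by case: nOy0; rewrite -[y0]mul1r gE; apply: O_ev.
  pose y1 := p%:R ^+ N * y0.
  have Oy1 : O' y1 by rewrite /y1 -(rmorph_nat ev) -rmorphXn; apply: Omul.
  exists g; first by exists y1 => //; rewrite -gE exprS mulrA.
  apply/negP => /dvdpP[c cE].
  have [h hE] : exists h, g = liftp p_pr c * f + p%:R * h.
    by apply: red_eqP; rewrite rmorphM /= liftpK.
  have : p%:R * y1 = p%:R * ev h.
    by rewrite -ev_pp /y1 mulrA -exprS gE hE rmorphD rmorphM /= ev_f mulr0 add0r.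
  move=> /K_cancel y1h; have := min N; rewrite ltnn => /(_ _)/negP.
  by apply => //; apply/asboolP; exists h.
have exm : exists k, `[< exists h, [/\ J h, red h != 0 & size (red h) = k] >].
  exists (size (red g1)); apply/asboolP; exists g1; split=> //.
  by apply: contraNneq g1nd => ->; rewrite dvdp0.
have [k /asboolP[h [Jh h0 sh]] min] := ex_minnP exm.
have hmin j : J j -> red h %| red j.
  move=> Jj; pose r := j - liftp p_pr (red j %/ red h) * h.
  have rr : red r = red j %% red h.
    by rewrite /r rmorphB rmorphM /= liftpK {1}(divp_eq (red j) (red h)) addrC addKr.
  rewrite /dvdp -rr; apply/negPn/negP => r0.
  have : (k <= size (red r))%N.
    apply: min; apply/asboolP; exists r; split=> //.
    by apply: Jsub => //; apply: Jmul.
  by rewrite -sh rr leqNgt ltn_modp h0.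
have Jf : J f by exists 0; [rewrite -(rmorph0 ev) | rewrite ev_f mulr0].
have /dvdpP[q qE] := hmin _ Jf.
have q0 : q != 0 by apply: contraNneq red_f_neq0 => q0; rewrite qE q0 mul0r.
have sq : (1 < size q)%N.
  rewrite ltn_neqAle eq_sym size_poly_gt0 q0 andbT.
  apply: contra g1nd; rewrite size_poly_eq1 => q1.
  by rewrite qE (eqp_dvdl _ (eqp_mulr _ q1)) mul1r hmin.
(* With ev h = p y and y in [O'], the bound [N0] puts p^N0 y^(N0+1) in O, so h^(N0+1) is divisible
   by p modulo f. Hence [q], a divisor of [red f], cannot be coprime to [red h]. *)
have fdvd : red f %| red h ^+ N0.+1.
  have [y Oy ey] := Jh.
  have OyX m : O' (y ^+ m) by elim: m => // m IH; rewrite exprS; apply: Omul.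
  have [g gE] := N0P _ (OyX N0.+1).
  have : ev (h ^+ N0.+1 - p%:R * g) = 0.
    by rewrite rmorphB rmorphXn /= ey ev_pp -gE exprMn exprS -mulrA subrr.
  move=> /ev_eq0[c cE]; apply/dvdpP; exists (red c).
  by have := congr1 red cE; rewrite rmorphB !rmorphM rmorphXn /= red_pp mul0r subr0.
pose e := gcdp q (red h).
have e0 : e != 0 by rewrite gcdp_eq0 negb_and q0.
have se : (1 < size e)%N.
  rewrite ltn_neqAle eq_sym size_poly_gt0 e0 andbT -coprimep_def.
  apply/negP => /(coprimep_expr N0.+1) cq.
  have qd : q %| red h ^+ N0.+1 by apply: dvdp_trans fdvd; rewrite qE dvdp_mulIl.
  have /coprimepP/(_ q (dvdpp _) qd) := cq.
  by rewrite -size_poly_eq1 => /eqP s1; rewrite s1 in sq.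
have [q' q'E] : exists q', q = q' * e by apply/dvdpP; apply: dvdp_gcdl.
have [h1 h1E] : exists h1, red h = h1 * e by apply/dvdpP; apply: dvdp_gcdr.
(* Both factors of red f = q (red h) are multiples of [e], so e^2 divides D^2 G modulo p, where G is
   separable. *)
have eD : e %| red D.
  apply: (dvdp_sqr_separable e0 G_sep); rewrite -red_f qE q'E h1E.
  by rewrite mulrACA -expr2 dvdp_mulIr.
have [D1 [D2 [DE fE]]] := factor_lift eD.
set E := liftp p_pr e in DE fE; pose psi := E * D1 ^+ 2 * G.
have Jpsi : J psi.
  apply: (@Jred _ (liftp p_pr q' * h)); last exact: Jmul.
  by apply: (mulfI e0); rewrite -fE qE [q in q * _]q'E rmorphM /= liftpK; ring.
have [z Oz ez] := Jpsi.
(* The relation f = 0, expanded through D = E D1 + p D2 and divided by p: modulo p, H is a multiple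
   of E in [O']. *)
have evH : ev H = - (ev E * (z + ev (D1 * D2 * G *+ 2))) - p%:R * ev (D2 ^+ 2 * G).
  apply: K_cancel; rewrite -ev_pp.
  have -> : p%:R * H = f - E * psi - p%:R * (E * (D1 * D2 * G *+ 2)) - p%:R * (p%:R * (D2 ^+ 2 * G)).
    by rewrite {1}f_split /psi DE; ring.
  by rewrite !rmorphB /= ev_f !ev_pp [ev (E * psi)]rmorphM [ev (E * _)]rmorphM /= ez; ring.
have [[a b] /= ab] : exists u, u.1 * red H + u.2 * e = 1.
  by apply/Bezout_eq1_coprimepP; apply: coprimep_dvdl eD cop.
have [cc ccE] : exists cc, liftp p_pr a * H + liftp p_pr b * E = 1 + p%:R * cc.
  by apply: red_eqP; rewrite rmorphD !rmorphM /= !liftpK rmorph1.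
(* The Bezout relation between H and [e] therefore makes E invertible in [O'] modulo p. *)
have one : 1 = ev E * (ev (liftp p_pr b) - ev (liftp p_pr a) * (z + ev (D1 * D2 * G *+ 2)))
    - p%:R * ev (liftp p_pr a * (D2 ^+ 2 * G) + cc).
  have := congr1 ev ccE.
  rewrite !evD (evM (liftp p_pr a)) (evM (liftp p_pr b)) (evM (liftp p_pr a) (D2 ^+ 2 * G)).
  rewrite evH rmorph1 ev_pp => /eqP.
  by rewrite -subr_eq0 => /eqP H0; apply/eqP; rewrite eq_sym -subr_eq0 -H0; apply/eqP; ring.
set w := ev (liftp _ b) - _ in one; set v := liftp p_pr a * _ + cc in one.
have Ow : O' w by apply: Osub => //; apply: Omul => //; apply: O'add.
have JH1 : J (liftp p_pr h1).
  have [t Ot et] : J (E * liftp p_pr h1).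
    by apply: Jred Jh; rewrite rmorphM /= !liftpK h1E mulrC.
  exists (t * w - ev v * ev (liftp p_pr h1)); first by apply: Osub; apply: Omul.
  transitivity ((ev E * ev (liftp p_pr h1)) * w - p%:R * ev v * ev (liftp p_pr h1)).
    by rewrite -[LHS]mulr1 {1}one; ring.
  by rewrite -evM et; ring.
have h10 : h1 != 0 by apply: contraNneq h0 => h10; rewrite h1E h10 mul0r.
have : (k <= size h1)%N.
  by apply: min; apply/asboolP; exists (liftp p_pr h1); rewrite liftpK.
rewrite -sh h1E size_mul // -(prednK (ltnW se)) addnS /=.
rewrite -[X in (_ <= X)%N]addn0 leq_add2l leqn0 => /eqP s0.
by have := prednK (ltnW se); rewrite s0 => s1; rewrite -s1 in se.
Qed.

(* Adjoining [psi / p], where [psi] lifts [red f / e] and [e] is the gcd, gives a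
   strictly larger order. *)
Lemma coprime_of_maximal : is_maximal f -> coprimep (red H) (red D).
Proof.
move=> [_ max]; apply/negPn/negP; rewrite coprimep_def => se; set e := gcdp _ _ in se.
have D0 : red D != 0.
  by apply: contraNneq red_f_neq0 => D0; rewrite red_f D0 expr0n mul0r.
have e0 : e != 0 by rewrite gcdp_eq0 negb_and D0 orbT.
have [D1 [D2 [DE fE]]] := factor_lift (dvdp_gcdr (red H) (red D)).
rewrite -/e in DE fE; set E := liftp p_pr e in DE fE; pose psi := E * D1 ^+ 2 * G.
(* As [e] divides H modulo p, the left side is a combination of E and p. This gives psi / p the
   monic equation t^2 + F1 t + F2 D1^2 G = 0 in K. *)
have [F1 [F2 F12]] : exists F1 F2,
    H + E * (D1 * D2 * G *+ 2) + p%:R * (D2 ^+ 2 * G) = E * F1 + p%:R * F2.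
  have [c cE] : exists c, red H = c * e by apply/dvdpP; apply: dvdp_gcdl.
  exists (liftp p_pr c + D1 * D2 * G *+ 2); apply: red_eqP.
  rewrite !rmorphD !rmorphM !rmorphD /= red_pp !liftpK cE; ring.
have psi2 : ev psi * ev psi = p%:R * (- (ev F1 * ev psi) - p%:R * ev (F2 * (D1 ^+ 2 * G))).
  have -> : ev psi * ev psi = ev (psi * psi - f * (D1 ^+ 2 * G)).
    by rewrite rmorphB !rmorphM /= ev_f mul0r subr0.
  have -> : psi * psi - f * (D1 ^+ 2 * G) = - (p%:R * (F1 * psi + p%:R * (F2 * (D1 ^+ 2 * G)))).
    transitivity (- (p%:R * (E * F1 + p%:R * F2) * (D1 ^+ 2 * G))); last by rewrite /psi; ring.
    by rewrite -F12 {1}f_split /psi DE; ring.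
  by rewrite rmorphN /= ev_pp rmorphD /= ev_pp [ev (F1 * _)]rmorphM /=; ring.
(* [O2] is O + O (psi / p), written without division; it is generated by the x^j and x^j psi / p
   with j < n. *)
pose O2 := [set y : K | exists a b, p%:R * y = p%:R * ev a + ev b * ev psi].
have O2order : @is_order p p_pr K O2.
  split.
  - by exists 1, 0; rewrite rmorph1 rmorph0 mul0r addr0.
  - move=> y z [a [b e1]] [a' [b' e2]]; exists (a - a'), (b - b').
    by rewrite mulrBr e1 e2 !rmorphB /=; ring.
  - move=> y z [a [b e1]] [a' [b' e2]].
    exists (a * a' - b * b' * (F2 * (D1 ^+ 2 * G))), (a * b' + a' * b - b * b' * F1).
    apply: K_cancel; transitivity ((p%:R * y) * (p%:R * z)); first by ring.
    rewrite e1 e2.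
    transitivity (p%:R * (p%:R * (ev a * ev a') + (ev a * ev b' + ev a' * ev b) * ev psi)
      + ev b * ev b' * (ev psi * ev psi)); first by ring.
    rewrite psi2; move: (F2 * _) => c; rewrite !(evB, evD, evM); ring.
  exists (n + n)%N, (fun i : 'I_(n + n) => match fintype.split i with
    | inl j => ev 'X^j | inr j => pinv (ev 'X^j * ev psi) end).
  have sumE (c : 'I_(n + n) -> Qp) :
    \sum_(i < n + n) c i *: match fintype.split i with
       | inl j => ev 'X^j | inr j => pinv (ev 'X^j * ev psi) end =
    \sum_(i < n) c (lshift n i) *: ev 'X^i +
    \sum_(i < n) c (rshift n i) *: pinv (ev 'X^i * ev psi).
    rewrite big_split_ord; congr (_ + _); apply: eq_bigr => i _.
      by rewrite (unsplitK (inl i)).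
    by rewrite (unsplitK (inr i)).
  split; apply/seteqP; split => y //=.
  - move=> [a [b e1]].
    exists (fun i => match fintype.split i with inl j => (rem a)`_j | inr j => (rem b)`_j end) => //.
    rewrite (sumE (fun i => toQp _)); apply: K_cancel; rewrite e1 mulrDr; congr (_ + _).
      rewrite (ev_expand a); congr (_ * _); apply: eq_bigr => i _.
      by rewrite (unsplitK (inl i)).
    rewrite (ev_expand b) mulr_suml mulr_sumr; apply: eq_bigr => i _.
    by rewrite (unsplitK (inr i)) -scalerAr pinvK scalerAl.
  - move=> [c _ <-]; rewrite (sumE (fun i => toQp (c i))).
    exists (\sum_(i < n) (c (lshift n i))%:P * 'X^i), (\sum_(i < n) (c (rshift n i))%:P * 'X^i).
    rewrite mulrDr -!ev_sum; congr (_ + _).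
    rewrite mulr_sumr mulr_suml; apply: eq_bigr => i _.
    by rewrite -scalerAr pinvK scalerAl.
  move=> _; exists (fun i => match fintype.split i with inl j => (y : {poly Qp})`_j | inr j => 0 end) => //.
  rewrite sumE [X in _ + X]big1 ?addr0 => [|i _]; last first.
    by rewrite (unsplitK (inr i)) scale0r.
  rewrite [RHS]K_span; apply: eq_bigr => i _.
  by rewrite (unsplitK (inl i)).
have OO2 : O `<=` O2.
  by move=> y /OP[g ->]; exists g, 0; rewrite rmorph0 mul0r addr0.
have := max _ O2order OO2 => O2O.
have : O2 (pinv (ev psi)).
  by exists 0, 1; rewrite pinvK rmorph0 rmorph1 mulr0 add0r mul1r.
rewrite O2O => /OP[g gE].
have : ev (psi - p%:R * g) = 0 by rewrite rmorphB /= ev_pp -gE pinvK subrr.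
move=> /ev_eq0[c cE].
have psi0 : red psi != 0.
  by apply: contraNneq red_f_neq0 => z; rewrite fE -/psi z mulr0.
have : red f %| red psi.
  apply/dvdpP; exists (red c); have := congr1 red cE.
  by rewrite rmorphB !rmorphM /= red_pp mul0r subr0.
move=> /(dvdp_leq psi0); rewrite fE -/psi size_mul //.
have e1 : (1 < size e)%N by rewrite ltn_neqAle eq_sym se size_poly_gt0.
rewrite -(prednK (ltnW e1)) addSn /= -{2}[size (red psi)]add0n leq_add2r leqn0 => /eqP s0.
by have := prednK (ltnW e1); rewrite s0 => s1; rewrite -s1 in e1.
Qed.

(* Dedekind's criterion. *)
Lemma maximal_iff_coprime : is_maximal f <-> coprimep (red H) (red D).
Proof. by split; [apply: coprime_of_maximal | apply: maximal_of_coprime]. Qed.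

End Splitting.
End MaximalOrderCriterion.

(** * The discriminant modulo p^2 *)

Section BandMatrices.
Variable R : comNzRingType.

(** A Sylvester matrix whose row counts are parameters, so that reduction modulo p keeps its shape
    even when the degree of f' drops. *)
Definition band a n (f g : {poly R}) : 'M[R]_(a + n) :=
  \matrix_(i, j) match fintype.split i with
                 | inl k => ('X^k * f)`_j
                 | inr k => ('X^k * g)`_j end.

Lemma Sylvester_band (f g : {poly R}) :
  Sylvester_mx f g = band (size g).-1 (size f).-1 f g.
Proof.
apply/matrixP => i j; rewrite Sylvester_mxE mxE.
by case: fintype.split => k; rewrite coefXnM ltnNge if_neg -mulrb.
Qed.

Lemma mul_band a n (f g : {poly R}) (w : 'rV_(a + n)) j :
  (w *m band a n f g) 0 j = (rVpoly (lsubmx w) * f + rVpoly (rsubmx w) * g)`_j.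
Proof.
have E m (v : 'rV[R]_m) (q : {poly R}) : (rVpoly v * q)`_j = \sum_(k < m) v 0 k * ('X^k * q)`_j.
  rewrite [rVpoly v]poly_def mulr_suml coef_sum; apply: eq_bigr => k _.
  by rewrite -scalerAl coefZ -coef_rVpoly_ord coef_rVpoly valK.
rewrite mxE big_split_ord coefD !E; congr (_ + _); apply: eq_bigr => k _; rewrite !mxE.
  by rewrite (unsplitK (inl k)).
by rewrite (unsplitK (inr k)).
Qed.

Lemma leq_pred_add (i j k l : nat) : (i <= k)%N -> (j <= l.+1)%N -> ((i + j).-1 <= k + l)%N.
Proof. lia. Qed.

Lemma size_combination a n (f g : {poly R}) (w : 'rV[R]_(a + n)) :
  (0 < a + n)%N -> (size f <= n.+1)%N -> (size g <= a.+1)%N ->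
  (size (rVpoly (lsubmx w) * f + rVpoly (rsubmx w) * g)%R <= a + n)%N.
Proof.
move=> an sf sg; have su := size_rVpoly (lsubmx w); have sv := size_rVpoly (rsubmx w).
rewrite (leq_trans (size_polyD _ _)) // geq_max; apply/andP; split;
  apply: leq_trans (size_polyMleq _ _) _; first exact: leq_pred_add.
by rewrite [X in (_ <= X)%N]addnC; apply: leq_pred_add.
Qed.

Lemma band_kernel a n (f g : {poly R}) (w : 'rV[R]_(a + n)) :
  (0 < a + n)%N -> (size f <= n.+1)%N -> (size g <= a.+1)%N ->
  w *m band a n f g = 0 <-> rVpoly (lsubmx w) * f + rVpoly (rsubmx w) * g = 0.
Proof.
move=> an sf sg; split=> [e|e]; last by apply/rowP => j; rewrite mul_band e coef0 mxE.
apply/polyP => i; rewrite coef0; have [lt|ge] := ltnP i (a + n).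
  by have := congr1 (fun z : 'rV[R]_(a + n) => z 0 (Ordinal lt)) e; rewrite mul_band mxE.
by rewrite nth_default // (leq_trans (size_combination _ an sf sg)).
Qed.

End BandMatrices.

Section PadicDeterminants.
Variables (p : nat) (p_pr : prime p).
Local Notation Zp := (padic p_pr).
Local Notation F := 'F_p.
Local Notation res := (@residue p p_pr).

(** The invertible factors of a rank factorization of the reduction lift to invertible [L] and [U].
    The rows of L^-1 S U^-1 beyond the rank are divisible by p, and there are at least two. *)
Lemma pdvd_det_corank2 n (S : 'M[Zp]_n) : (\rank (map_mx res S) + 2 <= n)%N -> pdvd 2 (\det S).
Proof.
set Sb := map_mx _ S; set r := \rank Sb => rn.
pose L : 'M[Zp]_n := map_mx (@teich p p_pr) (col_ebase Sb).
pose U : 'M[Zp]_n := map_mx (@teich p p_pr) (row_ebase Sb).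
have redM (M : 'M[F]_n) : map_mx res (map_mx (@teich p p_pr) M) = M.
  by apply/matrixP => i j; rewrite !mxE teichK.
have unitL : L \in unitmx.
  by rewrite unitmxE unit_residue -det_map_mx redM -unitfE -unitmxE col_ebase_unit.
have unitU : U \in unitmx.
  by rewrite unitmxE unit_residue -det_map_mx redM -unitfE -unitmxE row_ebase_unit.
pose M := invmx L *m S *m invmx U.
have SE : S = L *m M *m U by rewrite /M !mulmxA mulmxV // mul1mx mulmxKV.
have Mb : map_mx res M = pid_mx r.
  have E : Sb = col_ebase Sb *m map_mx res M *m row_ebase Sb.
    by rewrite -[LHS]/(map_mx res S) {1}SE !map_mxM /= !redM.
  rewrite -[X in X = _](mulmx_ebase Sb) in E.
  move: (col_ebase_unit Sb) (row_ebase_unit Sb) E.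
  rewrite -/r; move: (col_ebase Sb) (row_ebase Sb) (map_mx res M) => A B N uA uB E.
  by move/(can_inj (mulmxK uB))/(can_inj (mulKmx uA)): E => <-.
clearbody M.
have H (ij : 'I_n * 'I_n) : exists y : Zp, (r <= ij.1)%N -> M ij.1 ij.2 = p%:R * y.
  have [le|lt] := leqP r ij.1; last by exists 0.
  have /residue_eq0 [y yE] : residue (M ij.1 ij.2) = 0.
    have := congr1 (fun z : 'M[F]_n => z ij.1 ij.2) Mb; rewrite !mxE => ->.
    by rewrite ltnNge le andbF.
  by exists y; rewrite yE expr1.
have [h hE] := choice H.
pose M' := \matrix_(i < n, j < n) (if (r <= i)%N then h (i, j) else M i j).
pose d := \row_(i < n) (if (r <= i)%N then p%:R else 1 : Zp).
have ME : M = diag_mx d *m M'.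
  apply/matrixP => i j; rewrite mul_diag_mx !mxE.
  have [le|_] := leqP r i; last by rewrite mul1r.
  exact: (hE (i, j)).
have lt1 : (r < n)%N by lia.
have lt2 : (r.+1 < n)%N by lia.
have : pdvd 2 (\det (diag_mx d)).
  rewrite det_diag (bigD1 (Ordinal lt1)) //= (bigD1 (Ordinal lt2)); last first.
    by rewrite -val_eqE /= gtn_eqF.
  rewrite /= !mxE /= leqnn leqnSn mulrA -expr2.
  by eexists; reflexivity.
move=> [c cE]; exists (\det L * (c * \det M') * \det U).
by rewrite SE !det_mulmx ME det_mulmx cE; ring.
Qed.

Lemma padic_natr_neq0 n : (0 < n)%N -> (n%:R : Zp) != 0.
Proof.
move=> n0; apply/eqP => e; have := congr1 (fun z : Zp => z n) e; rewrite padic_natr padic0.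
rewrite modz_small; first by case=> z; rewrite z in n0.
by rewrite lez_nat ltz_nat ltn_expl ?prime_gt1.
Qed.

End PadicDeterminants.

Section Discriminant.
Variables (p : nat) (p_pr : prime p).
Local Notation Zp := (padic p_pr).
Local Notation F := 'F_p.
Local Notation res := (@residue p p_pr).
Local Notation red := (map_poly (@residue p p_pr)).

Variables (f : {poly Zp}) (n : nat).
Hypotheses (f_monic : f \is monic) (f_size : size f = n.+2).

(** The leading coefficient n + 1 of f' is nonzero in Z_p even when p divides it, so the resultant
    in [disc] has the shape used in [disc_band]. *)
Lemma size_derivf : size f^`() = n.+1.
Proof.
apply/eqP; rewrite eqn_leq; apply/andP; split.
  by rewrite -ltnS -f_size lt_size_deriv // monic_neq0.
rewrite ltnNge; apply/negP => /leq_sizeP/(_ n (leqnn n)).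
rewrite coef_deriv; have := f_monic; rewrite monicE /lead_coef f_size /= => /eqP->.
by move/eqP; rewrite (negPf (padic_natr_neq0 p_pr (ltn0Sn n))).
Qed.

Lemma disc_band : exists c : Zp, disc f = c * \det (band n n.+1 f f^`()) /\ c * c = 1.
Proof.
exists ((-1) ^+ 'C((size f).-1, 2)); rewrite -expr2 exprAC sqrrN !expr1n; split=> //.
rewrite /disc /resultant Sylvester_band.
by rewrite size_derivf f_size.
Qed.

Local Notation S := (band n n.+1 f f^`()).
Local Notation Sb := (band n n.+1 (red f) (red f)^`()).

Lemma pdvd_disc k : pdvd k (disc f) <-> pdvd k (\det S).
Proof.
have [c [-> cc]] := disc_band; split=> -[y yE].
  by exists (c * y); rewrite mulrCA -yE mulrA cc mul1r.
by exists (c * y); rewrite yE mulrCA.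
Qed.

Lemma map_band : map_mx res S = Sb.
Proof.
apply/matrixP => i j; rewrite !mxE.
by case: fintype.split => k; rewrite ?deriv_map -coef_map rmorphM /= map_polyXn.
Qed.

Lemma size_redf : size (red f) = n.+2. Proof. by rewrite size_red. Qed.

Lemma size_redf' : (size (red f)^`() <= n.+1)%N.
Proof. by rewrite -ltnS -size_redf lt_size_deriv // -size_poly_gt0 size_redf. Qed.

Lemma redf_neq0 : red f != 0. Proof. by rewrite -size_poly_gt0 size_redf. Qed.

Lemma band_kernelP (w : 'rV[F]_(n + n.+1)) : w *m Sb = 0 <->
  rVpoly (lsubmx w) * red f + rVpoly (rsubmx w) * (red f)^`() = 0.
Proof. by apply: band_kernel; rewrite ?addnS ?size_redf ?size_redf'. Qed.

Definition kernel_row (u v : {poly F}) : 'rV[F]_(n + n.+1) := row_mx (poly_rV u) (poly_rV v).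

Lemma kernel_rowP (u v : {poly F}) : (size u <= n)%N -> (size v <= n.+1)%N ->
  u * red f + v * (red f)^`() = 0 -> kernel_row u v *m Sb = 0.
Proof. by move=> su sv e; apply/band_kernelP; rewrite row_mxKl row_mxKr !poly_rV_K. Qed.

(** If f and f' are coprime, a kernel pair (u, v) has f dividing v, hence v = 0 by degree and u = 0.
    A nonconstant gcd h gives the kernel pair (f'/h, - f/h). *)
Lemma band_det0P : (\det Sb == 0) = ~~ separable_poly (red f).
Proof.
rewrite unlock; apply/det0P/idP => [[w w0 /band_kernelP e]|].
  apply: contra w0 => cop.
  have dv : red f %| rVpoly (rsubmx w).
    rewrite -(Gauss_dvdpl _ cop) -(dvdp_addr _ (dvdp_mull (rVpoly (lsubmx w)) (dvdpp _))).
    by rewrite e dvdp0.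
  have v0 : rVpoly (rsubmx w) = 0.
    apply/eqP; apply: contraTT dv => v0; rewrite gtNdvdp //.
    by rewrite size_redf ltnS size_rVpoly.
  have u0 : rVpoly (lsubmx w) = 0.
    by move/eqP: e; rewrite v0 mul0r addr0 mulf_eq0 (negPf redf_neq0) orbF => /eqP.
  by rewrite -[w]hsubmxK -[lsubmx w]rVpolyK -[rsubmx w]rVpolyK u0 v0 !linear0 row_mx0.
rewrite coprimep_def => sh; set h := gcdp _ _ in sh.
have h0 : h != 0 by rewrite gcdp_eq0 negb_and redf_neq0.
have sh1 : (1 < size h)%N by rewrite ltn_neqAle eq_sym sh size_poly_gt0.
have [G GE] : exists G, red f = G * h by apply/dvdpP; apply: dvdp_gcdl.
have [k kE] : exists k, (red f)^`() = k * h by apply/dvdpP; apply: dvdp_gcdr.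
have G0 : G != 0 by apply: contraNneq redf_neq0 => G0; rewrite GE G0 mul0r.
have sG : (size G <= n.+1)%N.
  have := size_redf; rewrite GE size_mul // => /eqP; lia.
have sk : (size k <= n)%N.
  have [->|k0] := eqVneq k 0; first by rewrite size_poly0.
  have := size_redf'; rewrite kE size_mul // => H; lia.
exists (kernel_row k (- G)).
  apply/eqP => /(congr1 rsubmx); rewrite row_mxKr linear0 => /(congr1 rVpoly).
  rewrite poly_rV_K ?size_polyN // linear0 => /eqP; rewrite oppr_eq0 (negPf G0) //.
apply: kernel_rowP; rewrite ?size_polyN // kE GE; ring.
Qed.

Lemma disc_unit : ~ pdvd 1 (disc f) <-> separable_poly (red f).
Proof.
have : (residue (\det S) == 0) = ~~ separable_poly (red f).
  by rewrite -det_map_mx map_band band_det0P.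
move=> e; split=> [nd|sep].
  by apply/negPn; rewrite -e; apply/eqP => /residue_eq0 /pdvd_disc.
by move=> /pdvd_disc /residue_eq0 /eqP; rewrite e sep.
Qed.

(* If the gcd of [red f] and its derivative has degree at least 2, the Sylvester
   matrix has corank at least 2 modulo [p], hence determinant divisible by
   [p ^+ 2]. *)
Lemma disc_valuation1 : has_valuation (disc f) 1 -> has_simple_double_root (red f).
Proof.
case=> d1 d2; have nsep : ~~ separable_poly (red f) by apply/negP => /disc_unit.
rewrite /has_simple_double_root; move: nsep; rewrite unlock coprimep_def => sh.
set h := gcdp _ _ in sh *.
have h0 : h != 0 by rewrite gcdp_eq0 negb_and redf_neq0.
have sh1 : (1 < size h)%N by rewrite ltn_neqAle eq_sym sh size_poly_gt0.
rewrite eqn_leq sh1 andbT leqNgt; apply/negP => sh2; apply: d2; apply/pdvd_disc.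
apply: pdvd_det_corank2; rewrite map_band.
have [G GE] : exists G, red f = G * h by apply/dvdpP; apply: dvdp_gcdl.
have [k kE] : exists k, (red f)^`() = k * h by apply/dvdpP; apply: dvdp_gcdr.
have G0 : G != 0 by apply: contraNneq redf_neq0 => G0; rewrite GE G0 mul0r.
have sG : (size G < n.+1)%N.
  have := size_redf; rewrite GE size_mul // => /eqP; lia.
have sk : (size k <= n.-1)%N.
  have [->|k0] := eqVneq k 0; first by rewrite size_poly0.
  have := size_redf'; rewrite kE size_mul // => H; lia.
have sXG : (size ('X * G)%R <= n.+1)%N.
  by rewrite (leq_trans (size_polyMleq _ _)) // size_polyX.
have sXk : (size ('X * k)%R <= n)%N.
  have [->|k0] := eqVneq k 0; first by rewrite mulr0 size_poly0.
  have : (0 < size k)%N by rewrite size_poly_gt0.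
  rewrite size_monicM ?monicX // size_polyX /= => k1.
  by rewrite (leq_ltn_trans sk) // prednK // (leq_trans k1) // (leq_trans sk) // leq_pred.
(* The kernel pair (k, - G) and its multiple by x both fit the shape because the gcd has degree at
   least 2; they are independent since G is nonzero. *)
pose K := col_mx (kernel_row k (- G)) (kernel_row ('X * k) (- ('X * G))).
have KS : K *m Sb = 0.
  have K1 : kernel_row k (- G) *m Sb = 0.
    apply: kernel_rowP; rewrite ?size_polyN ?(ltnW sG) ?(leq_trans sk) ?leq_pred //.
    by rewrite kE GE; ring.
  have K2 : kernel_row ('X * k) (- ('X * G)) *m Sb = 0.
    by apply: kernel_rowP; rewrite ?size_polyN // kE GE; ring.
  by rewrite mul_col_mx K1 K2 col_mx0.
have Kfree : row_free K.
  apply: inj_row_free => v; rewrite -[v]hsubmxK mul_row_col.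
  move=> /(congr1 rsubmx); rewrite !linearD /= linear0.
  set a := lsubmx v; set b := rsubmx v.
  have sc (c : 'rV[F]_1) (w : 'rV[F]_(n + n.+1)) : c *m w = c 0 0 *: w.
    by rewrite [in LHS](mx11_scalar c) mul_scalar_mx.
  rewrite !sc !linearZ /= !row_mxKr => /(congr1 rVpoly).
  rewrite linearD !linearZ /= !poly_rV_K ?size_polyN ?(ltnW sG) // linear0 => e.
  have : (- (a 0 0)%:P - (b 0 0) *: 'X) * G = 0.
    by rewrite -e -!mul_polyC; ring.
  move/eqP; rewrite mulf_eq0 (negPf G0) orbF => /eqP e2.
  have a0 : a 0 0 = 0.
    have := congr1 (fun q : {poly F} => q`_0) e2.
    by rewrite coefB coefN coefC coefZ coefX /= mulr0 subr0 coef0 => /eqP; rewrite oppr_eq0 => /eqP.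
  have b0 : b 0 0 = 0.
    have := congr1 (fun q : {poly F} => q`_1) e2.
    by rewrite coefB coefN coefC coefZ coefX /= mulr1 oppr0 sub0r coef0 => /eqP; rewrite oppr_eq0 => /eqP.
  by rewrite (mx11_scalar a) (mx11_scalar b) a0 b0 !raddf0 row_mx0.
have := mulmx0_rank_max KS; rewrite (eqP (Kfree : \rank K == 2)).
by rewrite addnC.
Qed.

Section DoubleRoot.
Variables (r : Zp) (phi : Zp).
Hypothesis f_root : f.[r] = p%:R * phi.
Hypothesis gcd_r : gcdp (red f) (red f)^`() %= 'X - (residue r)%:P.

(* A unimodular column operation turns the first column of the Sylvester matrix
   into the values at [r] of the multiples of [f] and [f^`()], all divisible by
   [p]; once [p] is extracted, the matrix is invertible modulo [p] exactly when
   [residue phi != 0]. *)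
Lemma disc_double_root : has_valuation (disc f) 1 <-> residue phi != 0.
Proof.
have d1 : pdvd 1 (\det S).
  apply/residue_eq0/eqP; rewrite -det_map_mx map_band band_det0P unlock coprimep_def.
  by rewrite (eqp_size gcd_r) size_XsubC.
have [G GE] : exists G, red f = G * ('X - (residue r)%:P).
  by apply/dvdpP; rewrite -(eqp_dvdl _ gcd_r) dvdp_gcdl.
have [k kE] : exists k, (red f)^`() = k * ('X - (residue r)%:P).
  by apply/dvdpP; rewrite -(eqp_dvdl _ gcd_r) dvdp_gcdr.
have X0 : 'X - (residue r)%:P != 0 by rewrite polyXsubC_eq0.
have copGk : coprimep G k.
  rewrite coprimep_def size_poly_eq1 -(eqp_mul2l _ _ X0) mulr1.
  apply: eqp_trans (mulp_gcdr _ _ _) _; rewrite ![_ * G]mulrC ![_ * k]mulrC -GE -kE.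
  exact: gcd_r.
set rho := residue r in GE kE X0 *.
have rG : root G rho.
  have : 'X - rho%:P %| G; last by rewrite dvdp_XsubCl.
  apply/dvdpP; exists (k - G^`()); rewrite mulrBl -kE GE derivM derivXsubC mulr1.
  by rewrite addrC addKr.
have rk : k.[rho] != 0.
  apply: contraTneq copGk => rk; apply/negP => /(coprimep_root); move=> /(_ rho rG).
  by rewrite rk eqxx.
have sG : size G = n.+1.
  have := size_redf; rewrite GE size_Mmonic ?monicXsubC ?size_XsubC ?addn2 //.
    by case.
  by apply: contraNneq redf_neq0 => G0; rewrite GE G0 mul0r.
have G0 : G != 0 by rewrite -size_poly_gt0 sG.
have sk : (size k <= n)%N.
  have [->|k0] := eqVneq k 0; first by rewrite size_poly0.
  by have := size_redf'; rewrite kE size_Mmonic ?monicXsubC ?size_XsubC ?addn2.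
have [phi' f'_root] : exists phi', f^`().[r] = p%:R * phi'.
  have /residue_eq0 [y yE] : residue f^`().[r] = 0.
    by rewrite -horner_map /= -deriv_map kE hornerM hornerXsubC subrr mulr0.
  by exists y; rewrite yE expr1.
pose C : 'M[Zp]_(n + n.+1) := \matrix_(i, j) (if (j : nat) == 0%N then r ^+ i else (i == j)%:R).
have detC : \det C = 1.
  rewrite det_trig; last first.
    apply/is_trig_mxP => i j ij; rewrite mxE gtn_eqF ?(leq_ltn_trans _ ij) //.
    by rewrite -val_eqE /= ltn_eqF.
  rewrite big1 // => i _; rewrite mxE eqxx; case: eqP => // ->; rewrite expr0 //.
pose col0 (i : 'I_(n + n.+1)) : Zp := match fintype.split i with
  | inl l => r ^+ l * phi | inr l => r ^+ l * phi' end.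
pose M := \matrix_(i < n + n.+1, j < n + n.+1) (if (j : nat) == 0%N then col0 i else S i j).
pose d := \row_(j < n + n.+1) (if (j : nat) == 0%N then p%:R else 1 : Zp).
have SC : S *m C = M *m diag_mx d.
  apply/matrixP => i j; rewrite mul_mx_diag !mxE; case: (altP eqP) => j0; last first.
    rewrite mulr1 (bigD1 j) //= big1 => [|l lj]; last by rewrite [C _ _]mxE (negPf j0) (negPf lj) mulr0.
    by rewrite [C _ _]mxE (negPf j0) eqxx mulr1 addr0 mxE.
  rewrite (_ : \sum_l _ = (match fintype.split i with
     | inl l => 'X^l * f | inr l => 'X^l * f^`() end).[r]).
    rewrite /col0; case: (fintype.split i) => l; rewrite hornerM hornerXn ?f_root ?f'_root; ring.
  rewrite (@horner_coef_wide _ (n + n.+1)).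
    apply: eq_bigr => l _; rewrite !mxE j0 eqxx; congr (_ * _).
    by case: fintype.split.
  case: (fintype.split i) => l; rewrite size_monicM ?monicXn ?size_polyXn ?f_size ?size_derivf
    -?size_poly_eq0 ?f_size ?size_derivf //.
    by rewrite addSn /= -addSnnS leq_add2r ltn_ord.
  by rewrite addSn /= leq_add2r -ltnS ltn_ord.
have dS : \det S = p%:R * \det M.
  have := congr1 determinant SC; rewrite !det_mulmx detC mulr1 => ->.
  rewrite det_diag mulrC; congr (_ * _).
  have lt0 : (0 < n + n.+1)%N by rewrite addnS.
  rewrite (bigD1 (Ordinal lt0)) //= mxE /= big1 ?mulr1 // => j.
  by rewrite -val_eqE mxE /= => /negPf->.
have p0 := pp_neq0 p_pr.
have -> : has_valuation (disc f) 1 <-> residue (\det M) != 0.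
  split=> [[_ nd2]|nz].
    apply/eqP => /residue_eq0 [y yE]; apply: nd2; apply/pdvd_disc; exists y.
    by rewrite dS yE expr1 expr2 mulrA.
  split; first exact/pdvd_disc.
  move=> /pdvd_disc [y]; rewrite dS expr2 -mulrA => /(mulfI p0) yE.
  by case/eqP: nz; apply/residue_eq0; exists y; rewrite yE expr1.
rewrite -det_map_mx.
have col0E (w : 'rV[F]_(n + n.+1)) (j : 'I_(n + n.+1)) : (j : nat) = 0%N -> (w *m map_mx res M) 0 j =
    (rVpoly (lsubmx w)).[rho] * residue phi + (rVpoly (rsubmx w)).[rho] * residue phi'.
  move=> j0; rewrite mxE big_split_ord !(horner_coef_wide _ (size_rVpoly _)) !mulr_suml.
  congr (_ + _); apply: eq_bigr => l _; rewrite !mxE j0 /= /col0 ?(unsplitK (inl l)) ?(unsplitK (inr l));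
    by rewrite rmorphM rmorphXn /= coef_rVpoly_ord mxE mulrA.
have colE (w : 'rV[F]_(n + n.+1)) (j : 'I_(n + n.+1)) : (j : nat) != 0%N -> (w *m map_mx res M) 0 j = (w *m Sb) 0 j.
  move=> j0; rewrite !mxE; apply: eq_bigr => i _; rewrite -map_band !mxE (negPf j0) //.
have lt0 : (0 < n + n.+1)%N by rewrite addnS.
have -> : (\det (map_mx res M) != 0) = (residue phi != 0); last by [].
congr (~~ _); apply/det0P/eqP => [[w w0 wM]|phi0]; last first.
  exists (kernel_row k (- G)).
    apply/eqP => /(congr1 rsubmx); rewrite row_mxKr linear0 => /(congr1 rVpoly).
    by rewrite poly_rV_K ?size_polyN ?sG // linear0 => /eqP; rewrite oppr_eq0 (negPf G0).
  apply/rowP => j; rewrite [RHS]mxE; have [j0|j0] := altP ((j : nat) =P 0%N).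
    rewrite col0E // phi0 mulr0 add0r row_mxKr poly_rV_K ?size_polyN ?sG //.
    by rewrite hornerN (rootP rG) oppr0 mul0r.
  rewrite colE // kernel_rowP ?mxE ?size_polyN ?sG //.
  by rewrite kE GE; ring.
set U := rVpoly (lsubmx w); set V := rVpoly (rsubmx w).
(* Outside column 0 the matrix agrees with the Sylvester matrix, so a kernel vector makes this
   combination constant; its value at [rho] is 0. *)
have UV0 : U * red f + V * (red f)^`() = 0.
  have sc : (size (U * red f + V * (red f)^`())%R <= 1)%N.
    apply/leq_sizeP => j j1; have [lt|ge] := ltnP j (n + n.+1); last first.
      rewrite nth_default // (leq_trans _ ge) //.
      by apply: size_combination; rewrite ?addnS ?size_redf ?size_redf'.
    have := congr1 (fun z : 'rV[F]_(n + n.+1) => z 0 (Ordinal lt)) wM.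
    by rewrite colE /= -1?lt0n // mul_band mxE.
  have [c cE] : exists c, U * red f + V * (red f)^`() = c%:P by exists (U * red f + V * (red f)^`())`_0; apply: size1_polyC.
  have := congr1 (fun q : {poly F} => q.[rho]) cE.
  rewrite /= hornerC hornerD !hornerM kE GE !hornerM hornerXsubC subrr !mulr0 addr0 => c0.
  by rewrite -kE -GE cE -c0.
have UG : U * G = - (V * k).
  apply/eqP; rewrite -subr_eq0 opprK; apply/eqP/(mulIf X0); rewrite mul0r -UV0 kE [in RHS]GE; ring.
have [c VE] : exists c, V = c * G.
  apply/dvdpP; rewrite -(Gauss_dvdpl _ copGk) -[V * k]opprK -UG dvdpNr dvdp_mulIr //.
have [c0 cE] : exists c0, c = c0%:P.
  exists c`_0; apply: size1_polyC; have [->|cn0] := eqVneq c 0; first by rewrite size_poly0.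
  have := size_rVpoly (rsubmx w); rewrite -/V VE size_mul // sG addnS /= addnC.
  by rewrite -[X in (_ <= X)%N]addn1 leq_add2l.
have UE : U = - (c0%:P * k).
  by apply: (mulIf G0); rewrite UG VE cE; ring.
(* Now column 0: G vanishes at [rho], so [phi'] drops out, leaving - c0 k(rho) phi = 0 modulo p with
   k(rho) nonzero. *)
have := congr1 (fun z : 'rV[F]_(n + n.+1) => z 0 (Ordinal lt0)) wM.
rewrite col0E // mxE -/U -/V UE VE cE !hornerM hornerN hornerM hornerC (rootP rG) mulr0 mul0r addr0.
move/eqP; rewrite mulNr oppr_eq0 mulf_eq0 mulf_eq0 (negPf rk) orbF => /orP[/eqP c00|/eqP//].
case/eqP: w0; rewrite -[w]hsubmxK -[lsubmx w]rVpolyK -[rsubmx w]rVpolyK -/U -/V UE VE cE c00.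
by rewrite !mul0r oppr0 !linear0 row_mx0.
Qed.

End DoubleRoot.
End Discriminant.

(** * Haar measure of cosets of p^2 *)

Section PadicTopology.
Variables (p : nat) (p_pr : prime p).
Local Notation Zp := (padic p_pr).
Local Notation F := 'F_p.
Local Notation res := (@residue p p_pr).
Local Notation pp := (p%:R : Zp).
Local Open Scope classical_set_scope.

Lemma nbhs_padic (x : Zp) (A : set Zp) : nbhs x A ->
  exists k, [set y : Zp | y k = x k] `<=` A.
Proof.
rewrite nbhsE => -[U [[D _ UE] Ux] UA].
move: Ux; rewrite -UE => -[[c k] Dk]; rewrite /padic_ball /= => ck; exists k => y /= yx.
by apply: UA; rewrite -UE; exists (c, k) => //; apply: etrans yx ck.
Qed.

Lemma padic_ball_nbhs (x : Zp) k : nbhs x [set y : Zp | y k = x k].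
Proof.
rewrite nbhsE; exists [set y : Zp | y k = x k]; last by [].
split=> //; exists [set (x, k)] => //=.
by rewrite bigcup_set1.
Qed.

(** Each coordinate modulo p^k takes finitely many values, so an ultrafilter selects one; the
    selected residues are coherent and define its limit. *)
Lemma compact_padic_rV d : compact [set: 'rV[Zp]_d].
Proof.
rewrite compact_ultra => U UU _.
have pU : ProperFilter U by apply: ultra_proper.
have key (jk : 'I_d * nat) : exists a : int, U [set y : 'rV[Zp]_d | y 0 jk.1 jk.2 = a].
  case: jk => j k; apply: contrapT => /forallNP nU; apply: (@filter_not_empty _ U).
  have : \forall y \near U, forall a : 'I_(p ^ k), ~ ((y : 'rV[Zp]_d) 0 j k = (a : nat)%:Z).
    apply: filter_forall => a; have [Ua|//] := in_ultra_setVsetC [set y : 'rV[Zp]_d | y 0 j k = (a : nat)%:Z] UU.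
    by case: (nU a).
  apply: filterS => y /= yk.
  have := padic_mod (y 0 j) k; have := modz_ge0 (y 0 j k) (P_neq0 p_pr k).
  have := ltz_pmod (y 0 j k) (P_gt0 p_pr k) => /[swap] _ /[swap] ->; move: (modz_ge0 (y 0 j k) (P_neq0 p_pr k)); rewrite padic_mod.
  case E : (y 0 j k) => [m|//] _ lt; rewrite ltz_nat in lt.
  exact: (yk (Ordinal lt)).
have [a aU] := choice key.
have coh j k : a (j, k) = (a (j, k.+1) %% (p ^ k)%N%:Z)%Z.
  have [y [/= y1 y2]] := filter_ex (filterI (aU (j, k)) (aU (j, k.+1))).
  by rewrite -y1 -y2 padic_coherent.
exists (\row_j Padic p_pr (coh j)); split=> // A [Q Qn QA].
have kk (j : 'I_d) : exists k, [set y : Zp | y k = a (j, k)] `<=` Q 0 j.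
  by have := Qn 0 j; rewrite mxE => /nbhs_padic.
have [k kQ] := choice kk.
have : \forall y \near U, forall j, (y : 'rV[Zp]_d) 0 j (k j) = a (j, k j).
  by apply: filter_forall => j; apply: (aU (j, k j)).
apply: filterS => y yP; apply: QA => i j; rewrite ord1; apply: kQ; exact: yP.
Qed.

Lemma open_padic_rV d (A : set 'rV[Zp]_d) k :
  (forall x y : 'rV[Zp]_d, (forall j, y 0 j k = x 0 j k) -> A x -> A y) -> open A.
Proof.
move=> H; rewrite openE => x Ax.
exists (fun i j => [set y : Zp | y k = x i j k]) => [i j|y yP]; first exact: padic_ball_nbhs.
by apply: H Ax => j; apply: yP.
Qed.

Section Cells.
Variable d : nat.
Local Notation lift := (map_mx (@teich p p_pr)).

Definition lift2 (c : 'rV[F]_d * 'rV[F]_d) : 'rV[Zp]_d := lift c.1 + pp *: lift c.2.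

(* The cosets of p^2 Z_p^d. *)
Definition cell c : set 'rV[Zp]_d := [set lift2 c + pp ^+ 2 *: t | t in setT].

Lemma cell_cover x : exists c, cell c x.
Proof.
have H (j : 'I_d) : exists y : F * F * Zp, x 0 j = teich p_pr y.1.1 + pp * teich p_pr y.1.2 + pp ^+ 2 * y.2.
  have [y yE] : pdvd 1 (x 0 j - teich p_pr (res (x 0 j))).
    by apply/residue_eq0; rewrite rmorphB /= teichK subrr.
  have [z zE] : pdvd 1 (y - teich p_pr (res y)).
    by apply/residue_eq0; rewrite rmorphB /= teichK subrr.
  exists ((res (x 0 j), res y), z) => /=.
  rewrite -[LHS](subrK (teich p_pr (res (x 0 j)))) yE -[y in LHS](subrK (teich p_pr (res y))) zE.
  ring.
have [h hE] := choice H.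
exists (\row_j (h j).1.1, \row_j (h j).1.2), (\row_j (h j).2) => //.
by apply/rowP => j; rewrite !mxE -hE.
Qed.

Lemma lift2_inj c c' (t t' : 'rV[Zp]_d) :
  lift2 c + pp ^+ 2 *: t = lift2 c' + pp ^+ 2 *: t' -> c = c'.
Proof.
case: c c' => [v w] [v' w'] /rowP e.
have pz (z : Zp) : res (pp * z) = 0 by apply/residue_eq0; exists z; rewrite expr1.
have vv : v = v'.
  apply/rowP => j; have := congr1 res (e j); rewrite !mxE /=.
  by rewrite !rmorphD /= !expr2 -!mulrA !pz !addr0 !teichK.
congr pair => //; apply/rowP => j; have := e j; rewrite !mxE /= vv.
rewrite -!addrA => /addrI; rewrite !expr2 -!mulrA -!mulrDr => /(mulfI (pp_neq0 p_pr)).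
by move/(congr1 res); rewrite !rmorphD /= !pz !addr0 !teichK.
Qed.

Lemma open_cell c : open (cell c).
Proof.
apply: (@open_padic_rV _ _ 2) => x y xy [t _ xE].
have H (j : 'I_d) : exists s : Zp, y 0 j = x 0 j + pp ^+ 2 * s.
  have [s sE] : pdvd 2 (y 0 j - x 0 j).
    by apply/pdvdP; rewrite padicD padicN modzDmr xy subrr mod0z.
  by exists s; rewrite -sE addrCA subrr addr0.
have [s sE] := choice H.
exists (t + \row_j s j) => //; apply/rowP => j.
by rewrite sE -xE !mxE mulrDr addrA.
Qed.

Variable (R : realType) (mu : {measure set (Zp_borel p_pr d) -> \bar R}).
Hypothesis mu_haar : is_haar mu.

Lemma measurable_open (A : set 'rV[Zp]_d) : open A -> measurable (A : set (Zp_borel p_pr d)).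
Proof. by move=> oA; apply: sub_sigma_algebra. Qed.

Lemma haar_cell c : mu (cell c) = mu (cell 0).
Proof.
have [inv _ _] := mu_haar.
rewrite -(inv (lift2 c) (cell 0) (measurable_open (@open_cell _))); congr (mu _).
have teich0 : teich p_pr 0 = 0 by [].
have l0 : lift2 0 = 0.
  by apply/rowP => j; rewrite !mxE teich0 mulr0 addr0.
apply/seteqP; split=> x.
  by move=> [t _ <-]; exists (pp ^+ 2 *: t) => //; exists t; rewrite ?l0 ?add0r.
by move=> [a [t _ <-] <-]; exists t; rewrite ?l0 ?add0r.
Qed.


Lemma haar_cell_fin_num c : mu (cell c) \is a fin_num.
Proof.
have [_ fin _] := mu_haar.
rewrite ge0_fin_numE //; apply: le_lt_trans (fin _ (@compact_padic_rV d)).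
apply: le_measure; rewrite ?inE //; apply: measurable_open; exact: open_cell.
Qed.

Lemma haar_cell_gt0 c : 0 < fine (mu (cell c)).
Proof.
have [_ _ pos] := mu_haar.
rewrite fine_gt0 // (pos _ (@open_cell _)) /=; last by exists (lift2 c), 0; rewrite ?scaler0 ?addr0.
by have := haar_cell_fin_num c; rewrite ge0_fin_numE.
Qed.

Lemma haar_bigcup_cell (B : {set 'rV[F]_d * 'rV[F]_d}) :
  mu (\bigcup_(c in [set` B]) cell c) = (fine (mu (cell 0)) *+ #|B|)%:E.
Proof.
rewrite measure_fin_bigcup //.
- rewrite (eq_fsbigr (fun _ => (fine (mu (cell 0)))%:E)) => [|c _]; last first.
    by rewrite (fineK (haar_cell_fin_num 0)); apply: haar_cell.
  rewrite (_ : [set` B] = [set` enum B]) -?fsbig_seq ?enum_uniq //; last first.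
    by apply/seteqP; split=> x /=; rewrite mem_enum.
  by rewrite sumEFin -sumr_const big_enum.
- by move=> c c' _ _ [x [[t _ <-] [t' _ /lift2_inj]]].
- by move=> c _; apply: measurable_open; apply: open_cell.
Qed.

(** A set determined by the first two digits is a finite disjoint union of cells, all of the same
    positive finite mass. *)
Lemma haar_ratio (S : set 'rV[Zp]_d) (B : pred ('rV[F]_d * 'rV[F]_d)) :
  (forall c t, S (lift2 c + pp ^+ 2 *: t) <-> B c) ->
  fine (mu S) / fine (mu setT) = #|B|%:R / p%:R ^+ (d + d).
Proof.
move=> SB.
have cells (A : set 'rV[Zp]_d) (D : pred ('rV[F]_d * 'rV[F]_d)) :
    (forall c t, A (lift2 c + pp ^+ 2 *: t) <-> D c) -> fine (mu A) = fine (mu (cell 0)) *+ #|D|.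
  move=> AD; rewrite (_ : A = \bigcup_(c in [set` [set c | D c]%SET]) cell c).
    by rewrite haar_bigcup_cell /= cardsE.
  apply/seteqP; split=> [x Ax|x [c /= + [t _ <-]]]; last by rewrite inE => /AD.
  have [c [t _ tx]] := cell_cover x; exists c; last by exists t.
  by rewrite /= inE; apply/(AD c t); rewrite tx.
rewrite (cells _ _ SB) (cells setT predT) // -[_ *+ #|B|]mulr_natr -[_ *+ #|predT|]mulr_natr.
rewrite invfM mulrACA mulfV ?mul1r ?gt_eqF ?haar_cell_gt0 //.
by rewrite card_prod !card_mx card_Fp // mul1n -expnD natrX.
Qed.

End Cells.
End PadicTopology.

(** * Local densities *)

Section CoprimeCount.
Variables (p : nat) (p_pr : prime p).
Local Notation F := 'F_p.

Lemma rVpoly_sum (R : nzRingType) m (z : 'rV[R]_m) : rVpoly z = \sum_i z 0 i *: 'X^i.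
Proof. by rewrite [LHS]poly_def; apply: eq_bigr => i _; rewrite valK. Qed.

Lemma rVpoly_row_mx (R : comNzRingType) m e (z : 'rV[R]_m) (u : 'rV[R]_e) :
  rVpoly (row_mx z u) = rVpoly z + 'X^m * rVpoly u.
Proof.
rewrite !rVpoly_sum big_split_ord mulr_sumr.
congr (_ + _); apply: eq_bigr => i _; rewrite ?row_mxEl ?row_mxEr //.
by rewrite exprD -scalerAr.
Qed.

(** The polynomials h + z with z of degree below m = deg D run once through the residues modulo D,
    as do the monic polynomials of degree m. *)
Lemma count_coprimep_shift (D h : {poly F}) m : D \in monics F m ->
  #|[pred z : 'rV[F]_m | coprimep (h + rVpoly z) D]| = euler_phi D.
Proof.
move=> Dm; have D0 := monic_neq0 (monics_monic Dm).
pose s : 'rV[F]_m := poly_rV ((h - 'X^m) %% D).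
have sE : rVpoly s = (h - 'X^m) %% D.
  by rewrite poly_rV_K // -ltnS -(monics_size Dm) ltn_modp.
have cop z : coprimep (h + rVpoly z) D = coprimep ('X^m + rVpoly (s + z)) D.
  have -> : h + rVpoly z = ('X^m + rVpoly (s + z)) + ((h - 'X^m) %/ D) * D.
    rewrite linearD /= sE.
    move: (divp_eq (h - 'X^m) D); set q := _ %/ _; set t := _ %% _ => /eqP.
    by rewrite subr_eq => /eqP ->; ring.
  by rewrite coprimep_sym [in RHS]coprimep_sym addrC coprimep_addl_mul.
rewrite /euler_phi (monics_size Dm) -sum1_card -sum1_count big_mkcond [RHS]big_mkcond.
rewrite (big_monics (F := F) m (fun e => if coprimep e D then 1%N else 0%N)).
rewrite [RHS](reindex_inj (addrI s)) /=; apply: eq_bigr => z _.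
by rewrite inE cop.
Qed.

Lemma count_coprimep (D h : {poly F}) m d : D \in monics F m -> (m <= d)%N ->
  #|[pred z : 'rV[F]_d | coprimep (h + rVpoly z) D]| = (p ^ (d - m) * euler_phi D)%N.
Proof.
move=> Dm md; have [e ->] : exists e, d = (m + e)%N by exists (d - m)%N; rewrite subnKC.
rewrite addKn -sum1_card big_mkcond /=.
rewrite (reindex (fun zu : 'rV[F]_m * 'rV[F]_e => row_mx zu.1 zu.2)) /=; last first.
  exists (fun z => (lsubmx z, rsubmx z)) => [[z u] _|z _] /=; first by rewrite row_mxKl row_mxKr.
  by rewrite hsubmxK.
rewrite -(pair_big predT predT (fun z u => if row_mx z u \in _ then 1 else 0)%N) /= exchange_big /=.
rewrite (eq_bigr (fun _ => euler_phi D)) => [|u _]; last first.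
  rewrite -(count_coprimep_shift (h + 'X^m * rVpoly u) Dm) -sum1_card [RHS]big_mkcond /=.
  by apply: eq_bigr => z _; rewrite !inE rVpoly_row_mx addrA addrAC.
by rewrite sum_nat_const card_mx card_Fp // mul1n mulnC.
Qed.

Lemma card_Fp_rV d : #|'rV[F]_d| = (p ^ d)%N.
Proof. by rewrite card_mx card_Fp // mul1n. Qed.

(** The constant coefficient of [z] is free since d > 0, so c + z(r) is equidistributed in F_p. *)
Lemma count_horner d (c r : F) : (0 < d)%N ->
  (p * #|[pred z : 'rV[F]_d | c + (rVpoly z).[r] != 0%R]%R| = (p - 1) * p ^ d)%N.
Proof.
case: d => // d _; pose N a := #|[pred z : 'rV[F]_d.+1 | c + (rVpoly z).[r] == a]|.
have NE a : N a = N 0.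
  rewrite /N -!sum1_card big_mkcond [RHS]big_mkcond.
  rewrite (reindex_inj (addIr (a *: delta_mx 0 0))) /=; apply: eq_bigr => z _.
  rewrite !inE linearD linearZ /= rVpoly_delta hornerD hornerZ hornerXn expr0 mulr1 addrA.
  by rewrite -subr_eq0 addrK.
have tot : (\sum_a N a = p ^ d.+1)%N.
  under eq_bigr do rewrite /N -sum1_card big_mkcond /=.
  rewrite exchange_big /= -card_Fp_rV.
  rewrite -sum1_card; apply: eq_bigr => z _.
  rewrite (bigD1 (c + (rVpoly z).[r])) //= inE eqxx big1 ?addn0 // => a /negPf az.
  by rewrite inE eq_sym az.
have N0 : (p * N 0%R = p ^ d.+1)%N.
  by rewrite -tot (eq_bigr (fun _ => N 0)) // sum_nat_const card_Fp.
have : (N 0%R + #|[pred z : 'rV[F]_d.+1 | c + (rVpoly z).[r] != 0]%R| = p ^ d.+1)%N.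
  have := cardC (fun z : 'rV[F]_d.+1 => c + (rVpoly z).[r] == 0).
  by rewrite card_Fp_rV.
move/(congr1 (muln p)); rewrite mulnDr N0 mulnBl mul1n => /eqP; lia.
Qed.

End CoprimeCount.

Section LocalDensity.
Variables (R : realType) (p : nat) (p_pr : prime p).
Local Notation Zp := (padic p_pr).
Local Notation F := 'F_p.
Local Notation red := (map_poly (@residue p p_pr)).
Local Notation pp := (p%:R : Zp).
Local Notation lift := (map_mx (@teich p p_pr)).
Local Open Scope classical_set_scope.

Variables (n d : nat) (T : {poly Zp}).
Hypotheses (T_monic : T \is monic) (T_size : size T = n.+1) (d_le : (d <= n)%N).
Hypothesis T_low : forall i, (i < d)%N -> T`_i = 0.

Definition top_family : set {poly Zp} := [set T + rVpoly u | u in [set: 'rV[Zp]_d]].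

Variable mu : {measure set (Zp_borel p_pr d) -> \bar R}.
Hypothesis mu_haar : is_haar mu.

Lemma poly_rV_family (u : 'rV[Zp]_d) : poly_rV (T + rVpoly u) = u.
Proof. by apply/rowP => i; rewrite mxE coefD T_low // add0r coef_rVpoly_ord. Qed.

Lemma density_family (S : set {poly Zp}) :
  density mu top_family S = fine (mu [set u | S (T + rVpoly u)]) / fine (mu setT).
Proof.
rewrite /density; congr (fine (mu _) / fine (mu _)); apply/seteqP; split=> // u.
- by move=> [f [[w _ <-] Sf] <-]; rewrite /= poly_rV_family.
- by move=> Su; exists (T + rVpoly u); rewrite ?poly_rV_family //; split=> //; exists u.
- by move=> _; exists (T + rVpoly u); rewrite ?poly_rV_family //; exists u.
Qed.

(** [A] is the proportion of second digits [w] satisfying the condition above a given reduction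
    [v]. *)
Lemma density_local (S : set {poly Zp}) (A : {poly F} -> R) :
  (forall v, exists C : pred 'rV[F]_d,
     (forall w t, S (T + rVpoly (lift2 p_pr (v, w) + pp ^+ 2 *: t)) <-> C w) /\
     #|C|%:R = p%:R ^+ d * A (red T + rVpoly v)) ->
  density mu top_family S = (\sum_(v : 'rV[F]_d) A (red T + rVpoly v)) / p%:R ^+ d.
Proof.
move=> H; have [C CP] := choice H.
rewrite density_family (haar_ratio mu_haar (B := fun c => C c.1 c.2)); last first.
  by move=> [v w] t; exact: (CP v).1.
have p0 : (p%:R : R) != 0 by rewrite pnatr_eq0 -lt0n prime_gt0.
suff -> : #|[pred c | C c.1 c.2]|%:R = p%:R ^+ d * \sum_(v : 'rV[F]_d) A (red T + rVpoly v).
  by rewrite exprD; field; rewrite expf_neq0.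
rewrite -sum1_card big_mkcond /=.
rewrite -(pair_big predT predT (fun v w => if (v, w) \in [pred c | C c.1 c.2] then 1 else 0)%N) /=.
rewrite natr_sum mulr_sumr; apply: eq_bigr => v _.
rewrite -(CP v).2 -sum1_card [in RHS]big_mkcond /=; congr _%:R.
Qed.

Lemma family_monic (u : 'rV[Zp]_d) : T + rVpoly u \is monic.
Proof.
have lt : (size (rVpoly u) < size T)%N by rewrite T_size ltnS (leq_trans (size_rVpoly u)).
by rewrite monicE lead_coefDl // -monicE.
Qed.

Lemma family_size (u : 'rV[Zp]_d) : size (T + rVpoly u) = n.+1.
Proof.
have lt : (size (rVpoly u) < size T)%N by rewrite T_size ltnS (leq_trans (size_rVpoly u)).
by rewrite size_polyDl.
Qed.

Lemma rVpoly_lift2 (v w : 'rV[F]_d) (t : 'rV[Zp]_d) :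
  rVpoly (lift2 p_pr (v, w) + pp ^+ 2 *: t) =
  rVpoly (lift v) + p%:R * (rVpoly (lift w) + p%:R * rVpoly t).
Proof.
have pC : (p%:R : {poly Zp}) = pp%:P by rewrite polyC_natr.
by rewrite /lift2 !linearD !linearZ /= -!mul_polyC pC rmorphXn /=; ring.
Qed.

Lemma red_lift (v : 'rV[F]_d) : red (rVpoly (lift v)) = rVpoly v.
Proof.
rewrite map_rVpoly; congr rVpoly; apply/rowP => i; rewrite !mxE; exact: teichK.
Qed.

Lemma red_family (v w : 'rV[F]_d) (t : 'rV[Zp]_d) :
  red (T + rVpoly (lift2 p_pr (v, w) + pp ^+ 2 *: t)) = red T + rVpoly v.
Proof. by rewrite rVpoly_lift2 !rmorphD rmorphM /= red_pp mul0r addr0 red_lift. Qed.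

Lemma P0sqf_family : (0 < n)%N -> P0sqf mu top_family =
  (\sum_(v : 'rV[F]_d) (separable_poly (red T + rVpoly v))%:R) / p%:R ^+ d.
Proof.
move=> n0; apply: density_local (fun f => (separable_poly f)%:R) _ => v.
exists (fun _ => separable_poly (red T + rVpoly v)); split=> [w t|].
  rewrite -(red_family v w t) /=; apply: (disc_unit (n := n.-1)); first exact: family_monic.
  by rewrite family_size prednK.
case: separable_poly; last by rewrite mulr0 eq_card0.
by rewrite mulr1 -natrX -card_Fp_rV //; congr _%:R; apply: eq_card.
Qed.

Lemma red_T_monic (v : 'rV[F]_d) : red T + rVpoly v \is monic /\ size (red T + rVpoly v) = n.+1.
Proof.
rewrite -(red_family v 0 0) (size_red (family_monic _)) family_size; split=> //.
exact/red_monic/family_monic.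
Qed.

Lemma P1sqf_family : (0 < n)%N -> (0 < d)%N -> P1sqf mu top_family =
  (\sum_(v : 'rV[F]_d) (1 - 1 / p%:R) * (has_simple_double_root (red T + rVpoly v))%:R)
    / p%:R ^+ d.
Proof.
move=> n0 d0.
apply: density_local (fun f => (1 - 1 / p%:R) * (has_simple_double_root f)%:R) _ => v.
have p0 : (p%:R : R) != 0 by rewrite pnatr_eq0 -lt0n prime_gt0.
have [fm fs] := red_T_monic v.
have fsz (u : 'rV[Zp]_d) : size (T + rVpoly u) = n.-1.+2 by rewrite family_size prednK.
have [H|H] := boolP (has_simple_double_root _); last first.
  exists (fun _ => false); split=> [w t|]; last by rewrite mulr0 mulr0 eq_card0.
  split=> // /(disc_valuation1 (family_monic _) (fsz _)).
  by rewrite red_family (negPf H).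
have [po [r [g [fE sg rg]]]] := simple_double_rootP p_pr fm H.
have [phi phiE] : exists phi, (T + rVpoly (lift v)).[teich p_pr r] = pp * phi.
  have /residue_eq0 [y yE] : residue (T + rVpoly (lift v)).[teich p_pr r] = 0.
    by rewrite -horner_map /= teichK rmorphD /= red_lift fE hornerM horner_exp hornerXsubC
      subrr expr0n mul0r.
  by exists y; rewrite yE expr1.
(* The second digit shifts f(r) / p modulo p by w(r), so the criterion of [disc_double_root] fails
   for one value out of p. *)
exists (fun w => residue phi + (rVpoly w).[r] != 0); split=> [w t|]; last first.
  rewrite mulr1; apply: (mulfI p0); rewrite -natrM count_horner // natrM natrB ?prime_gt0 //.
  by rewrite natrX; field.
have froot : (T + rVpoly (lift2 p_pr (v, w) + pp ^+ 2 *: t)).[teich p_pr r] =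
    pp * (phi + ((rVpoly (lift w)).[teich p_pr r] + pp * (rVpoly t).[teich p_pr r])).
  rewrite rVpoly_lift2 addrA hornerD phiE !hornerM hornerD !hornerM -polyC_natr hornerC.
  by rewrite -mulrDr.
have gcd_r : gcdp (red (T + rVpoly (lift2 p_pr (v, w) + pp ^+ 2 *: t)))
   (red (T + rVpoly (lift2 p_pr (v, w) + pp ^+ 2 *: t)))^`() %= 'X - (residue (teich p_pr r))%:P.
  by rewrite red_family teichK fE gcdp_simple_double_root.
apply: iff_trans (disc_double_root (family_monic _) (fsz _) froot gcd_r) _.
have pz (z : Zp) : residue (pp * z) = 0 by apply/residue_eq0; exists z; rewrite expr1.
by rewrite !rmorphD /= pz addr0 -horner_map /= red_lift teichK.
Qed.

Lemma P1sqf_even : (0 < n)%N -> (0 < d)%N -> ~~ odd p -> P1sqf mu top_family = 0.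
Proof.
move=> n0 d0 po; rewrite P1sqf_family // big1 ?mul0r // => v _.
have [H|_] := boolP (has_simple_double_root _); last by rewrite mulr0.
by have [odd_p] := simple_double_rootP p_pr (red_T_monic v).1 H; rewrite odd_p in po.
Qed.

(** The square part D has degree at most floor(n/2); the bound on [d] lets the second digit reach
    every residue modulo D in Dedekind's criterion. For d = n - 2 it holds once n >= 3. *)
Lemma Pmax_family : (0 < n)%N -> (n./2 <= d)%N -> Pmax mu top_family =
  (\sum_(v : 'rV[F]_d) maximal_weight R (red T + rVpoly v)) / p%:R ^+ d.
Proof.
move=> n0 nd; apply: density_local (@maximal_weight p R) _ => v.
have p0 : (p%:R : R) != 0 by rewrite pnatr_eq0 -lt0n prime_gt0.
have [fm fs] := red_T_monic v.
have [k [D [g [kn Dk gm sg fE]]]] := square_decomposition p_pr (monicsP fm fs).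
have kd : (k <= d)%N by apply: leq_trans nd; rewrite -[k]doubleK half_leq.
have [h hE] : exists h, T + rVpoly (lift v) = liftp p_pr D ^+ 2 * liftp p_pr g + p%:R * h.
  by apply: red_eqP; rewrite rmorphD /= red_lift fE rmorphM rmorphXn /= !liftpK.
exists (fun w => coprimep (red h + rVpoly w) D); split=> [w t|]; last first.
  rewrite (count_coprimep p_pr _ Dk kd) fE (maximal_weightE R kn Dk gm sg).
  by rewrite natrM natrX exprB // ?unitfE //; field; rewrite expf_neq0.
have split_f : T + rVpoly (lift2 p_pr (v, w) + pp ^+ 2 *: t) =
    liftp p_pr D ^+ 2 * liftp p_pr g + p%:R * (h + (rVpoly (lift w) + p%:R * rVpoly t)).
  by rewrite rVpoly_lift2 addrA hE -addrA -mulrDr.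
have := maximal_iff_coprime (family_monic _) _ split_f.
rewrite family_size !liftpK => /(_ n0 sg).
by rewrite !rmorphD rmorphM /= red_pp mul0r addr0 red_lift.
Qed.

End LocalDensity.

(** * Densities as weighted counts *)

Section FixedCoefficients.
Variables (R : nzRingType) (n : nat).
Hypothesis n_gt1 : (1 < n)%N.

Definition top_poly (b1 b2 : R) : {poly R} := 'X^n + b1 *: 'X^(n - 1) + b2 *: 'X^(n - 2).

Lemma coef_top_poly b1 b2 i :
  (top_poly b1 b2)`_i = (i == n)%:R + b1 * (i == n - 1)%N%:R + b2 * (i == n - 2)%N%:R.
Proof. by rewrite !coefD !coefZ !coefXn. Qed.

Lemma top_poly_monic_size b1 b2 : top_poly b1 b2 \is monic /\ size (top_poly b1 b2) = n.+1.
Proof.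
have lt : (size (b1 *: 'X^(n - 1) + b2 *: 'X^(n - 2))%R < size ('X^n : {poly R}))%N.
  rewrite size_polyXn ltnS (leq_trans (size_polyD _ _)) // geq_max.
  by rewrite !(leq_trans (size_scale_leq _ _)) // size_polyXn; lia.
by rewrite /top_poly -addrA monicE lead_coefDl // lead_coefXn size_polyDl // size_polyXn.
Qed.

Lemma add_rVpolyP d (T f : {poly R}) :
  (forall i, (d <= i)%N -> f`_i = T`_i) <-> exists u : 'rV[R]_d, f = T + rVpoly u.
Proof.
split=> [H|[u ->] i di].
  exists (poly_rV (f - T)); rewrite poly_rV_K; first by rewrite addrC subrK.
  by apply/leq_sizeP => i di; rewrite coefB H ?subrr.
by rewrite coefD [(rVpoly u)`_i]nth_default ?addr0 // (leq_trans (size_rVpoly u)).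
Qed.

Lemma add_rVpoly_monic_size d (T : {poly R}) (u : 'rV[R]_d) :
  T \is monic -> size T = n.+1 -> (d <= n)%N ->
  T + rVpoly u \is monic /\ size (T + rVpoly u) = n.+1.
Proof.
move=> Tm Ts dn; have lt : (size (rVpoly u) < size T)%N.
  by rewrite Ts ltnS (leq_trans (size_rVpoly u)).
by rewrite monicE lead_coefDl // -monicE size_polyDl.
Qed.

Lemma fix1P b1 (f : {poly R}) : [/\ f \is monic, size f = n.+1 & f`_(n - 1) = b1] <->
  exists u : 'rV[R]_(n - 1), f = top_poly b1 0 + rVpoly u.
Proof.
have [Tm Ts] := top_poly_monic_size b1 0.
split=> [[fm fs f1]|[u fE]].
  apply/add_rVpolyP => i di; have [->|i1] := eqVneq i (n - 1)%N.
    rewrite f1 coef_top_poly eqxx mulr1 mul0r addr0 (_ : (_ == n) = false) ?add0r //; lia.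
  have [->|i2] := eqVneq i n.
    by move: (monicP fm) (monicP Tm); rewrite /lead_coef fs Ts /= => -> ->.
  by rewrite !nth_default ?fs ?Ts //; lia.
have le : (n - 1 <= n)%N by lia.
have [fm fs] := add_rVpoly_monic_size u Tm Ts le.
rewrite fE; split=> //; rewrite (iffRL (add_rVpolyP (n - 1) (top_poly b1 0) _)) //; last by exists u.
by rewrite coef_top_poly eqxx mulr1 mul0r addr0 (_ : (_ == n) = false) ?add0r //; lia.
Qed.

Lemma fix2P b1 b2 (f : {poly R}) :
  [/\ f \is monic, size f = n.+1, f`_(n - 1) = b1 & f`_(n - 2) = b2] <->
  exists u : 'rV[R]_(n - 2), f = top_poly b1 b2 + rVpoly u.
Proof.
have [Tm Ts] := top_poly_monic_size b1 b2.
have c1 : (top_poly b1 b2)`_(n - 1) = b1.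
  rewrite coef_top_poly eqxx mulr1 (_ : (_ == n) = false) ?add0r; last by lia.
  by rewrite (_ : (_ == n - 2)%N = false) ?mulr0 ?addr0 //; lia.
have c2 : (top_poly b1 b2)`_(n - 2) = b2.
  rewrite coef_top_poly eqxx mulr1 (_ : (_ == n) = false) ?add0r; last by lia.
  by rewrite (_ : (_ == n - 1)%N = false) ?mulr0 ?add0r //; lia.
split=> [[fm fs f1 f2]|[u fE]].
  apply/add_rVpolyP => i di; have [->|i1] := eqVneq i (n - 1)%N; first by rewrite f1 c1.
  have [->|i2] := eqVneq i (n - 2)%N; first by rewrite f2 c2.
  have [->|i3] := eqVneq i n.
    by move: (monicP fm) (monicP Tm); rewrite /lead_coef fs Ts /= => -> ->.
  by rewrite !nth_default ?fs ?Ts //; lia.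
have le : (n - 2 <= n)%N by lia.
have [fm fs] := add_rVpoly_monic_size u Tm Ts le.
have fc := iffRL (add_rVpolyP (n - 2) (top_poly b1 b2) f) (ex_intro _ u fE).
by split; rewrite ?fE // -fE fc //; lia.
Qed.

End FixedCoefficients.

Section CountSums.
Variables (p n : nat) (n_gt1 : (1 < n)%N) (b1 b2 : 'F_p).
Variables (R : nzRingType) (W : {poly 'F_p} -> R).
Local Notation F := 'F_p.

Lemma big_add_rVpoly d (T : {poly F}) (P : pred {poly F}) :
  (forall f, (f \in monics F n) && P f <-> exists u : 'rV[F]_d, f = T + rVpoly u) ->
  \sum_(f <- monics F n | P f) W f = \sum_(v : 'rV[F]_d) W (T + rVpoly v).
Proof.
move=> H; rewrite -big_filter -(big_image _ _ (fun v : 'rV[F]_d => T + rVpoly v) predT W).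
apply: perm_big; apply: uniq_perm; first exact/filter_uniq/monics_uniq.
  by rewrite map_inj_uniq ?enum_uniq // => u v /addrI e; rewrite -(rVpolyK u) e rVpolyK.
move=> f; rewrite mem_filter andbC; apply/idP/mapP => [fP|[u _ fE]].
  by have [u fE] := iffLR (H f) fP; exists u; rewrite ?mem_enum.
by apply: (iffRL (H f)); exists u.
Qed.

Lemma count2E : count2 n b1 b2 W = \sum_(v : 'rV[F]_(n - 2)) W (top_poly n b1 b2 + rVpoly v).
Proof.
apply: big_add_rVpoly => f; rewrite -fix2P // mem_monics.
split=> [/andP[/andP[-> /eqP->] /andP[/eqP-> /eqP->]]//|[-> -> -> ->]].
by rewrite !eqxx.
Qed.

Lemma count1E : count1 n b1 W = \sum_(v : 'rV[F]_(n - 1)) W (top_poly n b1 0 + rVpoly v).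
Proof.
apply: big_add_rVpoly => f; rewrite -fix1P // mem_monics.
split=> [/andP[/andP[-> /eqP->] /eqP->]//|[-> -> ->]].
by rewrite !eqxx.
Qed.

End CountSums.

(** * From complex to real counting identities, through the rationals *)

Section RationalTransfer.
Variables (p n : nat) (b1 b2 : 'F_p).

Lemma ratr_count2 (K : numFieldType) (W : {poly 'F_p} -> rat) :
  ratr (count2 n b1 b2 W) = count2 n b1 b2 (fun f => ratr (W f) : K).
Proof. exact: rmorph_sum. Qed.

Lemma ratr_count1 (K : numFieldType) (W : {poly 'F_p} -> rat) :
  ratr (count1 n b1 W) = count1 n b1 (fun f => ratr (W f) : K).
Proof. exact: rmorph_sum. Qed.

Lemma ratr_maximal_weight (K : numFieldType) (f : {poly 'F_p}) :
  ratr (maximal_weight rat f) = maximal_weight K f.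
Proof.
rewrite rmorph_sum; apply: eq_bigr => k _; rewrite rmorph_sum; apply: eq_bigr => d _.
by rewrite rmorphM fmorphV rmorphXn /= !ratr_nat.
Qed.

(** The weights and the right-hand side are images of rationals, so an identity proved in one
    numeric field holds in every other. *)
Lemma count_transfer (K L : numFieldType) (W : {poly 'F_p} -> rat) (WK : {poly 'F_p} -> K)
    (WL : {poly 'F_p} -> L) (x c1 c2 : rat) :
  (forall f, ratr (W f) = WK f) -> (forall f, ratr (W f) = WL f) ->
  ratr c2 * count2 n b1 b2 WK - ratr c1 * count1 n b1 WK = ratr x ->
  ratr c2 * count2 n b1 b2 WL - ratr c1 * count1 n b1 WL = ratr x.
Proof.
move=> /funext <- /funext <-; rewrite -!ratr_count1 -!ratr_count2 -!rmorphM -!rmorphB.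
by move=> /fmorph_inj ->.
Qed.

End RationalTransfer.

Section Identities.
Variables (p : nat) (p_pr : prime p).
Local Notation F := 'F_p.
Variables (n : nat) (b1 b2 : F).
Hypothesis n_gt2 : (2 < n)%N.
Variable K : numFieldType.
Local Notation leg a := ((legendre (a : F))%:~R : K).

Let char_root : exists w : algC, p.-primitive_root w.
Proof. by have [w] := C_prim_root_exists (prime_gt0 p_pr); exists w. Qed.

Lemma odd_transfer (W : {poly F} -> rat) (WC : {poly F} -> algC) (WK : {poly F} -> K) (x : rat) :
  (forall f, ratr (W f) = WC f) -> (forall f, ratr (W f) = WK f) ->
  p%:R ^+ 2 * count2 n b1 b2 WC - p%:R * count1 n b1 WC = ratr x ->
  p%:R ^+ 2 * count2 n b1 b2 WK - p%:R * count1 n b1 WK = ratr x.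
Proof.
move=> hC hK; have := count_transfer (n := n) (b1 := b1) (b2 := b2) (x := x) (c2 := p%:R ^+ 2) (c1 := p%:R) hC hK.
by rewrite !rmorphXn /= !ratr_nat.
Qed.

Lemma odd_separable : odd p ->
  p%:R ^+ 2 * count2 n b1 b2 (fun f => (separable_poly f)%:R : K)
    - p%:R * count1 n b1 (fun f => (separable_poly f)%:R : K)
  = (-1) ^+ n./2 * leg 2%:R ^+ n./2 * (dual_value n b1 b2 (uphalf n))%:~R.
Proof.
move=> po; have [w w_prim] := char_root.
transitivity (ratr ((-1) ^+ n./2 * (legendre (2%:R : F))%:~R ^+ n./2
    * (dual_value n b1 b2 (uphalf n))%:~R) : K); last first.
  by rewrite !rmorphM !rmorphXn /= rmorphN1 !ratr_int.
apply: (odd_transfer (W := fun f => (separable_poly f)%:R)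
  (WC := fun f => (separable_poly f)%:R)) => [f|f|]; rewrite ?ratr_nat //.
rewrite (count_separable p_pr po w_prim) //.
by rewrite !rmorphM !rmorphXn /= rmorphN1 !ratr_int.
Qed.

Lemma odd_maximal : odd p ->
  p%:R ^+ 2 * count2 n b1 b2 (maximal_weight K) - p%:R * count1 n b1 (maximal_weight K)
  = (-1) ^+ n./2 * leg 2%:R ^+ n./2 * (dual_value n b1 b2 (uphalf n))%:~R / p%:R ^+ n./2.
Proof.
move=> po; have [w w_prim] := char_root.
transitivity (ratr ((-1) ^+ n./2 * (legendre (2%:R : F))%:~R ^+ n./2
    * (dual_value n b1 b2 (uphalf n))%:~R / p%:R ^+ n./2) : K); last first.
  by rewrite !(rmorphM, fmorphV) !rmorphXn /= rmorphN1 !ratr_int ratr_nat.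
apply: (odd_transfer (W := @maximal_weight p rat) (WC := @maximal_weight p algC)) => [f|f|];
  rewrite ?ratr_maximal_weight //.
rewrite (count_maximal p_pr po w_prim) //.
by rewrite !(rmorphM, fmorphV) !rmorphXn /= rmorphN1 !ratr_int ratr_nat.
Qed.

Lemma odd_double_root : odd p ->
  p%:R ^+ 2 * count2 n b1 b2 (fun f => (has_simple_double_root f)%:R : K)
    - p%:R * count1 n b1 (fun f => (has_simple_double_root f)%:R : K)
  = (-1) ^+ n * \sum_(k < n.-1) (-1) ^+ uphalf k * leg 2%:R ^+ k./2 *
      (if (p %| n - k)%N then p%:R * (dual_value n b1 b2 (uphalf k))%:~R
       else leg (n - k)%:R * (dual_value n b1 b2 (uphalf k).+1)%:~R).
Proof.
move=> po; have [w w_prim] := char_root.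
have E (L : numFieldType) : ratr ((-1) ^+ n * \sum_(k < n.-1) (-1) ^+ uphalf k *
     (legendre (2%:R : F))%:~R ^+ k./2 *
      (if (p %| n - k)%N then p%:R * (dual_value n b1 b2 (uphalf k))%:~R
       else (legendre ((n - k)%:R : F))%:~R * (dual_value n b1 b2 (uphalf k).+1)%:~R)) =
   (-1) ^+ n * \sum_(k < n.-1) (-1) ^+ uphalf k * (legendre (2%:R : F))%:~R ^+ k./2 *
      (if (p %| n - k)%N then p%:R * (dual_value n b1 b2 (uphalf k))%:~R
       else (legendre ((n - k)%:R : F))%:~R * (dual_value n b1 b2 (uphalf k).+1)%:~R) :> L.
  rewrite rmorphM rmorphXn /= rmorphN1 rmorph_sum; congr (_ * _); apply: eq_bigr => k _.
  rewrite rmorphM rmorphM !rmorphXn /= rmorphN1 !ratr_int; congr (_ * _).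
  by case: ifP => _; rewrite rmorphM /= ?ratr_nat !ratr_int.
rewrite -E; apply: (odd_transfer (W := fun f => (has_simple_double_root f)%:R)
  (WC := fun f => (has_simple_double_root f)%:R)) => [f|f|]; rewrite ?ratr_nat //.
by rewrite (count_double_root p_pr po w_prim) // E.
Qed.

End Identities.

Section EvenIdentities.
Variables (n : nat) (b1 b2 : 'F_2).
Hypothesis n_gt2 : (2 < n)%N.
Variable K : numFieldType.

Lemma even_transfer (W : {poly 'F_2} -> rat) (WC : {poly 'F_2} -> algC) (WK : {poly 'F_2} -> K) :
  (forall f, ratr (W f) = WC f) -> (forall f, ratr (W f) = WK f) ->
  2%:R * count2 n b1 b2 WC = count1 n b1 WC ->
  2%:R * count2 n b1 b2 WK = count1 n b1 WK.
Proof.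
move=> hC hK e; have := count_transfer (n := n) (b1 := b1) (b2 := b2) (x := 0) (c2 := 2%:R) (c1 := 1) hC hK.
rewrite !ratr_nat !rmorph1 !rmorph0 !mul1r e subrr => /(_ erefl) /eqP.
by rewrite subr_eq0 => /eqP.
Qed.

Lemma even_separable : 2%:R * count2 n b1 b2 (fun f => (separable_poly f)%:R : K)
  = count1 n b1 (fun f => (separable_poly f)%:R).
Proof.
apply: (even_transfer (W := fun f => (separable_poly f)%:R)
  (WC := fun f => (separable_poly f)%:R)) => [f|f|]; rewrite ?ratr_nat //.
apply: count_even => // u u2; rewrite -[RHS](separable_sum_even u2 (ltnW n_gt2)).
rewrite /separable_sum [in RHS]big_mkcond; apply: eq_bigr => f _.
by case: separable_poly; rewrite ?mul1r ?mul0r.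
Qed.

Lemma even_maximal : 2%:R * count2 n b1 b2 (maximal_weight K) = count1 n b1 (maximal_weight K).
Proof.
apply: (even_transfer (W := @maximal_weight 2 rat) (WC := @maximal_weight 2 algC)) => [f|f|];
  rewrite ?ratr_maximal_weight //.
by apply: count_even => // u u2; rewrite maximal_sum_even // ltnW.
Qed.

End EvenIdentities.

Lemma ratio_difference (R : numFieldType) (p n : nat) (c1 c2 X : R) : prime p -> (2 < n)%N ->
  p%:R ^+ 2 * c2 - p%:R * c1 = X ->
  c2 / p%:R ^+ (n - 2) = c1 / p%:R ^+ (n - 1) + X / p%:R ^+ n.
Proof.
move=> p_pr n_gt2 <-; have p0 : (p%:R : R) != 0 by rewrite pnatr_eq0 -lt0n prime_gt0.
have -> : p%:R ^+ n = p%:R ^+ 2 * p%:R ^+ (n - 2) :> R by rewrite -exprD subnKC // ltnW.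
have -> : p%:R ^+ (n - 1) = p%:R * p%:R ^+ (n - 2) :> R by rewrite -exprS; congr (_ ^+ _); lia.
by field; rewrite p0 expf_neq0.
Qed.

Section Densities.
Variables (R : realType) (n p : nat) (p_pr : prime p) (b1 b2 : padic p_pr).
Local Notation Zp := (padic p_pr).
Local Open Scope classical_set_scope.
Hypothesis n_gt2 : (2 < n)%N.
Local Notation red := (map_poly (@residue p p_pr)).

Lemma red_top_poly (c1 c2 : Zp) : red (top_poly n c1 c2) = top_poly n (residue c1) (residue c2).
Proof.
apply/polyP => i; rewrite coef_red !coef_top_poly.
by rewrite 2!rmorphD /= 2!rmorphM /= !rmorph_nat.
Qed.

Lemma V_fix2_family : V_fix2 n b1 b2 = top_family (n - 2) (top_poly n b1 b2).
Proof.
apply/seteqP; split=> f /=; rewrite /V_fix2 /= fix2P ?(ltnW n_gt2) //.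
  by move=> [u ->]; exists u.
by move=> [u _ <-]; exists u.
Qed.

Lemma V_fix1_family : V_fix1 n b1 = top_family (n - 1) (top_poly n b1 0).
Proof.
apply/seteqP; split=> f /=; rewrite /V_fix1 /= fix1P ?(ltnW n_gt2) //.
  by move=> [u ->]; exists u.
by move=> [u _ <-]; exists u.
Qed.

Lemma top_poly_low2 i : (i < n - 2)%N -> (top_poly n b1 b2)`_i = 0.
Proof.
by move=> lt; rewrite coef_top_poly !ltn_eqF ?mulr0 ?addr0 //; lia.
Qed.

Lemma top_poly_low1 i : (i < n - 1)%N -> (top_poly n b1 0)`_i = 0.
Proof.
by move=> lt; rewrite coef_top_poly mul0r !ltn_eqF ?mulr0 ?addr0 //; lia.
Qed.

Let n_gt1 : (1 < n)%N := ltnW n_gt2.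
Let n_gt0 : (0 < n)%N := ltnW n_gt1.

Variable mu : {measure set (Zp_borel p_pr (n - 2)) -> \bar R}.
Variable mu' : {measure set (Zp_borel p_pr (n - 1)) -> \bar R}.
Hypotheses (mu_haar : is_haar mu) (mu'_haar : is_haar mu').

Local Notation V := (V_fix2 n b1 b2).
Local Notation V' := (V_fix1 n b1).
Local Notation count2 := (count2 n (residue b1) (residue b2)).
Local Notation count1 := (count1 n (residue b1)).

Let half_le2 : (n./2 <= n - 2)%N. Proof. by clear -n_gt2; lia. Qed.
Let half_le1 : (n./2 <= n - 1)%N. Proof. by clear -n_gt2; lia. Qed.
Let d_gt0 : (0 < n - 2)%N. Proof. by rewrite subn_gt0. Qed.
Let d'_gt0 : (0 < n - 1)%N. Proof. by rewrite subn_gt0. Qed.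
Let T2 := top_poly_monic_size n_gt1 b1 b2.
Let T1 := top_poly_monic_size n_gt1 b1 0.
Let le2 : (n - 2 <= n)%N := leq_subr 2 n.
Let le1 : (n - 1 <= n)%N := leq_subr 1 n.

Lemma P0sqf_count2 : P0sqf mu V = count2 (fun f => (separable_poly f)%:R : R) / p%:R ^+ (n - 2).
Proof.
rewrite V_fix2_family (P0sqf_family T2.1 T2.2 le2 top_poly_low2 mu_haar n_gt0).
by rewrite count2E // red_top_poly.
Qed.

Lemma P0sqf_count1 : P0sqf mu' V' = count1 (fun f => (separable_poly f)%:R : R) / p%:R ^+ (n - 1).
Proof.
rewrite V_fix1_family (P0sqf_family T1.1 T1.2 le1 top_poly_low1 mu'_haar n_gt0).
by rewrite count1E // red_top_poly rmorph0.
Qed.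

Lemma Pmax_count2 : Pmax mu V = count2 (maximal_weight R) / p%:R ^+ (n - 2).
Proof.
rewrite V_fix2_family (Pmax_family T2.1 T2.2 le2 top_poly_low2 mu_haar n_gt0 half_le2).
by rewrite count2E // red_top_poly.
Qed.

Lemma Pmax_count1 : Pmax mu' V' = count1 (maximal_weight R) / p%:R ^+ (n - 1).
Proof.
rewrite V_fix1_family (Pmax_family T1.1 T1.2 le1 top_poly_low1 mu'_haar n_gt0 half_le1).
by rewrite count1E // red_top_poly rmorph0.
Qed.

Lemma P1sqf_count2 : P1sqf mu V =
  (1 - 1 / p%:R) * count2 (fun f => (has_simple_double_root f)%:R : R) / p%:R ^+ (n - 2).
Proof.
rewrite V_fix2_family (P1sqf_family T2.1 T2.2 le2 top_poly_low2 mu_haar n_gt0 d_gt0).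
by rewrite -mulr_sumr count2E // red_top_poly.
Qed.

Lemma P1sqf_count1 : P1sqf mu' V' =
  (1 - 1 / p%:R) * count1 (fun f => (has_simple_double_root f)%:R : R) / p%:R ^+ (n - 1).
Proof.
rewrite V_fix1_family (P1sqf_family T1.1 T1.2 le1 top_poly_low1 mu'_haar n_gt0 d'_gt0).
by rewrite -mulr_sumr count1E // red_top_poly rmorph0.
Qed.

Lemma P1sqf_V_even : ~~ odd p -> P1sqf mu V = 0.
Proof.
rewrite V_fix2_family.
exact: (P1sqf_even T2.1 T2.2 le2 top_poly_low2 mu_haar n_gt0 d_gt0).
Qed.

End Densities.

Lemma Fp_natr_eq0 p n : prime p -> ((n%:R : 'F_p) == 0) = (p %| n)%N.
Proof. by move=> p_pr; rewrite -(dvdn_pcharf (pchar_Fp p_pr)). Qed.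

(** Covers the odd cases at once: t = 1, c = 1 when p divides n and b_1; t = 0 with c the symbol of
    n when p does not divide n; and c = 0 when p divides n only. *)
Lemma double_root_value_Hsum (R : realType) (p n t : nat) (c : int) (b1 b2 b : 'F_p) : (2 < n)%N ->
  (forall m, dual_value n b1 b2 m = c * delta (m + t) b) ->
  \sum_(k < n.-1) (-1) ^+ uphalf k * (legendre (2%:R : 'F_p))%:~R ^+ k./2 *
      (if (p %| n - k)%N then p%:R * (dual_value n b1 b2 (uphalf k))%:~R
       else (legendre ((n - k)%:R : 'F_p))%:~R * (dual_value n b1 b2 (uphalf k).+1)%:~R)
  = (c * Hsum n t b)%:~R :> R.
Proof.
move=> n2 dv; rewrite /Hsum (_ : (n - 2).+1 = n.-1); last by lia.
rewrite [X in X + _]big_mkcond [X in _ + X]big_mkcond -big_split /= big_mkord.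
rewrite mulr_sumr rmorph_sum; apply: eq_bigr => k _.
case: ifP => _ /=; rewrite !dv ?add0r ?addr0 !(rmorphM, rmorphXn) /= rmorphN1; first by ring.
by rewrite addSn addnAC addn1 addSn; ring.
Qed.

(** * The four cases assembled *)

Local Open Scope classical_set_scope.
Local Open Scope ring_scope.

Theorem theorem4p1 (R : realType) (n p : nat) (p_pr : prime p)
    (b1 b2 : padic p_pr)
    (mu : {measure set (Zp_borel p_pr (n - 2)) -> \bar R})
    (mu' : {measure set (Zp_borel p_pr (n - 1)) -> \bar R}) :
  (3 <= n)%N -> is_haar mu -> is_haar mu' ->
  let V := V_fix2 n b1 b2 in
  let V' := V_fix1 n b1 in
  let pR : R := p%:R in
  let leg (a : nat) : R := (legendre (a%:R : 'F_p))%:~R in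
  let dl (m : nat) (b : 'F_p) : R := (delta m b)%:~R in
  let HH (t : nat) (b : 'F_p) : R := (Hsum n t b)%:~R in
  [/\ (p = 2%N ->
       [/\ P1sqf mu V = 0,
           Pmax mu V = Pmax mu' V' &
           P0sqf mu V = P0sqf mu' V']),
      (odd p -> (p %| n)%N -> ~ pdvd 1 b1 ->
       [/\ Pmax mu V = Pmax mu' V',
           P0sqf mu V = P0sqf mu' V' &
           P1sqf mu V = P1sqf mu' V']),
      (odd p -> (p %| n)%N -> pdvd 1 b1 ->
       let beta : 'F_p := 2%:R * residue b2 in
       [/\ Pmax mu V = Pmax mu' V' + (-1) ^+ n./2 / pR ^+ (n + n./2)%N
             * leg 2%N ^+ n./2 * dl (uphalf n + 1)%N beta,
           P0sqf mu V = P0sqf mu' V' + (-1) ^+ n./2 / pR ^+ n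
             * leg 2%N ^+ n./2 * dl (uphalf n + 1)%N beta &
           P1sqf mu V = P1sqf mu' V' + (-1) ^+ n * (1 - 1 / pR) / pR ^+ n
             * HH 1%N beta]) &
      (odd p -> ~~ (p %| n)%N ->
       let beta : 'F_p :=
         2%:R * residue b2 - (1 - 1 / n%:R) * residue b1 ^+ 2 in
       [/\ Pmax mu V = Pmax mu' V' + (-1) ^+ n./2 / pR ^+ (n + n./2)%N
             * leg n * leg 2%N ^+ n./2 * dl (uphalf n) beta,
           P0sqf mu V = P0sqf mu' V' + (-1) ^+ n./2 / pR ^+ n
             * leg n * leg 2%N ^+ n./2 * dl (uphalf n) beta &
           P1sqf mu V = P1sqf mu' V' + (-1) ^+ n * (1 - 1 / pR) / pR ^+ n
             * leg n * HH 0%N beta])].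
Proof.
move=> n3 hmu hmu' V V' pR leg dl HH.
have p0 : pR != 0 by rewrite pnatr_eq0 -lt0n prime_gt0.
have n2 : (2 < n)%N := n3.
pose dv := dual_value n (residue b1) (residue b2).
(* The three odd cases differ only in the value of [dv]. *)
have odd_diff : odd p ->
  [/\ Pmax mu V = Pmax mu' V'
        + (-1) ^+ n./2 * leg 2%N ^+ n./2 * (dv (uphalf n))%:~R / pR ^+ n./2 / pR ^+ n,
      P0sqf mu V = P0sqf mu' V' + (-1) ^+ n./2 * leg 2%N ^+ n./2 * (dv (uphalf n))%:~R / pR ^+ n &
      forall t c (b : 'F_p), (forall m, dv m = c * delta (m + t) b) ->
      P1sqf mu V = P1sqf mu' V' + (-1) ^+ n * (1 - 1 / pR) / pR ^+ n * (c * Hsum n t b)%:~R].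
  move=> po; split.
  - rewrite (Pmax_count2 b1 b2 n2 hmu) (Pmax_count1 b1 n2 hmu').
    exact: (ratio_difference p_pr n2 (odd_maximal p_pr _ _ n2 R po)).
  - rewrite (P0sqf_count2 b1 b2 n2 hmu) (P0sqf_count1 b1 n2 hmu').
    exact: (ratio_difference p_pr n2 (odd_separable p_pr _ _ n2 R po)).
  move=> t c b dvE; rewrite (P1sqf_count2 b1 b2 n2 hmu) (P1sqf_count1 b1 n2 hmu').
  rewrite -[LHS]mulrA (ratio_difference p_pr n2 (odd_double_root p_pr _ _ n2 R po)).
  rewrite (double_root_value_Hsum R n2 dvE) -/pR; ring.
split.
- move=> p2; subst p.
  (* V' has one more free coefficient than V, so 2 c2 = c1 for the counts is equality of the
     densities. *)
  have half (c1 c2 : R) : 2%:R * c2 = c1 -> c2 / 2%:R ^+ (n - 2) = c1 / 2%:R ^+ (n - 1).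
    have -> : (n - 1 = (n - 2).+1)%N by lia.
    by move=> <-; rewrite exprS; field; rewrite expf_neq0.
  split; first by rewrite P1sqf_V_even.
    rewrite (Pmax_count2 b1 b2 n2 hmu) (Pmax_count1 b1 n2 hmu'); apply: half.
    exact: even_maximal.
  rewrite (P0sqf_count2 b1 b2 n2 hmu) (P0sqf_count1 b1 n2 hmu'); apply: half.
  exact: even_separable.
- move=> po pn pb1; have [dmax dsep ddbl] := odd_diff po.
  have dv0 m : dv m = 0.
    rewrite /dv /dual_value (Fp_natr_eq0 _ p_pr) pn; case: eqP => // /residue_eq0 //.
  rewrite dmax dsep !dv0 (ddbl 0%N 0 0) => [|m]; last by rewrite dv0 mul0r.
  by rewrite !(mulr0, mul0r, addr0).
- move=> po pn pb1 beta; have [dmax dsep ddbl] := odd_diff po.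
  have dvE m : dv m = delta (m + 1) beta.
    by rewrite /dv /dual_value (Fp_natr_eq0 _ p_pr) pn (iffRL (residue_eq0 _) pb1) eqxx.
  rewrite dmax dsep dvE (ddbl 1%N 1 beta) => [|m]; last by rewrite dvE mul1r.
  rewrite (mul1r (Hsum n 1 beta)).
  by split; rewrite ?exprD //; congr (_ + _); rewrite /dl; field; rewrite !expf_neq0.
move=> po pn beta; have [dmax dsep ddbl] := odd_diff po.
have dvE m : dv m = legendre (n%:R : 'F_p) * delta m beta.
  by rewrite /dv /dual_value (Fp_natr_eq0 _ p_pr) (negPf pn).
rewrite dmax dsep dvE (ddbl 0%N (legendre (n%:R : 'F_p)) beta) => [|m]; last by rewrite dvE addn0.
by split; rewrite /dl ?exprD ?rmorphM /=; congr (_ + _); field; rewrite !expf_neq0.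
Qed.
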